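(* Let $(a_n)_{n\ge1}$ be an increasing sequence of positive real numbers such that $\lim_{n\to\infty} a_n/\log n=\infty$, and such that there is $C>0$ with $a_{n+1}-a_n\ge n^{-C}$ for all sufficiently large $n$. Then for Lebesgue-almost every $\alpha>0$, the sequence $(\{e^{\alpha a_n}\})_{n\ge1}$ has Poissonian $k$-point correlation for every integer $k\ge2$.
   Context: For a real sequence $\vartheta=(\vartheta_n)_{n\ge1}$, an integer $k\ge2$ and $N\ge1$, let $\mathcal{B}_k=\mathcal{B}_k(N)$ be the set of integer $k$-tuples $\mathbf{x}=(x_1,\dots,x_k)$ with all $x_i\in\{1,\dots,N\}$ and no two components equal. Let $\Delta(\mathbf{x},\vartheta)=(\vartheta_{x_1}-\vartheta_{x_2},\dots,\vartheta_{x_{k-1}}-\vartheta_{x_k})\in\mathbb{R}^{k-1}$. For compactly supported $f:\mathbb{R}^{k-1}\to\mathbb{R}$ define $R_k(f,\vartheta,N)=\frac1N\sum_{\mathbf{x}\in\mathcal{B}_k}\sum_{\mathbf{m}\in\mathbb{Z}^{k-1}} f\big(N(\Delta(\mathbf{x},\vartheta)-\mathbf{m})\big)$. The $k$-point correlation of $(\{\vartheta_n\})_{n\ge1}$ is Poissonian if $\lim_{N\to\infty}R_k(f,\vartheta,N)=\int_{\mathbb{R}^{k-1}}f(\mathbf{x})\,d\mathbf{x}$ for every real-valued smooth compactly supported $f$ on $\mathbb{R}^{k-1}$. $\{\cdot\}$ denotes the fractional part. *)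

(* Defs.v *)
From HB Require Import structures.
From mathcomp Require Import all_boot all_order all_algebra.
From mathcomp Require Import all_classical all_reals all_analysis.
From mathcomp Require Import ring.

Set Implicit Arguments.
Unset Strict Implicit.
Unset Printing Implicit Defensive.

Import Order.TTheory GRing.Theory Num.Theory.
Import numFieldNormedType.Exports.

Local Open Scope classical_set_scope.
Local Open Scope ring_scope.

(* Lebesgue measure on R^n is built as the n-fold product of the
   one-dimensional one. It lives on n.-tuple R, whose sigma-algebra is the one
   generated by the coordinates, i.e. the Borel sets. *)

Section product_cons.
Context d (T : measurableType d) (R : realType) (n : nat).
Variable nu : {sigma_finite_measure set T -> \bar R}.
Variable mu : {sigma_finite_measure set (n.-tuple T) -> \bar R}.

Definition tcons (p : T * n.-tuple T) : n.+1.-tuple T := [tuple of p.1 :: p.2].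

Let tuncons (t : n.+1.-tuple T) : T * n.-tuple T :=
  (thead t, [tuple of behead t]).

Lemma measurable_tcons : measurable_fun [set: T * n.-tuple T] tcons.
Proof. exact: measurable_cons. Qed.

Let measurable_tuncons : measurable_fun [set: n.+1.-tuple T] tuncons.
Proof.
by apply: measurable_fun_pair; [exact: measurable_tnth|exact: measurable_behead].
Qed.

Lemma tcons_preimage (A : set T) (B : set (n.-tuple T)) :
  tcons @^-1` (tuncons @^-1` (A `*` B)) = A `*` B.
Proof.
rewrite -comp_preimage (_ : tuncons \o tcons = id) ?preimage_id//.
by apply/funext => -[x t]; rewrite /tuncons /tcons /= theadE; congr pair; exact/val_inj.
Qed.

Definition product_cons : set (n.+1.-tuple T) -> \bar R :=
  pushforward (nu \x mu)%E tcons.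

HB.instance Definition _ := Measure.copy product_cons
  (measure_function_pushforward__canonical__measure_function_Measure
    (nu \x mu)%E measurable_tcons).

Let product_cons_sigma_finite : sigma_finite setT product_cons.
Proof.
have /sigma_finiteP[F [TF ndF Foo]] := sigma_finiteT nu.
have /sigma_finiteP[G [TG ndG Goo]] := sigma_finiteT mu.
exists (fun i => tuncons @^-1` (F i `*` G i)).
  apply/esym; rewrite -subTset => t _.
  have [i _ Fi] : (\bigcup_i F i) (thead t) by rewrite -TF.
  have [j _ Gj] : (\bigcup_i G i) [tuple of behead t] by rewrite -TG.
  exists (maxn i j) => //; split => /=.
  - by move: Fi; exact/subsetPset/ndF/leq_maxl.
  - by move: Gj; exact/subsetPset/ndG/leq_maxr.
move=> i; have [mF Fi] := Foo i; have [mG Gi] := Goo i; split.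
  rewrite -[X in measurable X]setTI; apply: measurable_tuncons => //.
  exact: measurableX.
rewrite /product_cons /pushforward tcons_preimage product_measure1E//.
by rewrite lte_mul_pinfty// ge0_fin_numE.
Qed.

HB.instance Definition _ := Measure_isSigmaFinite.Build _ _ _ product_cons
  product_cons_sigma_finite.

End product_cons.

Fixpoint lebesgue_tuple (R : realType) (n : nat) :
    {sigma_finite_measure set (n.-tuple (measurableTypeR R)) -> \bar R} :=
  match n with
  | 0 => \d_([tuple])
  | m.+1 => product_cons (@lebesgue_measure R) (lebesgue_tuple R m)
  end.

Lemma lebesgue_tuple_box (R : realType) (n : nat)
    (A : 'I_n -> set (measurableTypeR R)) :
  (forall i, measurable (A i)) ->
  lebesgue_tuple R n [set t | forall i, A i (tnth t i)] =
  (\prod_(i < n) lebesgue_measure (A i))%E.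
Proof.
elim: n A => [A _|n IHn A mA].
  rewrite big_ord0 /= diracE mem_set//= => -[] //.
rewrite big_ord_recl -IHn//= /product_cons /pushforward.
rewrite -product_measure1E//.
  congr (product_measure1 _ _ _); apply/seteqP; split => -[x t] /=.
    move=> At; split; first exact: (At ord0).
    by move=> i; have := At (lift ord0 i); rewrite /tcons tnthS.
  move=> [Ax At] i; case: (unliftP ord0 i) => [j ->|->]; last exact: Ax.
  by rewrite /tcons tnthS.
rewrite (_ : mkset _ =
    \bigcap_(i in [set: 'I_n]) ((@tnth n _)^~ i @^-1` A (lift ord0 i))).
  apply: fin_bigcap_measurable => // i _.
  by rewrite -[X in measurable X]setTI; apply: measurable_tnth.
by apply/seteqP; split => t /= At i; [move=> _|]; apply: At.
Qed.

Definition integral_rV (R : realType) (n : nat) (f : 'rV[R]_n -> R) : R :=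
  \int[lebesgue_tuple R n]_t f (\row_(i < n) tnth t i).

(* C^p on R^n: f is continuous and, if p > 0, all its first-order partial
   derivatives exist everywhere and are C^(p-1). *)
Fixpoint continuously_derivable (R : realType) (n p : nat) (f : 'rV[R]_n -> R)
    : Prop :=
  continuous f /\
  match p with
  | 0 => True
  | q.+1 => forall i : 'I_n,
      (forall x, derivable f x (delta_mx 0 i)) /\
      continuously_derivable q (fun x => 'D_(delta_mx 0 i) f x)
  end.

Definition smooth (R : realType) (n : nat) (f : 'rV[R]_n -> R) : Prop :=
  forall p, continuously_derivable p f.

Definition compactly_supported (R : realType) (n : nat) (f : 'rV[R]_n -> R)
    : Prop :=
  compact (closure [set x | f x != 0]).

Definition fractional_part (R : realType) (x : R) : R := x - (Num.floor x)%:~R.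

Definition distinct_tuples (k N : nat) : {set k.-tuple 'I_N.+1} :=
  [set x : k.-tuple 'I_N.+1 | uniq x & all (fun j : 'I_N.+1 => 0 < j)%N x].

(* The default value ord0 of nth is never used: i.+1 < k whenever i < k.-1. *)
Definition gaps (R : realType) (k N : nat) (x : k.-tuple 'I_N.+1)
    (theta : nat -> R) : 'rV[R]_k.-1 :=
  \row_(i < k.-1) (theta (nth ord0 x i) - theta (nth ord0 x i.+1)).

(* For compactly supported f and N > 0 only finitely many m contribute, so the
   finitely supported sum over Z^(k-1) is the full sum. *)
Definition correlation (R : realType) (k : nat) (f : 'rV[R]_k.-1 -> R)
    (theta : nat -> R) (N : nat) : R :=
  N%:R^-1 * \sum_(x in distinct_tuples k N)
    \sum_(m \in [set: 'rV[int]_k.-1])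
      f (N%:R *: (gaps x theta - map_mx intr m)).

(* The k-point correlation of the fractional parts of theta is Poissonian; theta
   may be replaced by those fractional parts, by correlation_fractional_part. *)
Definition poissonian (R : realType) (k : nat) (theta : nat -> R) : Prop :=
  forall f : 'rV[R]_k.-1 -> R, smooth f -> compactly_supported f ->
    correlation f theta N @[N --> \oo] --> integral_rV f.

Lemma correlation_fractional_part (R : realType) (k : nat) (f : 'rV[R]_k.-1 -> R)
    (theta : nat -> R) (N : nat) :
  correlation f (fun n => fractional_part (theta n)) N = correlation f theta N.
Proof.
rewrite /correlation; congr (_ * _); apply: eq_bigr => x _.
pose s : 'rV[int]_k.-1 := \row_(i < k.-1)
  (Num.floor (theta (nth ord0 x i)) - Num.floor (theta (nth ord0 x i.+1))).
rewrite [RHS](reindex_fsbigT (fun m => m + s)); last first.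
  by exists (fun m => m - s) => m; rewrite (addrK, subrK).
apply: eq_fsbigr => m _; congr (f (_ *: _)); apply/rowP => i.
rewrite !mxE /fractional_part !intrD rmorphN /=; ring.
Qed.

(* Main.v *)
(** For nonnegative tents the correlations converge almost surely along N = m^4,
by a second moment bound and Borel-Cantelli; the limit for all N and all test
functions then follows deterministically, sandwiching a test function between
combinations of the countably many tents.

The moments are integrals over a compact interval of alpha of products of tents
in differences of the phases e^(alpha a_v).  A finite Fejer approximation
replaces each tent by a trigonometric sum of length polynomial in m, so it is
enough that the integral of cos(2 pi sum_i u_i e^(alpha a_i)) is smaller than any
prescribed power of 1/m as soon as some u_i with a large index i (i^k > m) is
nonzero.  If a_j is the largest frequency present, the derivative of the phase
is K e^(alpha a_j) h(alpha) with h = 1 + sum_i c_i e^(-alpha d_i) and gaps d_i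
that are at least a negative power of m.  Off a bounded number of short
intervals, h is bounded below by a power of 1/m (induction on the number of
terms: multiply by e^(alpha d) for the largest gap d and differentiate), whereas
e^(alpha a_j) exceeds every power of m since a_n / log n tends to infinity; one
integration by parts concludes.

Two disjoint tuples of large indices are thus almost uncorrelated.  A pair of
tuples with a common index, or a tuple with a small index r, is dominated by a
product of wider tents centred at the phase of r, whose mean is computed the
same way; there are too few such configurations to matter. *)
Require Import Defs.
From HB Require Import structures.
From mathcomp Require Import all_boot all_order all_algebra.
From mathcomp Require Import all_classical all_reals all_analysis.
From mathcomp Require Import (coercions) finmap.
From mathcomp Require Import ring lra zify measurable_realfun.

Set Implicit Arguments.
Unset Strict Implicit.
Unset Printing Implicit Defensive.

Import Order.TTheory GRing.Theory Num.Theory.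
Import numFieldNormedType.Exports.

Local Open Scope classical_set_scope.
Local Open Scope ring_scope.

(** * Integrals of continuous functions over segments *)

Section Integral.
Variable R : realType.
Implicit Types (a b c : R) (f g F : R -> R).

(** A factor can be peeled off when one of its endpoints oscillates and occurs in no other remaining
    factor. A chain through distinct large indices, or two disjoint ones, can be peeled completely.
    Two chains with a common index may close a cycle, and a small index offers no oscillation; both
    are compared with a star, a tree whose large leaves are peeled while its centre, possibly small,
    never is. This loses a constant factor, affordable where only an upper bound is asked for.

    All errors are fixed powers of m. Summing over pairs of k-tuples up to N = m^4 costs about
    N^(2k) = m^(8k), so each mean is needed up to m^-(8k). This fixes the degree of the
    trigonometric sums and the lower bound for h as powers of m, and growth of a_n beyond every
    multiple of log n makes e^(alpha a_v) exceed them all, uniformly in v^k > m.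

    The variance is O(1/N) and the small indices contribute O(m/N): at N = m^4 both are summable in
    m, while (m+1)^4 / m^4 tends to 1, so that a nonnegative correlation is caught between
    neighbouring fourth powers. *)

Definition Int a b f : R := \int[@lebesgue_measure R]_(x in `[a, b]) f x.

Lemma continuous_integrable a b f : continuous f ->
  (@lebesgue_measure R).-integrable `[a, b] (EFin \o f).
Proof.
move=> cf; apply: continuous_compact_integrable; first exact: segment_compact.
exact: continuous_subspaceT.
Qed.

Lemma eq_Int a b f g : {in `[a, b], f =1 g} -> Int a b f = Int a b g.
Proof. by move=> fg; apply: eq_Rintegral => x; rewrite inE => /fg. Qed.

Lemma IntD a b f g : continuous f -> continuous g ->
  Int a b (fun x => f x + g x) = Int a b f + Int a b g.
Proof. by move=> cf cg; apply: RintegralD => //; exact: continuous_integrable. Qed.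

Lemma IntB a b f g : continuous f -> continuous g ->
  Int a b (fun x => f x - g x) = Int a b f - Int a b g.
Proof. by move=> cf cg; apply: RintegralB => //; exact: continuous_integrable. Qed.

Lemma IntZ a b r f : continuous f -> Int a b (fun x => r * f x) = r * Int a b f.
Proof. by move=> cf; apply: RintegralZl => //; exact: continuous_integrable. Qed.

Lemma continuous_mul f g : continuous f -> continuous g -> continuous (fun x => f x * g x).
Proof. by move=> cf cg x; apply: continuousM; [exact: cf|exact: cg]. Qed.

Lemma continuous_add f g : continuous f -> continuous g -> continuous (fun x => f x + g x).
Proof. by move=> cf cg x; apply: continuousD; [exact: cf|exact: cg]. Qed.

Lemma continuous_scale c f : continuous f -> continuous (fun x => c * f x).
Proof. by move=> cf; apply: continuous_mul => // x; exact: cst_continuous. Qed.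

Lemma continuous_compose f g : continuous f -> continuous g -> continuous (fun x => f (g x)).
Proof. by move=> cf cg x; apply: continuous_comp; [exact: cg|exact: cf]. Qed.

Lemma continuous_sum (I : Type) (s : seq I) (P : pred I) (h : I -> R -> R) :
  (forall i, continuous (h i)) -> continuous (fun x => \sum_(i <- s | P i) h i x).
Proof.
move=> ch; elim: s => [|i s IH] x.
  by under eq_fun do rewrite big_nil; exact: cvg_cst.
under eq_fun do rewrite big_cons; case: (P i); last exact: IH.
by apply: continuousD; [exact: ch|exact: IH].
Qed.

Lemma continuous_prod (I : Type) (s : seq I) (P : pred I) (h : I -> R -> R) :
  (forall i, continuous (h i)) -> continuous (fun x => \prod_(i <- s | P i) h i x).
Proof.
move=> ch; elim: s => [|i s IH] x.
  by under eq_fun do rewrite big_nil; exact: cvg_cst.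
under eq_fun do rewrite big_cons; case: (P i); last exact: IH.
by apply: continuousM; [exact: ch|exact: IH].
Qed.

Lemma Int_sum a b (I : Type) (s : seq I) (P : pred I) (h : I -> R -> R) :
  (forall i, continuous (h i)) ->
  Int a b (fun x => \sum_(i <- s | P i) h i x) = \sum_(i <- s | P i) Int a b (h i).
Proof.
move=> ch; elim: s => [|i s IH].
  rewrite big_nil /Int; under eq_Rintegral do rewrite big_nil.
  by rewrite Rintegral_cst// mul0r.
rewrite big_cons -IH; case Pi: (P i).
  rewrite -IntD//; last exact: continuous_sum.
  by apply: eq_Int => x _; rewrite big_cons Pi.
by apply: eq_Int => x _; rewrite big_cons Pi.
Qed.

Lemma Int_cst a b r : a <= b -> Int a b (fun=> r) = r * (b - a).
Proof.
move=> ab; rewrite /Int Rintegral_cst//; congr (_ * _).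
rewrite [LHS](congr1 fine (lebesgue_measure_itv `[a, b])).
by rewrite /= lte_fin; case: ltgtP ab => // ->; rewrite subrr.
Qed.

Lemma le_Int a b f g : continuous f -> continuous g ->
  {in `[a, b], forall x, f x <= g x} -> Int a b f <= Int a b g.
Proof.
by move=> cf cg fg; apply: le_Rintegral => //; exact: continuous_integrable.
Qed.

Lemma Int_ge0 a b f : {in `[a, b], forall x, 0 <= f x} -> 0 <= Int a b f.
Proof. by move=> f0; apply: Rintegral_ge0 => x /f0. Qed.

Lemma Int_norm_le a b f M : a <= b -> continuous f ->
  {in `[a, b], forall x, `|f x| <= M} -> `|Int a b f| <= M * (b - a).
Proof.
move=> ab cf fM; rewrite ler_norml -mulNr -!Int_cst//.
by apply/andP; split; apply: le_Int => //; try exact: cst_continuous;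
  move=> x /fM; rewrite ler_norml => /andP[].
Qed.

Lemma Int_primitive a b f : a <= b -> continuous f ->
  exists F : R -> R, {in `[a, b], forall x : R, is_derive x 1 F (f x)} /\
    forall x y, a <= x -> x <= y -> y <= b -> Int x y f = F y - F x.
Proof.
(* The base point a - 1, and b + 1 as right end below, put a and b in the interior, where the
   fundamental theorem gives a two-sided derivative. *)
move=> ab cf; exists (fun x => Int (a - 1) x f); split.
  move=> x; rewrite in_itv/= => /andP[ax xb].
  have xu : x < b + 1 by lra.
  have [|||] := @continuous_FTC1_closed R f (a - 1) x (b + 1) xu.
  - exact: continuous_integrable.
  - lra.
  - exact: cf.
  - by move=> dF F'; split; [exact: dF|rewrite -derive1E; exact: F'].
move=> x y ax xy yb; rewrite /Int.
have := @Rintegral_itvB R f (BLeft (a - 1)) (BRight y) x.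
rewrite !bnd_simp => ->//; last by lra.
- rewrite -Rintegral_itv_obnd_cbnd//.
  apply: integrableS (continuous_integrable x y cf) => //.
  exact: subset_itv_oc_cc.
- exact: continuous_integrable.
Qed.

Lemma Int_split a b c f : continuous f -> a <= c -> c <= b ->
  Int a b f = Int a c f + Int c b f.
Proof.
move=> cf ac cb; have ab := le_trans ac cb.
have [F [_ FE]] := Int_primitive ab cf.
by rewrite !FE//; ring.
Qed.

(** Integration by parts will be used in this form: [G] is only an approximate primitive, and the
    mean value theorem for its difference with an exact one bounds the error. *)
Lemma Int_le_primitive a b f G g D : a <= b -> continuous f ->
  {in `[a, b], forall x : R, is_derive x 1 G (g x)} ->
  {in `[a, b], forall x, `|f x - g x| <= D} ->
  `|Int a b f| <= `|G b - G a| + D * (b - a).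
Proof.
move=> ab cf dG fg.
have [F [dF FE]] := Int_primitive ab cf.
have [||c cab E] := @MVT_segment R (fun x => F x - G x) (fun x => f x - g x) a b ab.
- move=> x xab; have {}xab : x \in `[a, b] by exact: subset_itv_oo_cc xab.
  by apply: is_deriveB; [exact: dF|exact: dG].
- apply: derivable_within_continuous => x xab.
  by apply: derivableB; [case: (dF _ xab)|case: (dG _ xab)].
rewrite FE// (_ : F b - F a = (G b - G a) + (F b - G b - (F a - G a))); last by ring.
rewrite E (le_trans (ler_normD _ _))// lerD2l normrM.
by rewrite (ger0_norm (_ : 0 <= b - a)) ?subr_ge0// ler_wpM2r ?subr_ge0// fg.
Qed.

End Integral.

(** * Oscillatory integrals of exponential phases *)

Section Oscillation.
Variable R : realType.
Implicit Types (a b c e x w lam : R) (P Q : R -> Prop) (s : seq (R * R)).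

(** The number of pieces is what an integral pays for: short pieces are bounded by their length,
    good ones by one integration by parts each. *)
Inductive piecewise P e : nat -> R -> R -> Prop :=
| piecewise_short a b : a <= b -> b - a <= e -> piecewise P e 1 a b
| piecewise_good a b : a <= b -> {in `[a, b], forall x, P x} -> piecewise P e 1 a b
| piecewise_cat m n a c b : piecewise P e m a c -> piecewise P e n c b -> piecewise P e (m + n) a b.

Lemma piecewise_le P e n a b : piecewise P e n a b -> a <= b.
Proof. by elim=> // {}n m {}a c {}b _ ac _; apply: le_trans. Qed.

Lemma piecewise_refine P Q e k n a b : piecewise P e n a b ->
  (forall c d, a <= c -> c <= d -> d <= b -> {in `[c, d], forall x, P x} ->
     exists2 m, (m <= k)%N & piecewise Q e m c d) -> (0 < k)%N ->
  exists2 m, (m <= k * n)%N & piecewise Q e m a b.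
Proof.
move=> cov + k0; elim: cov => {n a b}.
- by move=> a b ab abe _; exists 1%N; [rewrite muln1|exact: piecewise_short].
- by move=> a b ab abP H; rewrite muln1; apply: H.
move=> n n' a c b cov1 IH1 cov2 IH2 H.
have ac := piecewise_le cov1; have cb := piecewise_le cov2.
have [|m1 m1k c1] := IH1.
  by move=> x y ax xy yc; apply: H => //; exact: le_trans cb.
have [|m2 m2k c2] := IH2.
  by move=> x y cx xy yb; apply: H => //; exact: le_trans cx.
by exists (m1 + m2)%N; [rewrite mulnDr leq_add|exact: piecewise_cat c1 c2].
Qed.

(** By the intermediate value theorem [g'] keeps its sign, so [g] is monotone with slope at least
    [kappa] in size. The point [z] is a zero of [g] or, failing that, the endpoint where |g| is
    smallest. *)
Lemma slope_away_from_point (g g' : R -> R) a b kappa : a <= b -> 0 < kappa ->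
  (forall x : R, is_derive x 1 g (g' x)) -> continuous g' ->
  {in `[a, b], forall x, kappa <= `|g' x|} ->
  exists2 z, z \in `[a, b] & {in `[a, b], forall x, kappa * `|x - z| <= `|g x|}.
Proof.
move=> ab k0; wlog ga : g g' / 0 <= g' a.
  move=> W dg cg gk; case: (lerP 0 (g' a)) => ga; first exact: W ga dg cg gk.
  have [|||z zab H] := W (fun x => - g x) (fun x => - g' x).
  - lra.
  - by move=> x; apply: continuousN; exact: cg.
  - by move=> x /gk; rewrite normrN.
  by exists z => // x /H; rewrite normrN.
move=> dg cg' gk.
have cg : continuous g.
  by move=> x; apply: differentiable_continuous; apply/derivable1_diffP; case: (dg x).
have gpos : {in `[a, b], forall x, kappa <= g' x}.
  move=> x xab; rewrite leNgt; apply/negP => gx.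
  have := gk _ xab; rewrite ler_normr leNgt gx/= => gx'.
  have ax : a <= x by move: xab; rewrite in_itv/= => /andP[].
  have [||c cax c0] := @IVT R g' a x 0 ax.
  - exact: continuous_subspaceT.
  - rewrite ge_min le_max ga /=; apply/andP; split => //; apply/orP; right; lra.
  have : c \in `[a, b].
    by move: cax xab; rewrite !in_itv/= => /andP[-> cx] /andP[_]; exact: le_trans.
  by move/gk; rewrite c0 normr0 leNgt k0.
have incr x y : a <= x -> x <= y -> y <= b -> kappa * (y - x) <= g y - g x.
  move=> ax xy yb; have [|c cxy ->] := @MVT_segment R g g' x y xy (fun z _ => dg z).
    exact: continuous_subspaceT.
  rewrite ler_wpM2r ?subr_ge0//; apply: gpos.
  move: cxy; rewrite !in_itv/= => /andP[xc cy]; apply/andP; split; lra.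
have away z : z \in `[a, b] -> (a < z -> g z <= 0) -> (z < b -> 0 <= g z) ->
    {in `[a, b], forall x, kappa * `|x - z| <= `|g x|}.
  rewrite in_itv/= => /andP[az zb] Hl Hr x; rewrite in_itv/= => /andP[ax xb].
  case: (ltgtP x z) => [xz|zx|->]; last by rewrite subrr normr0 mulr0.
    rewrite ltr0_norm ?subr_lt0// opprB.
    have := incr x z ax (ltW xz) zb; have := Hl (le_lt_trans ax xz) => gz.
    by rewrite ler_normr => H; apply/orP; right; lra.
  rewrite gtr0_norm ?subr_gt0//.
  have := incr z x az (ltW zx) xb; have := Hr (lt_le_trans zx xb) => gz.
  by rewrite ler_normr => H; apply/orP; left; lra.
have [g0|g0] := leP 0 (g a).
  exists a; first by rewrite in_itv/= lexx.
  by apply: away => //; rewrite ?in_itv/= ?lexx// ltxx.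
have [gb|gb] := leP (g b) 0.
  exists b; first by rewrite in_itv/= lexx ab.
  by apply: away => //; rewrite ?in_itv/= ?lexx ?ab// ltxx.
have [||z zab z0] := @IVT R g a b 0 ab.
- exact: continuous_subspaceT.
- by rewrite ge_min le_max (ltW g0) (ltW gb) orbT.
by exists z => //; apply: away => //; rewrite z0.
Qed.

Lemma piecewise_around P e a b z : 0 <= e -> z \in `[a, b] ->
  {in `[a, b], forall x, e / 2 <= `|x - z| -> P x} ->
  exists2 m, (m <= 3)%N & piecewise P e m a b.
Proof.
rewrite in_itv/= => e0 /andP[az zb] H.
pose l := Num.max a (z - e / 2); pose r := Num.min b (z + e / 2).
have al : a <= l by rewrite le_max lexx.
have lz : l <= z by rewrite ge_max az/=; lra.
have zr : z <= r by rewrite le_min zb/=; lra.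
have rb : r <= b by rewrite ge_min lexx.
exists (1 + (1 + 1))%N => //; apply: (@piecewise_cat _ _ 1 2 _ l); last first.
  apply: (@piecewise_cat _ _ 1 1 _ r).
    apply: piecewise_short; first lra.
    have : z - e / 2 <= l by rewrite le_max lexx orbT.
    have : r <= z + e / 2 by rewrite ge_min lexx orbT.
    lra.
  rewrite /r; case: (leP b (z + e / 2)) => zb'.
    by apply: piecewise_short; rewrite ?subrr.
  apply: piecewise_good; first exact: ltW.
  move=> x; rewrite in_itv/= => /andP[zx xb]; apply: H.
    by rewrite in_itv/= xb andbT; lra.
  by rewrite ler_normr; apply/orP; left; lra.
rewrite /l; case: (leP (z - e / 2) a) => za'.
  by apply: piecewise_short; rewrite ?subrr.
apply: piecewise_good; first exact: ltW.
move=> x; rewrite in_itv/= => /andP[ax xz]; apply: H.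
  by rewrite in_itv/= ax/=; lra.
by rewrite ler_normr; apply/orP; right; lra.
Qed.

(* Up to a factor [K * expR (x * lam)], the derivative of a phase whose largest
   frequency is [lam]; the pairs of [s] are relative coefficients and gaps to [lam]. *)
Definition expsum s x : R := 1 + \sum_(p <- s) p.1 * expR (- (x * p.2)).

Definition expsum' s x : R := - \sum_(p <- s) p.1 * p.2 * expR (- (x * p.2)).

Lemma is_derive_expR_scale c x : is_derive x 1 (fun y => expR (- (y * c))) (- c * expR (- (x * c))).
Proof.
have d1 : is_derive x 1 (fun y : R => - (y * c)) (- c).
  apply: is_deriveN.
  rewrite -[X in is_derive _ _ _ X](_ : x *: (0 : R) + c *: (1 : R) = c).
    exact: is_deriveM.
  by rewrite /GRing.scale/= mulr0 add0r mulr1.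
have := @is_derive1_comp R expR (fun y => - (y * c)) x _ _ (is_derive_expR _) d1.
by rewrite mulrC.
Qed.

Lemma is_derive_expsum s x : is_derive x 1 (expsum s) (expsum' s x).
Proof.
rewrite -[expsum' s x]add0r; apply: is_deriveD; rewrite /expsum'.
elim: s => [|p s IH].
  by under eq_fun do rewrite big_nil; rewrite big_nil oppr0; exact: is_derive_cst.
under eq_fun do rewrite big_cons.
rewrite big_cons opprD; apply: is_deriveD.
rewrite (_ : - (p.1 * p.2 * _) = p.1 * (- p.2 * expR (- (x * p.2)))); last by ring.
exact: is_deriveZ (is_derive_expR_scale _ _).
Qed.

Lemma continuous_expsum s : continuous (expsum s).
Proof.
move=> x; apply: differentiable_continuous; apply/derivable1_diffP.
by case: (is_derive_expsum s x).
Qed.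

End Oscillation.

Section Cover.
Variable R : realType.
Implicit Types (a b c e x w lam : R) (P Q : R -> Prop) (s : seq (R * R)).

(* The recursion is dictated by the induction step of [expsum_piecewise], where
   [k] bounds the ratio of the endpoints of the interval. *)
Fixpoint piecewise_exponent (k r : nat) : nat :=
  if r is r'.+1 then (3 + 2 * k + (1 + k) * piecewise_exponent k r')%N else 0%N.

Lemma norm_expsum_cons (q : R * R) s x :
  `|expsum s x| - `|q.1| * expR (- (x * q.2)) <= `|expsum (q :: s) x|.
Proof.
rewrite lerBlDr.
have -> : expsum s x = expsum (q :: s) x - q.1 * expR (- (x * q.2)).
  by rewrite /expsum big_cons; ring.
by apply: le_trans (ler_normB _ _) _; rewrite normrM (ger0_norm (expR_ge0 _)).
Qed.

(* If the term with the largest gap [d] is negligible, drop it.  Otherwise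
   [expR (x * d)] is at most a power of [w^-1], and [expR (x * d) * expsum s x] has
   derivative [d * expR (x * d)] times a shorter sum. *)
Lemma expsum_piecewise (A B w : R) (k : nat) s :
  0 < A -> A <= B -> B <= A * k%:R -> 0 < w -> w <= 2^-1 ->
  sorted (fun p q => q.2 <= p.2) s ->
  {in s, forall p, w <= p.2} -> {in s, forall p, `|p.1| * w <= 1} ->
  exists2 n, (n <= 3 ^ size s)%N &
    piecewise (fun x => w ^+ piecewise_exponent k (size s) <= `|expsum s x|) w n A B.
Proof.
move=> A0 AB Bk w0 w2; move sz : (size s) => r.
elim: r s sz => [|r IH] [|q s]//=.
  move=> _ _ _ _; exists 1%N => //; apply: piecewise_good => // x _.
  by rewrite /expsum big_nil addr0 normr1.
move=> [sz] srt sw sc.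
set e := piecewise_exponent k r in IH *.
have tau0 : 0 < w ^+ e by rewrite exprn_gt0.
have tau1 : w ^+ e <= 1 by rewrite exprn_ile1//; lra.
(* With tau = w ^+ e, the factor w ^+ 3 * tau is a lower bound for |g|, [g] as below, off the
   exceptional window, and (w ^+ 2 * tau) ^+ k pays for dividing by expR (x * q.2). *)
have final : w ^+ (3 + 2 * k + (1 + k) * e) = w ^+ 3 * (w ^+ e) * (w ^+ 2 * w ^+ e) ^+ k.
  by rewrite exprMn -!exprM -!exprD; congr (_ ^+ _); lia.
have u0 : 0 < w ^+ 2 * w ^+ e by rewrite mulr_gt0// exprn_gt0.
have u1 : w ^+ 2 * w ^+ e <= 1.
  by rewrite mulr_ile1// ?exprn_ile1 ?exprn_ge0// ?(ltW w0)//; lra.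
have small : (w ^+ 2 * w ^+ e) ^+ k <= 1 by rewrite exprn_ile1// ltW.
have small0 : 0 < (w ^+ 2 * w ^+ e) ^+ k by rewrite exprn_gt0.
have w3 : w ^+ 3 <= 2^-1.
  rewrite exprS (le_trans _ w2)// -[leRHS]mulr1 ler_wpM2l ?exprn_ile1//; lra.
have srt' : sorted (fun p q => q.2 <= p.2) s by move/path_sorted: srt.
have sw' : {in s, forall p, w <= p.2} by move=> p ps; apply: sw; rewrite inE ps orbT.
have sc' : {in s, forall p, `|p.1| * w <= 1}.
  by move=> p ps; apply: sc; rewrite inE ps orbT.
have smax : {in s, forall p, p.2 <= q.2}.
  have tr : transitive (fun p p' : R * R => p'.2 <= p.2).
    by move=> y x z /= xy yz; exact: le_trans yz xy.
  by move: srt; rewrite /= (path_sortedE tr) => /andP[/allP].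
have qw : w <= q.2 by apply: sw; rewrite mem_head.
have qc : `|q.1| * w <= 1 by apply: sc; rewrite mem_head.
have [drop|keep] := leP (`|q.1| * expR (- (A * q.2))) (w ^+ e / 2).
  have [n n3 cov] := IH s sz srt' sw' sc'.
  have [|//|m m3 cov'] := @piecewise_refine _ _
    (fun x => w ^+ (3 + 2 * k + (1 + k) * e) <= `|expsum (q :: s) x|) _ 1 _ _ _ cov.
    move=> c d Ac cd dB cd_good; exists 1%N => //.
    apply: piecewise_good => // x xcd.
    have Ax : A <= x by move: xcd; rewrite in_itv/= => /andP[+ _]; exact: le_trans.
    have := norm_expsum_cons q s x; have := cd_good _ xcd.
    have : `|q.1| * expR (- (x * q.2)) <= w ^+ e / 2.
      apply: le_trans drop; rewrite ler_wpM2l// ler_expR lerN2 ler_wpM2r//; lra.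
    have : w ^+ (3 + 2 * k + (1 + k) * e) <= w ^+ e / 2.
      rewrite final; apply: (@le_trans _ _ (2^-1 * w ^+ e * 1)); last lra.
      apply: ler_pM => //; rewrite ?mulr_ge0 ?exprn_ge0// ?(ltW w0)//; last first.
        by rewrite ler_wpM2r// ltW.
      exact: ltW.
    lra.
  exists m => //; apply: leq_trans m3 _; rewrite mul1n expnS.
  by apply: leq_trans n3 _; rewrite leq_pmull.
(* For d = q.2, the derivative of expR (x * d) * expsum (q :: s) x is d * expR (x * d) * expsum s'
   x: the term of the largest gap has become constant and disappears, and the other coefficients
   shrink since 0 <= p.2 / d <= 1. *)
pose s' : seq (R * R) := [seq (p.1 * (1 - p.2 / q.2), p.2) | p <- s].
have q20 : 0 < q.2 by lra.
have [||||n n3 cov] := IH s'.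
- by rewrite size_map.
- rewrite /s' sorted_map; exact: srt'.
- by move=> _ /mapP[p ps ->]/=; exact: sw'.
- move=> _ /mapP[p ps ->]/=; apply: le_trans (sc' _ ps).
  rewrite ler_wpM2r ?(ltW w0)// normrM -[leRHS]mulr1 ler_wpM2l//.
  have p0 : 0 <= p.2 / q.2 by rewrite divr_ge0//; have := sw' _ ps; lra.
  have p1 : p.2 / q.2 <= 1 by rewrite ler_pdivrMr// mul1r smax.
  rewrite ler_norml; lra.
pose g x := expR (x * q.2) * expsum (q :: s) x.
pose g' x := q.2 * expR (x * q.2) * expsum s' x.
have d1 x : is_derive x 1 (fun y => expR (y * q.2)) (q.2 * expR (x * q.2)).
  have := is_derive_expR_scale (- q.2) x; rewrite opprK mulrN opprK.
  by under eq_fun do rewrite mulrN opprK.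
have dg x : is_derive x 1 g (g' x).
  have D := is_deriveM (d1 x) (is_derive_expsum (q :: s) x).
  apply: (is_derive_eq D); rewrite /g' /GRing.scale/= /expsum /expsum' /s'.
  rewrite big_map !big_cons/=.
  have E p : p \in s -> p.1 * (1 - p.2 / q.2) * expR (- (x * p.2)) =
      p.1 * expR (- (x * p.2)) - q.2^-1 * (p.1 * p.2 * expR (- (x * p.2))).
    by move=> ps; field; rewrite gt_eqF.
  rewrite [X in _ = q.2 * _ * (1 + X)](eq_big_seq _ E) sumrB -mulr_sumr.
  set S1 := \sum_(_ <- _) _; set S2 := \sum_(_ <- _) _.
  by field; rewrite gt_eqF.
have cg' : continuous g'.
  apply: continuous_mul; last exact: continuous_expsum.
  apply: continuous_scale; apply: continuous_compose; first exact: continuous_expR.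
  by apply: continuous_mul => x; [exact: cvg_id|exact: cst_continuous].
have [|//|m m3 cov'] := @piecewise_refine _ _
    (fun x => w ^+ (3 + 2 * k + (1 + k) * e) <= `|expsum (q :: s) x|) _ 3 _ _ _ cov.
  move=> c d Ac cd dB cd_good.
  have kap0 : 0 < w * w ^+ e by rewrite mulr_gt0.
  have [|z zcd Hz] := slope_away_from_point cd kap0 dg cg'.
    move=> x xcd; rewrite /g' !normrM (gtr0_norm q20) (gtr0_norm (expR_gt0 _)).
    have x0 : 0 < x by move: xcd; rewrite in_itv/= => /andP[? _]; lra.
    have E1 : 1 <= expR (x * q.2) by rewrite -expR0 ler_expR mulr_ge0 ?ltW.
    apply: ler_pM; rewrite ?(ltW w0) ?(ltW tau0)//; last exact: cd_good.
    nra.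
  apply: (piecewise_around (ltW w0) zcd) => x xcd xz.
  have := Hz x xcd; rewrite /g normrM gtr0_norm ?expR_gt0// => gx.
  (* [keep] and |q.1| <= 1 / w bound expR (A * q.2) by the inverse of w ^+ 2 * w ^+ e; since x <= B
     <= A * k, the k-th power bounds expR (x * q.2). *)
  have Ex : expR (x * q.2) * (w ^+ 2 * w ^+ e) ^+ k <= 1.
    have : expR (A * q.2) * (w ^+ 2 * w ^+ e) <= 1.
      have E0 : 0 < expR (A * q.2) by exact: expR_gt0.
      move: keep; rewrite expRN => /ltW; rewrite ler_pdivlMr//.
      set E := expR _ in E0 *; set t := w ^+ e in tau0 tau1 * => H.
      have : w * (t / 2 * E) <= 1 by rewrite (le_trans _ qc)// mulrC ler_wpM2r// ltW.
      rewrite expr2; nra.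
    move=> /(exprn_ile1 k) => /(_ _) H; apply: le_trans (H _); last first.
      by rewrite mulr_ge0 ?mulr_ge0 ?expR_ge0 ?exprn_ge0// ltW.
    rewrite [leRHS]exprMn ler_pM2r// -expRM_natl ler_expR mulrA.
    apply: ler_wpM2r; first lra.
    rewrite mulrC; apply: le_trans Bk.
    by move: xcd; rewrite in_itv/= => /andP[_]; lra.
  rewrite final -(ler_pM2l (expR_gt0 (x * q.2))); apply: le_trans gx.
  rewrite mulrCA; set D := _ * _ ^+ k in Ex *.
  have D0 : 0 <= D by rewrite mulr_ge0 ?expR_ge0// ltW.
  apply: (@le_trans _ _ (w ^+ 3 * w ^+ e)).
    by rewrite -[leRHS]mulr1 ler_wpM2l// mulr_ge0// ?exprn_ge0// ltW.
  apply: (@le_trans _ _ (w * w ^+ e * (w / 2))); last by rewrite ler_wpM2l// ltW.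
  rewrite !exprS expr0 mulr1 [leRHS]mulrAC ler_wpM2r//; nra.
by exists m => //; apply: leq_trans m3 _; rewrite expnS leq_mul2l n3 orbT.
Qed.

End Cover.

Section OscillationBound.
Variable R : realType.
Implicit Types (a b c e x w lam : R) (s : seq (R * R)).

Lemma mul_expRN_le1 (y : R) : y * expR (- y) <= 1.
Proof.
rewrite expRN ler_pdivrMr ?expR_gt0// mul1r.
by have := expR_ge1Dx y; lra.
Qed.

(** The inequality y e^(-y) <= 1 at y = x * p.2 bounds each term by |p.1| / x, hence by 1 / (w * A),
    however large the gap. *)
Lemma norm_expsum' A w s x : 0 < A -> A <= x -> 0 < w ->
  {in s, forall p, w <= p.2} -> {in s, forall p, `|p.1| * w <= 1} ->
  `|expsum' s x| * (w * A) <= (size s)%:R.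
Proof.
move=> A0 Ax w0; rewrite /expsum' normrN; elim: s => [|p s IH] sw sc.
  by rewrite big_nil normr0 mul0r.
rewrite big_cons /= -natr1 addrC -lerBlDr.
have ih := IH (fun q qs => sw q (mem_behead (s := p :: s) qs))
  (fun q qs => sc q (mem_behead (s := p :: s) qs)).
have pw := sw p (mem_head _ _); have pc := sc p (mem_head _ _).
rewrite lerBlDr; apply: (@le_trans _ _
  (`|p.1 * p.2 * expR (- (x * p.2))| * (w * A) + (size s)%:R)); last first.
  rewrite addrC lerD2l.
  rewrite !normrM (ger0_norm (expR_ge0 _)) (ger0_norm (_ : 0 <= p.2)); last lra.
  rewrite -[leRHS]mulr1 [leLHS](_ : _ = (`|p.1| * w) * (A * p.2 * expR (- (x * p.2)))); last by ring.
  apply: ler_pM => //.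
  - by rewrite mulr_ge0// ltW.
  - by rewrite mulr_ge0 ?expR_ge0// mulr_ge0//; lra.
  apply: le_trans (mul_expRN_le1 (x * p.2)).
  by rewrite ler_wpM2r ?expR_ge0// ler_wpM2r//; lra.
apply: le_trans (lerD (lexx _) ih); rewrite -mulrDl.
by apply: ler_wpM2r; [rewrite mulr_ge0// ltW|rewrite addrC; exact: ler_normD].
Qed.

(** With rho = 1 / phi', the function sin(phi) * rho has derivative cos(phi) + sin(phi) * rho', and
    - rho' = lam * rho + rho * h' / h for h = [expsum s]. The bound on expR (- (A * lam)) gives lam
    * |rho| <= tau * w ^+ 2; the factor tau absorbs the division by h. *)
Lemma Int_cos_piece A B w tau lam K phi s c d : 0 < A -> A <= c -> c <= d -> d <= B ->
  0 < w -> w <= 2^-1 -> 0 < tau -> tau <= 1 ->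
  {in s, forall p, w <= p.2} -> {in s, forall p, `|p.1| * w <= 1} ->
  1 <= lam -> lam <= `|K| -> expR (- (A * lam)) <= tau ^+ 2 * w ^+ 2 ->
  (forall x : R, is_derive x 1 phi (K * expR (x * lam) * expsum s x)) ->
  {in `[c, d], forall x, tau <= `|expsum s x|} ->
  `|Int c d (fun x => cos (phi x))| <= (2 + (B - A) * (1 + (size s)%:R / A)) * w.
Proof.
move=> A0 Ac cd dB w0 w2 t0 t1 sw sc lam1 lamK El dphi hs.
have K1 : 1 <= `|K| by exact: le_trans lamK.
have K0 : K != 0 by rewrite -normr_gt0; lra.
have cphi : continuous phi.
  by move=> x; apply: differentiable_continuous; apply/derivable1_diffP; case: (dphi x).
pose rho x := K^-1 * (expR (- (x * lam)) * (expsum s x)^-1).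
pose del x := sin (phi x) * (lam * rho x + rho x * (expsum' s x / expsum s x)).
have hn0 x : x \in `[c, d] -> expsum s x != 0.
  by move=> /hs H; rewrite -normr_gt0; lra.
have rhoB x : x \in `[c, d] -> `|rho x| * lam <= tau * w ^+ 2.
  move=> xcd; rewrite !normrM (ger0_norm (expR_ge0 _)) !normfV.
  have h0 := hs _ xcd.
  have E : expR (- (x * lam)) <= tau ^+ 2 * w ^+ 2.
    apply: le_trans El; rewrite ler_expR lerN2 ler_wpM2r//; first lra.
    by move: xcd; rewrite in_itv/= => /andP[]; lra.
  rewrite [leLHS](_ : _ = (`|K|^-1 * lam) * (expR (- (x * lam)) * `|expsum s x|^-1)); last by ring.
  rewrite -[leRHS]mul1r; apply: ler_pM.
  - by rewrite mulr_ge0 ?invr_ge0//; lra.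
  - by rewrite mulr_ge0 ?invr_ge0 ?expR_ge0.
  - by rewrite mulrC ler_pdivrMr ?mul1r//; lra.
  - rewrite ler_pdivrMr; last lra.
    apply: (le_trans E); rewrite [leLHS](_ : _ = tau * w ^+ 2 * tau); last by ring.
    by rewrite ler_wpM2l// mulr_ge0 ?exprn_ge0 ?ltW.
pose H := (size s)%:R / A * w^-1.
have H0 : 0 <= H by rewrite /H !mulr_ge0 ?invr_ge0 ?(ltW w0) ?(ltW A0).
have delB x : x \in `[c, d] -> `|cos (phi x) - (cos (phi x) - del x)| <= w ^+ 2 * (1 + H).
  move=> xcd; rewrite opprB addrC subrK /del normrM.
  have Hs : `|expsum' s x| <= H.
    have := @norm_expsum' A w s x A0 _ w0 sw sc.
    rewrite /H -mulrA -invfM ler_pdivlMr ?mulr_gt0//; rewrite (mulrC A); apply.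
    by move: xcd; rewrite in_itv/= => /andP[]; lra.
  rewrite -[leRHS]mul1r; apply: ler_pM => //; first exact: sin_max.
  apply: le_trans (ler_normD _ _) _; rewrite mulrDr mulr1; apply: lerD.
    rewrite normrM mulrC (ger0_norm (_ : 0 <= lam)); last lra.
    apply: (le_trans (rhoB _ xcd)); rewrite -[leRHS]mul1r ler_wpM2r// exprn_ge0 ?ltW//.
  rewrite normrM (normrM (expsum' s x)) normfV.
  have h0 := hs _ xcd.
  have r1 : `|rho x| <= tau * w ^+ 2.
    by apply: le_trans (rhoB _ xcd); rewrite -[leLHS]mulr1 ler_wpM2l.
  apply: (@le_trans _ _ ((tau * w ^+ 2) * (H * tau^-1))).
    apply: ler_pM; [exact: normr_ge0|by rewrite mulr_ge0 ?invr_ge0|exact: r1|].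
    by apply: ler_pM; rewrite ?invr_ge0// lef_pV2 ?posrE//; lra.
  by rewrite [leLHS](_ : _ = w ^+ 2 * H)//; field; rewrite gt_eqF.
have dG : {in `[c, d], forall x : R,
    is_derive x 1 (fun x => sin (phi x) * rho x) (cos (phi x) - del x)}.
  move=> x xcd; have h0 := hn0 _ xcd.
  have d1 := @is_derive1_comp R sin phi x _ _ (is_derive_sin _) (dphi x).
  have d2 := is_deriveV h0 (is_derive_expsum s x).
  have d3 := is_deriveM (is_derive_expR_scale lam x) d2.
  have d4 := is_deriveZ K^-1 d3.
  have d5 := is_deriveM d1 d4.
  apply: (is_derive_eq d5); rewrite /GRing.scale/= /del /rho.
  rewrite -[(_ * _ : R -> R) x]/(expR (- (x * lam)) * (expsum s x)^-1).
  rewrite -[_ *: _]/(K^-1 * (expR (- (x * lam)) * (expsum s x)^-1)).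
  rewrite expRN; field.
  by rewrite h0 K0 gt_eqF ?expR_gt0.
have cc : continuous (fun x => cos (phi x)).
  by apply: continuous_compose => //; exact: continuous_cos.
apply: le_trans (Int_le_primitive cd cc dG delB) _.
have G1 x : x \in `[c, d] -> `|sin (phi x) * rho x| <= w.
  move=> xcd; rewrite normrM -[leRHS]mul1r; apply: ler_pM => //; first exact: sin_max.
  apply: (@le_trans _ _ (`|rho x| * lam)); first by rewrite -[leLHS]mulr1 ler_wpM2l.
  apply: (le_trans (rhoB _ xcd)); rewrite -[leRHS]mul1r; apply: ler_pM => //.
  - by rewrite ltW.
  - by rewrite exprn_ge0 ?ltW.
  - rewrite expr2; nra.
have cI : c \in `[c, d] by rewrite in_itv/= lexx.
have dI : d \in `[c, d] by rewrite in_itv/= lexx cd.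
have := G1 _ cI; have := G1 _ dI; have := ler_normB (sin (phi d) * rho d) (sin (phi c) * rho c).
have : w ^+ 2 * (1 + H) * (d - c) <= w * (1 + (size s)%:R / A) * (B - A).
  apply: ler_pM; rewrite ?mulr_ge0 ?exprn_ge0 ?(ltW w0)//; try lra.
  have -> : w ^+ 2 * (1 + H) = w * (w + (size s)%:R / A).
    by rewrite /H; field; rewrite !gt_eqF.
  by rewrite ler_pM2l// lerD2r; lra.
lra.
Qed.

(** The single-piece estimate is applied with tau = w ^+ e, e being the exponent of the
    decomposition; its factor tau ^+ 2 * w ^+ 2 is the origin of 2 * e + 2. A piece of either kind
    costs at most [M * w]. *)
Lemma Int_cos_expsum A B w lam K phi s (k : nat) :
  0 < A -> A <= B -> B <= A * k%:R -> 0 < w -> w <= 2^-1 ->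
  sorted (fun p q => q.2 <= p.2) s ->
  {in s, forall p, w <= p.2} -> {in s, forall p, `|p.1| * w <= 1} ->
  1 <= lam -> lam <= `|K| ->
  expR (- (A * lam)) <= w ^+ (2 * piecewise_exponent k (size s) + 2) ->
  (forall x : R, is_derive x 1 phi (K * expR (x * lam) * expsum s x)) ->
  `|Int A B (fun x => cos (phi x))| <=
    (3 ^ size s)%:R * (2 + (B - A) * (1 + (size s)%:R / A)) * w.
Proof.
move=> A0 AB Bk w0 w2 srt sw sc lam1 lamK El dphi.
have [n n3 cov] := expsum_piecewise A0 AB Bk w0 w2 srt sw sc.
have cphi : continuous phi.
  by move=> x; apply: differentiable_continuous; apply/derivable1_diffP; case: (dphi x).
have cc : continuous (fun x => cos (phi x)).
  by apply: continuous_compose => //; exact: continuous_cos.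
set e := piecewise_exponent _ _ in El cov.
set M := (2 + _).
have M1 : 1 <= M.
  have : 0 <= (B - A) * (1 + (size s)%:R / A).
    by rewrite mulr_ge0 ?subr_ge0// addr_ge0// divr_ge0// ltW.
  rewrite /M; lra.
apply: (@le_trans _ _ (n%:R * (M * w))); last first.
  by rewrite -mulrA ler_wpM2r ?ler_nat// mulr_ge0 ?(ltW w0)//; lra.
have gen a b m : piecewise (fun x => w ^+ e <= `|expsum s x|) w m a b -> A <= a -> b <= B ->
    `|Int a b (fun x => cos (phi x))| <= m%:R * (M * w).
  elim=> {a b m}.
  - move=> a b ab abw Aa bB; rewrite mul1r.
    apply: (@le_trans _ _ (1 * (b - a))).
      by apply: Int_norm_le => // x _; exact: cos_max.
    by rewrite mul1r; apply: (le_trans abw); rewrite -[leLHS]mul1r ler_wpM2r// ltW.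
  - move=> a b ab good Aa bB; rewrite mul1r.
    apply: (@Int_cos_piece A B w (w ^+ e) lam K phi s a b) => //.
    + by rewrite exprn_gt0.
    + by rewrite exprn_ile1//; lra.
    + by rewrite -exprM -exprD (mulnC e).
  move=> m1 m2 a c b p1 IH1 p2 IH2 Aa bB.
  have ac := piecewise_le p1; have cb := piecewise_le p2.
  rewrite (Int_split cc ac cb) natrD mulrDl; apply: le_trans (ler_normD _ _) _.
  by apply: lerD; [apply: IH1 => //; exact: le_trans bB|apply: IH2 => //; exact: le_trans ac].
exact: gen.
Qed.

End OscillationBound.

(** * Periodic tents and their Fejer approximation *)

Section NearestInteger.
Variable R : realType.
Implicit Types (s t x y : R) (z : int).

(** Distance to the nearest integer. *)
Definition dn t : R := `|t - (Num.floor (t + 2^-1))%:~R|.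

Lemma dn_ge0 t : 0 <= dn t. Proof. exact: normr_ge0. Qed.

Lemma dn_attained t : exists z, dn t = `|t - z%:~R|.
Proof. by exists (Num.floor (t + 2^-1)). Qed.

Lemma dn_le_half t : dn t <= 2^-1.
Proof.
have := floor_le_tmp (t + 2^-1); have := floorD1_gt (t + 2^-1).
by rewrite intrD /dn ler_norml => ? ?; lra.
Qed.

Lemma dn_le t z : dn t <= `|t - z%:~R|.
Proof.
have [z0 E] := dn_attained t; have := dn_le_half t; rewrite E => H.
have [<-//|zz] := eqVneq z0 z.
have : 1 <= `|z0%:~R - z%:~R : R|.
  by rewrite -intrB -intr_norm ler1z -gtz0_ge1 normr_gt0 subr_eq0.
have : `|z0%:~R - z%:~R : R| <= `|t - z%:~R| + `|t - z0%:~R|.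
  rewrite (_ : z0%:~R - z%:~R = (t - z%:~R) - (t - z0%:~R)); last by ring.
  exact: ler_normB.
lra.
Qed.

Lemma dn_le_norm t : dn t <= `|t|.
Proof. by have := dn_le t 0; rewrite subr0. Qed.

Lemma dnDz t z : dn (t + z%:~R) = dn t.
Proof.
apply/eqP; rewrite eq_le; apply/andP; split.
  have [z0 ->] := dn_attained t; have := dn_le (t + z%:~R) (z0 + z).
  by rewrite intrD opprD addrACA subrr addr0.
have [z0 ->] := dn_attained (t + z%:~R); have := dn_le t (z0 - z).
by rewrite intrB opprB addrA.
Qed.

Lemma dnN t : dn (- t) = dn t.
Proof.
have H u : dn (- u) <= dn u.
  have [z0 ->] := dn_attained u; have := dn_le (- u) (- z0).
  by rewrite intrN opprK addrC distrC.
by apply/eqP; rewrite eq_le H /= -{1}(opprK t) H.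
Qed.

Lemma dnD s t : dn (s + t) <= dn s + dn t.
Proof.
have [z1 ->] := dn_attained s; have [z2 ->] := dn_attained t.
apply: le_trans (ler_normD _ _); apply: le_trans (dn_le _ (z1 + z2)) _.
by rewrite intrD opprD addrACA.
Qed.

Lemma dn_lipschitz s t : `|dn s - dn t| <= dn (s - t).
Proof.
have := dnD (s - t) t; have := dnD (t - s) s; rewrite !subrK -(dnN (t - s)) opprB.
by move=> ? ?; rewrite ler_norml; apply/andP; split; lra.
Qed.

Lemma continuous_lipschitz (f : R -> R) (M : R) : 0 < M ->
  (forall x y, `|f x - f y| <= M * `|x - y|) -> continuous f.
Proof.
move=> M0 fM x; apply/cvgrPdist_le => /= e e0; near=> y.
apply: le_trans (fM _ _) _; rewrite mulrC -ler_pdivlMr//.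
by near: y; apply: cvgr_dist_le; [exact: cvg_id|exact: divr_gt0].
Unshelve. all: by end_near. Qed.

Lemma continuous_dn : continuous dn.
Proof.
apply: (@continuous_lipschitz _ 1) => // x y; rewrite mul1r.
exact: le_trans (dn_lipschitz _ _) (dn_le_norm _).
Qed.

Lemma dn_eq_norm t : `|t| <= 2^-1 -> dn t = `|t|.
Proof.
move=> t2; apply/eqP; rewrite eq_le dn_le_norm/=.
have [z0 ->] := dn_attained t; have [->|z1] := eqVneq z0 0; first by rewrite subr0.
have : 1 <= `|z0%:~R : R| by rewrite -intr_norm ler1z -gtz0_ge1 normr_gt0.
have := ler_normB t (t - z0%:~R); rewrite (_ : t - (t - z0%:~R) = z0%:~R); last by ring.
lra.
Qed.

Lemma dn_ge t x : x <= t -> t <= 1 - x -> x <= dn t.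
Proof.
move=> xt tx; have [z ->] := dn_attained t.
have [z0|z0] := leP z 0.
  have : z%:~R <= 0 :> R by rewrite lerz0.
  by move=> ?; rewrite ler_normr; apply/orP; left; lra.
have : 1 <= z%:~R :> R by rewrite ler1z -gtz0_ge1.
by move=> ?; rewrite ler_normr; apply/orP; right; lra.
Qed.

Lemma sinDzpi x z : `|sin (x + pi * z%:~R)| = `|sin x|.
Proof.
elim: z => [|n IH|n IH]; first by rewrite mulr0 addr0.
  by rewrite -IH intS intrD mulrDr mulr1 addrCA addrC sinDpi normrN.
rewrite -IH -(normrN (sin (x + pi * (- n.+1%:Z)%:~R))) -sinDpi.
congr (`|sin _|); rewrite -[n.+1]addn1 PoszD opprD intrD; ring.
Qed.

(** Here sin x = 2 sin(x/2) cos(x/2), where sin(x/2) >= (x/2) cos(x/2) by the mean value theorem and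
    cos(x/2)^2 = (1 + cos x) / 2 >= 1/2. *)
Lemma half_le_sin x : 0 <= x -> x <= pi / 2 -> x / 2 <= sin x.
Proof.
move=> x0 xpi.
have xx : x / 2 *+ 2 = x by rewrite mulr2n; lra.
have c2 : 2^-1 <= cos (x / 2) ^+ 2.
  have := cos_mulr2n (x / 2); rewrite xx.
  have : 0 <= cos x by apply: cos_ge0_pihalf; rewrite xpi; have := @pi_gt0 R; lra.
  move=> + E; rewrite E mulr2n; lra.
have cge y : y \in `[0, x / 2] -> cos (x / 2) <= cos y.
  rewrite in_itv/= => /andP[y0 yx]; rewrite le_eqVlt; apply/orP.
  have [->|yx'] := eqVneq y (x / 2); [by left|right].
  rewrite ltr_cos ?in_itv/=; last first.
  - by apply/andP; split; have := @pi_gt0 R; lra.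
  - by apply/andP; split; have := @pi_gt0 R; lra.
  by rewrite lt_neqAle yx' yx.
have s2 : cos (x / 2) * (x / 2) <= sin (x / 2).
  have x20 : 0 <= x / 2 by lra.
  have [|c cx] := @MVT_segment R (@sin R) (@cos R) 0 (x / 2) x20 (fun y _ => is_derive_sin y).
    by apply: continuous_subspaceT; exact: continuous_sin.
  by rewrite sin0 !subr0 => ->; rewrite ler_wpM2r ?cge//; lra.
have := sin_mulr2n (x / 2); rewrite xx => ->.
have c0 : 0 <= cos (x / 2) by apply: cos_ge0_pihalf; have := @pi_gt0 R; lra.
have : cos (x / 2) * (cos (x / 2) * (x / 2)) <= cos (x / 2) * sin (x / 2) by rewrite ler_wpM2l.
rewrite mulrA -expr2.
have : 2^-1 * (x / 2) <= cos (x / 2) ^+ 2 * (x / 2) by rewrite ler_wpM2r//; lra.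
lra.
Qed.

Lemma dn_le_sin t : dn t <= `|sin (pi * t)|.
Proof.
have [z E] := dn_attained t; have := dn_le_half t; rewrite E => u2.
rewrite (_ : pi * t = pi * (t - z%:~R) + pi * z%:~R); last by ring.
rewrite sinDzpi; set u := t - _ in u2 *; clearbody u.
wlog u0 : u u2 / 0 <= u.
  move=> W; have [/W|u0] := leP 0 u; first exact.
  by have := W (- u); rewrite mulrN sinN !normrN; apply => //; lra.
rewrite (ger0_norm u0) in u2 *.
have p2 := @pi_ge2 R.
have := @half_le_sin (pi * u); rewrite mulr_ge0 ?pi_ge0// => /(_ isT) H.
have : pi * u / 2 <= sin (pi * u) by apply: H; rewrite ler_wpM2l// pi_ge0.
move=> h; rewrite ger0_norm; nra.
Qed.

(** For s >= 2 the bumps of radius 1 / s around distinct integers do not overlap, so this is the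
    1-periodization of t |-> max 0 (1 - s |t|), of mean 1 / s. *)
Definition tent s t : R := Num.max 0 (1 - s * dn t).

Lemma tent_ge0 s t : 0 <= tent s t. Proof. by rewrite le_max lexx. Qed.

Lemma tent_le1 s t : 0 <= s -> tent s t <= 1.
Proof. by move=> s0; rewrite ge_max ler01/= gerBl mulr_ge0// dn_ge0. Qed.

Lemma tent_lipschitz s x y : 0 <= s -> `|tent s x - tent s y| <= s * dn (x - y).
Proof.
move=> s0; have := dn_lipschitz x y; have [xy0 H] := (dn_ge0 (x - y), I).
rewrite ler_norml => /andP[h1 h2].
have {}h1 : s * dn y - s * dn x <= s * dn (x - y) by rewrite -mulrBr ler_wpM2l//; lra.
have {}h2 : s * dn x - s * dn y <= s * dn (x - y) by rewrite -mulrBr ler_wpM2l//; lra.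
have h3 : 0 <= s * dn (x - y) by rewrite mulr_ge0.
rewrite /tent; case: (leP 0 (1 - s * dn x)) => ?; case: (leP 0 (1 - s * dn y)) => ?; rewrite ler_norml; apply/andP; split; lra.
Qed.

Lemma tentDz s t z : tent s (t + z%:~R) = tent s t.
Proof. by rewrite /tent dnDz. Qed.

Lemma sum_periodic_shift (f : R -> R) (L : nat) z : (0 < L)%N ->
  (forall t, f (t + 1) = f t) ->
  \sum_(j < L) f (j%:R / L%:R - z%:~R / L%:R) = \sum_(j < L) f (j%:R / L%:R).
Proof.
move=> L0 f1; have Ln0 : L%:R != 0 :> R by rewrite pnatr_eq0 -lt0n.
have step (c : R) : \sum_(j < L) f (j%:R / L%:R - (c + 1) / L%:R) =
                    \sum_(j < L) f (j%:R / L%:R - c / L%:R).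
  case: L L0 Ln0 => // L _ Ln0.
  rewrite big_ord_recl [RHS]big_ord_recr addrC /=; congr (_ + _).
    by apply: eq_bigr => i _; congr f; rewrite /bump/= add1n -natr1; ring.
  by rewrite -f1; congr f; rewrite -!natr1; field; rewrite natr1.
elim: z => [|n IH|n IH].
- by apply: eq_bigr => j _; rewrite mul0r subr0.
- rewrite -IH -[in RHS]step; apply: eq_bigr => j _; congr (f (_ - _ / _)).
  by rewrite intS intrD addrC.
- rewrite -IH -[LHS]step; apply: eq_bigr => j _; congr (f (_ - _ / _)).
  by rewrite -[n.+1]addn1 PoszD opprD intrD; ring.
Qed.

(** A centre on the grid and the slope L / P make the grid average exactly the mean P / L. Once the
    centre is moved to P / L, the values at i and i + P, for i < P, are i / P and 1 - i / P; the
    remaining ones vanish. *)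
Lemma tent_grid_sum (L P : nat) z : (0 < P)%N -> (2 * P <= L)%N ->
  \sum_(j < L) tent (L%:R / P%:R) (j%:R / L%:R - z%:~R / L%:R) = P%:R.
Proof.
move=> P0 PL; have L0 : (0 < L)%N by lia.
have Ln0 : L%:R != 0 :> R by rewrite pnatr_eq0 -lt0n.
have Pn0 : P%:R != 0 :> R by rewrite pnatr_eq0 -lt0n.
have Lgt0 : 0 < L%:R :> R by rewrite ltr0n.
have Pgt0 : 0 < P%:R :> R by rewrite ltr0n.
have per t : tent (L%:R / P%:R) (t + 1) = tent (L%:R / P%:R) t := tentDz _ t 1.
rewrite sum_periodic_shift// -(sum_periodic_shift (P : int) L0 per).
pose h (j : nat) : R := tent (L%:R / P%:R) (j%:R / L%:R - P%:R / L%:R).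
rewrite -(big_mkord xpredT h).
rewrite (@big_cat_nat _ _ _ (P + P)) ?leq0n//=; last lia.
have -> : \sum_(P + P <= j < L) h j = 0.
  rewrite big_nat_cond big1// => j /andP[/andP[Pj jL] _]; rewrite /h /tent; apply/max_idPl.
  rewrite subr_le0 mulrAC ler_pdivlMr// mul1r mulrC -ler_pdivrMr//.
  have Pj' : P%:R + P%:R <= j%:R :> R by rewrite -natrD ler_nat.
  have jL' : j%:R <= L%:R :> R by rewrite ler_nat ltnW.
  apply: dn_ge; rewrite -mulrBl ?ler_pM2r ?invr_gt0//; first lra.
  by rewrite mulrBl lerD2r ler_pdivrMr// mul1r.
have E : \sum_(P <= j < P + P) h j = \sum_(0 <= j < P) h (j + P)%N.
  by rewrite -{1}(add0n P) big_addn addnK.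
rewrite addr0 (@big_cat_nat _ _ _ P) ?leq0n ?leq_addr//= E.
rewrite -big_split/= big_mkord.
suff H (i : 'I_P) : h i + h (i + P)%N = 1.
  by under eq_bigr do rewrite H; rewrite sumr_const card_ord.
case: i => i iP /=.
have iP' : i%:R <= P%:R :> R by rewrite ler_nat ltnW.
have i0 : 0 <= i%:R :> R by rewrite ler0n.
have PL2 : P%:R / L%:R <= 2^-1 :> R.
  by rewrite ler_pdivrMr// mulrC ler_pdivlMr// mulrC -natrM ler_nat.
have e1 : dn (i%:R / L%:R - P%:R / L%:R) = (P%:R - i%:R) / L%:R.
  have neg : i%:R / L%:R - P%:R / L%:R <= 0 :> R by rewrite -mulrBl pmulr_lle0 ?invr_gt0//; lra.
  rewrite dn_eq_norm ler0_norm//; [by ring|].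
  have : 0 <= i%:R / L%:R :> R by rewrite divr_ge0.
  lra.
have e2 : dn ((i + P)%:R / L%:R - P%:R / L%:R) = i%:R / L%:R.
  rewrite natrD mulrDl addrK dn_eq_norm ger0_norm ?divr_ge0//.
  by apply: le_trans PL2; rewrite ler_pM2r ?invr_gt0.
rewrite /h /tent e1 e2.
have -> : L%:R / P%:R * ((P%:R - i%:R) / L%:R) = (P%:R - i%:R) / P%:R :> R.
  by field; apply/andP.
have -> : L%:R / P%:R * (i%:R / L%:R) = i%:R / P%:R :> R by field; apply/andP.
have p1 : (P%:R - i%:R) / P%:R <= 1 :> R by rewrite ler_pdivrMr//; lra.
have p2 : i%:R / P%:R <= 1 :> R by rewrite ler_pdivrMr//; lra.
rewrite !max_r ?subr_ge0//.
by field.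
Qed.

End NearestInteger.

Section Fejer.
Variable R : realType.
Implicit Types (x y t : R) (L : nat).

(** The Fejer kernel divided by [L], that is |sum_(a < L) exp(2 pi i a y)|^2 / L^2: in this
    normalization its values on any translate of the grid sum to 1. *)
Definition fejer L y : R :=
  L%:R ^- 2 * \sum_(a < L) \sum_(b < L) cos (2 * pi * ((a%:R - b%:R) * y)).

Lemma fejer_sqE L y : fejer L y = L%:R ^- 2 *
  ((\sum_(a < L) cos (2 * pi * (a%:R * y))) ^+ 2 +
   (\sum_(a < L) sin (2 * pi * (a%:R * y))) ^+ 2).
Proof.
rewrite /fejer !expr2 !big_distrlr -big_split/=; congr (_ * _).
apply: eq_bigr => a _; rewrite -big_split/=; apply: eq_bigr => b _.
by rewrite -cosB; congr cos; ring.
Qed.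

Lemma fejer_ge0 L y : 0 <= fejer L y.
Proof. by rewrite fejer_sqE mulr_ge0 ?invr_ge0 ?exprn_ge0// addr_ge0 ?sqr_ge0. Qed.

(** Multiplied by 2 sin(pi y), the sums of cosines and of sines telescope, and the squares of the
    two differences add up to 2 - 2 cos(p - q) <= 4. *)
Lemma fejer_sin L y : fejer L y * sin (pi * y) ^+ 2 <= L%:R ^- 2.
Proof.
rewrite fejer_sqE -mulrA -[leRHS]mulr1 ler_wpM2l ?invr_ge0 ?exprn_ge0//.
have tc : 2 * sin (pi * y) * (\sum_(a < L) cos (2 * pi * (a%:R * y))) =
    sin (2 * pi * (L%:R * y) - pi * y) - sin (- (pi * y)).
  pose u (a : nat) := sin (2 * pi * (a%:R * y) - pi * y).
  transitivity (u L - u 0%N); last by rewrite /u mul0r mulr0 sub0r.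
  rewrite -(telescope_sumr _ (leq0n L)) big_mkord mulr_sumr; apply: eq_bigr => a _.
  rewrite /u -[a.+1%:R]natr1 (_ : 2 * pi * ((a%:R + 1) * y) - pi * y = 2 * pi * (a%:R * y) + pi * y); last by ring.
  by rewrite sinD sinB; ring.
have ts : 2 * sin (pi * y) * (\sum_(a < L) sin (2 * pi * (a%:R * y))) =
    cos (- (pi * y)) - cos (2 * pi * (L%:R * y) - pi * y).
  pose u (a : nat) := - cos (2 * pi * (a%:R * y) - pi * y).
  transitivity (u L - u 0%N); last by rewrite /u mul0r mulr0 sub0r; ring.
  rewrite -(telescope_sumr _ (leq0n L)) big_mkord mulr_sumr; apply: eq_bigr => a _.
  rewrite /u -[a.+1%:R]natr1 (_ : 2 * pi * ((a%:R + 1) * y) - pi * y = 2 * pi * (a%:R * y) + pi * y); last by ring.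
  by rewrite cosD cosB; ring.
set C := \sum_(_ < _) _ in tc *; set S := \sum_(_ < _) _ in ts *.
set p := _ - pi * y in tc ts; set q := - (pi * y) in tc ts; set s := sin (pi * y) in tc ts *.
clearbody C S p q s.
have E : 4 * ((C ^+ 2 + S ^+ 2) * s ^+ 2) = 2 - 2 * cos (p - q).
  transitivity ((2 * s * C) ^+ 2 + (2 * s * S) ^+ 2); first by ring.
  transitivity ((cos p ^+ 2 + sin p ^+ 2) + (cos q ^+ 2 + sin q ^+ 2) - 2 * cos (p - q)).
    by rewrite tc ts cosB; ring.
  by rewrite !cos2Dsin2; ring.
have := cos_geN1 (p - q); lra.
Qed.

Lemma sinB_period x (a b : nat) : sin (x - 2 * pi * (a%:R - b%:R)) = sin x.
Proof.
have H (c : nat) y : sin (y + 2 * pi * c%:R) = sin y.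
  rewrite (_ : 2 * pi * c%:R = (pi *+ 2) *+ c); last by rewrite -[RHS]mulr_natr -[pi *+ 2]mulr_natr; ring.
  exact: (periodicn (@sinD2pi R)).
by rewrite -[RHS](H b) -(H a); congr sin; ring.
Qed.

(** Orthogonality of characters mod L: for a != b the sum telescopes after multiplication by sin(pi
    (a - b) / L), nonzero because 0 < |a - b| < L. *)
Lemma sum_cos_grid L (a b : nat) x : (a < L)%N -> (b < L)%N ->
  \sum_(j < L) cos (x - 2 * pi * ((a%:R - b%:R) * (j%:R / L%:R))) =
    if a == b then L%:R * cos x else 0.
Proof.
move=> aL bL; have L0 : (0 < L)%N by exact: leq_ltn_trans aL.
have Lgt0 : 0 < L%:R :> R by rewrite ltr0n.
have [->|ab] := eqVneq a b.
  under eq_bigr do rewrite subrr mul0r mulr0 subr0.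
  by rewrite sumr_const card_ord mulr_natl.
pose d : R := pi * ((a%:R - b%:R) / L%:R).
have dn0 : sin d != 0.
  have pos (u v : nat) : (u < v)%N -> (v < L)%N -> sin (pi * ((v%:R - u%:R) / L%:R)) != 0 :> R.
    move=> uv vL; rewrite gt_eqF// sin_gt0_pi// mulr_gt0 ?pi_gt0 ?divr_gt0 ?subr_gt0 ?ltr_nat//=.
    rewrite -[ltRHS]mulr1 ltr_pM2l ?pi_gt0// ltr_pdivrMr// mul1r.
    have : v%:R < L%:R :> R by rewrite ltr_nat.
    have : 0 <= u%:R :> R by [].
    lra.
  case: (ltngtP a b) ab => // [lt|lt] _; last exact: pos.
  by rewrite /d -opprB mulNr mulrN sinN oppr_eq0; exact: pos.
apply: (mulfI dn0); rewrite mulr0 mulr_sumr.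
pose u (j : nat) := - 2^-1 * sin (x + d - 2 * d * j%:R).
transitivity (u L - u 0%N).
  rewrite -(telescope_sumr _ (leq0n L)) big_mkord; apply: eq_bigr => j _.
  rewrite (_ : 2 * pi * _ = 2 * d * j%:R); last by rewrite /d; ring.
  rewrite /u -[j.+1%:R]natr1 (_ : x + d - 2 * d * (j%:R + 1) = x - 2 * d * j%:R - d); last by ring.
  rewrite (_ : x + d - 2 * d * j%:R = x - 2 * d * j%:R + d); last by ring.
  by rewrite (sinB _ d) (sinD _ d); field.
rewrite /u (_ : 2 * d * L%:R = 2 * pi * (a%:R - b%:R)); last first.
  by rewrite /d; field; rewrite gt_eqF.
by rewrite sinB_period mulr0 subr0 subrr.
Qed.

Lemma fejer_grid_sum L t : (0 < L)%N -> \sum_(j < L) fejer L (t - j%:R / L%:R) = 1.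
Proof.
move=> L0; have Ln0 : L%:R != 0 :> R by rewrite pnatr_eq0 -lt0n.
rewrite /fejer -mulr_sumr exchange_big/=.
rewrite (eq_bigr (fun a : 'I_L => L%:R)); last first.
  move=> a _; rewrite exchange_big/= (bigD1 a)//= [X in _ + X]big1 => [|b ba].
    rewrite addr0 (eq_bigr (fun=> 1)); first by rewrite sumr_const card_ord.
    by move=> j _; rewrite subrr mul0r mulr0 cos0.
  under eq_bigr => j _ do rewrite (_ : 2 * pi * _ =
    2 * pi * ((a%:R - b%:R) * t) - 2 * pi * ((a%:R - b%:R) * (j%:R / L%:R))) ?mulrBr//.
  by rewrite sum_cos_grid// eq_sym [X in if X then _ else _](negPf ba).
by rewrite sumr_const card_ord -(mulr_natr L%:R) expr2 mulVf// mulf_neq0.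
Qed.

(* Averaging over a grid of mesh [1 / L] instead of the circle keeps all Fourier
   expansions finite. *)
Definition trigapprox L (g : R -> R) t : R :=
  \sum_(j < L) g (j%:R / L%:R) * fejer L (t - j%:R / L%:R).

Lemma trigapprox_cosE L (g : R -> R) t : trigapprox L g t =
  L%:R ^- 2 * \sum_(j < L) \sum_(a < L) \sum_(b < L)
    g (j%:R / L%:R) * cos (2 * pi * ((a%:R - b%:R) * (t - j%:R / L%:R))).
Proof.
rewrite /trigapprox mulr_sumr; apply: eq_bigr => j _.
rewrite /fejer mulrCA; congr (_ * _); rewrite mulr_sumr.
by apply: eq_bigr => a _; rewrite mulr_sumr.
Qed.

Definition gridavg L (g : R -> R) : R := L%:R^-1 * \sum_(j < L) g (j%:R / L%:R).

Lemma fejer_grid_dn L t : (0 < L)%N ->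
  \sum_(j < L) dn (t - j%:R / L%:R) ^+ 2 * fejer L (t - j%:R / L%:R) <= L%:R^-1.
Proof.
move=> L0; have Ln0 : L%:R != 0 :> R by rewrite pnatr_eq0 -lt0n.
apply: (@le_trans _ _ (\sum_(j < L) L%:R ^- 2)).
  apply: ler_sum => j _; apply: le_trans (fejer_sin _ (t - j%:R / L%:R)).
  rewrite mulrC ler_wpM2l ?fejer_ge0// -(real_normK (num_real (sin _))).
  by rewrite lerXn2r ?nnegrE ?dn_ge0 ?dn_le_sin.
by rewrite sumr_const card_ord -(mulr_natr (_ ^- 2)) expr2 invfM -mulrA mulVf// mulr1.
Qed.

(** The kernel weights sum to 1 and give the distance d a second moment of at most 1 / L; d <= sg +
    d^2 / sg turns this into a first moment. The free parameter [sg] will be of order L^(-1/2). *)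
Lemma trigapprox_dist L (g : R -> R) M sg t : (0 < L)%N -> 0 <= M -> 0 < sg ->
  (forall x y, `|g x - g y| <= M * dn (x - y)) ->
  `|trigapprox L g t - g t| <= M * (sg + (L%:R * sg)^-1).
Proof.
move=> L0 M0 s0 gM; have {1}-> : g t = \sum_(j < L) g t * fejer L (t - j%:R / L%:R).
  by rewrite -mulr_sumr fejer_grid_sum// mulr1.
rewrite /trigapprox -sumrB.
apply: le_trans (ler_norm_sum _ _ _) _.
apply: (@le_trans _ _ (M * \sum_(j < L) (sg * fejer L (t - j%:R / L%:R) +
   sg^-1 * (dn (t - j%:R / L%:R) ^+ 2 * fejer L (t - j%:R / L%:R))))).
  rewrite mulr_sumr; apply: ler_sum => j _; rewrite -mulrBl normrM (ger0_norm (fejer_ge0 _ _)).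
  set d := dn (t - _); set F := fejer _ _.
  rewrite (_ : M * (_ + _) = M * (sg + sg^-1 * d ^+ 2) * F); last by ring.
  apply: ler_wpM2r; first exact: fejer_ge0.
  rewrite distrC; apply: le_trans (gM _ _) _; rewrite -/d ler_wpM2l//.
  rewrite -(ler_pM2l s0) mulrDr mulrA mulfV ?gt_eqF// mul1r.
  have := sqr_ge0 (sg - d); have : 0 <= d by exact: dn_ge0.
  nra.
rewrite ler_wpM2l// big_split/= -[X in X + _]mulr_sumr -[X in _ + X]mulr_sumr fejer_grid_sum// mulr1 lerD2l invfM mulrC.
by rewrite ler_wpM2r ?invr_ge0 ?(ltW s0)// fejer_grid_dn.
Qed.

Lemma trigapprox_itv L (g : R -> R) t : (0 < L)%N -> (forall x, 0 <= g x <= 1) ->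
  0 <= trigapprox L g t <= 1.
Proof.
move=> L0 g01; rewrite sumr_ge0 => [|j _]; last first.
  by rewrite mulr_ge0 ?fejer_ge0//; have /andP[] := g01 (j%:R / L%:R).
rewrite -(fejer_grid_sum t L0); apply: ler_sum => j _.
by rewrite -[leRHS]mul1r ler_wpM2r ?fejer_ge0//; have /andP[] := g01 (j%:R / L%:R).
Qed.

(** The diagonal b = a is the constant Fourier coefficient; every other term has a nonzero frequency
    a - b, so that oscillation can make its integral small. *)
Lemma trigapproxE L (g : R -> R) t : (0 < L)%N -> trigapprox L g t = gridavg L g +
  L%:R ^- 2 * \sum_(j < L) \sum_(a < L) \sum_(b < L | b != a)
    g (j%:R / L%:R) * cos (2 * pi * ((a%:R - b%:R) * (t - j%:R / L%:R))).
Proof.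
move=> L0; have Ln0 : L%:R != 0 :> R by rewrite pnatr_eq0 -lt0n.
have E : L%:R^-1 = L%:R ^- 2 * L%:R :> R by rewrite expr2 invfM -mulrA mulVf// mulr1.
rewrite /gridavg [X in X * _ + _]E.
rewrite -mulrA -mulrDr mulr_sumr -big_split/= mulr_sumr; apply: eq_bigr => j _.
rewrite /fejer mulrCA; congr (_ * _); rewrite mulr_sumr.
transitivity (\sum_(a < L) (g (j%:R / L%:R) + \sum_(b < L | b != a)
    g (j%:R / L%:R) * cos (2 * pi * ((a%:R - b%:R) * (t - j%:R / L%:R))))).
  apply: eq_bigr => a _; rewrite (bigD1 a)//= subrr mul0r mulr0 cos0 mulrDr mulr1.
  by rewrite mulr_sumr.
rewrite big_split/= sumr_const card_ord; congr (_ + _); by rewrite (mulr_natl (g _)).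
Qed.

Lemma continuous_fejer L : continuous (fejer L).
Proof.
apply: continuous_scale; apply: continuous_sum => a; apply: continuous_sum => b.
apply: continuous_compose; first exact: continuous_cos.
by do 2 apply: continuous_scale; move=> x; exact: cvg_id.
Qed.

Lemma continuous_trigapprox L (g : R -> R) : continuous (trigapprox L g).
Proof.
apply: continuous_sum => j; apply: continuous_scale.
apply: continuous_compose; first exact: continuous_fejer.
by apply: continuous_add => x; [exact: cvg_id|exact: cst_continuous].
Qed.

End Fejer.

(** * Equidistribution of products of tents *)

Section Peeling.
Variables (R : realType) (theta : nat -> R -> R) (A B : R) (V : seq nat) (L U : nat) (beta : R).
Hypotheses (ctheta : forall n, continuous (theta n)) (AB : A <= B) (uniqV : uniq V) (L0 : (0 < L)%N).
Hypothesis beta0 : 0 <= beta.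

Definition phase (u : nat -> int) (c : R) (x : R) : R :=
  2 * pi * (\sum_(i <- V) (u i)%:~R * theta i x) + c.

(** The other frequencies are arbitrary up to [U]: expanding factors that do not involve [v] changes
    them but leaves [u v] alone. *)
Definition oscillates (v : nat) := forall (u : nat -> int) (c : R),
  (forall i, (`|u i| <= U)%N) -> u v != 0 ->
  `|Int A B (fun x => cos (phase u c x))| <= beta.

Definition add_edge (u : nat -> int) (n : int) (v w : nat) (i : nat) : int :=
  u i + (if i == v then n else 0) - (if i == w then n else 0).

Lemma add_edge_le u n v w i : (`|add_edge u n v w i| <= `|u i| + `|n|)%N.
Proof. by rewrite /add_edge; case: (i == v); case: (i == w); lia. Qed.

Lemma absz_ord_sub (a b : 'I_L) : (`|a%:Z - b%:Z| <= L)%N.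
Proof. by case: a b => a aL [b bL] /=; lia. Qed.

Lemma phase_add_edge u c n v w x : v \in V -> w \in V ->
  phase (add_edge u n v w) c x = phase u c x + 2 * pi * (n%:~R * (theta v x - theta w x)).
Proof.
move=> vV wV; rewrite /phase /add_edge.
have pick z : z \in V -> \sum_(i <- V) (if i == z then n else 0)%:~R * theta i x = n%:~R * theta z x.
  move=> zV; rewrite (bigD1_seq z)//= eqxx big1 ?addr0// => i /negPf ->.
  by rewrite mul0r.
under eq_bigr do rewrite intrB intrD mulrBl mulrDl.
rewrite sumrB big_split/= !pick//; ring.
Qed.

(* [(v, w, g)] stands for the factor [g (theta v x - theta w x)]. *)
Definition edge := (nat * nat * (R -> R))%type.
Implicit Types (e : edge) (es : seq edge).

Definition edge_in e := (e.1.1 \in V) && (e.1.2 \in V).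
Definition edge_avoids (v : nat) e := (e.1.1 != v) && (e.1.2 != v).
Definition edge_diff e x := theta e.1.1 x - theta e.1.2 x.
Definition unit_valued e := forall t, 0 <= e.2 t <= 1.

Lemma continuous_edge_diff e : continuous (edge_diff e).
Proof. by move=> x; apply: continuousB; exact: ctheta. Qed.

Lemma continuous_phase u c : continuous (phase u c).
Proof.
apply: continuous_add; last by move=> x; exact: cst_continuous.
by apply: continuous_scale; apply: continuous_sum => i; exact: continuous_scale.
Qed.

Lemma continuous_cos_phase u c : continuous (fun x => cos (phase u c x)).
Proof. by apply: continuous_compose; [exact: continuous_cos|exact: continuous_phase]. Qed.

Definition trig_prod es x := \prod_(e <- es) trigapprox L e.2 (edge_diff e x).

Lemma continuous_trig_prod es : continuous (trig_prod es).
Proof.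
apply: continuous_prod => e.
by apply: continuous_compose; [exact: continuous_trigapprox|exact: continuous_edge_diff].
Qed.

(** Expanding one factor moves each frequency by at most [L], which is taken from the budget [U],
    and produces L^3 terms weighted by L^-2, hence a loss of [L] per factor. The edges avoid [v], so
    its frequency stays nonzero to the end. *)
Lemma Int_cos_trig_prod v es u c : oscillates v ->
  all edge_in es -> all (edge_avoids v) es -> {in es, forall e, unit_valued e} ->
  (forall i, (`|u i| + size es * L <= U)%N) -> u v != 0 ->
  `|Int A B (fun x => cos (phase u c x) * trig_prod es x)| <= L%:R ^+ size es * beta.
Proof.
move=> osc; elim: es u c => [|e es IH] u c /=.
  move=> _ _ _ uU uv; rewrite expr0 mul1r.
  rewrite (_ : (fun x => _) = (fun x => cos (phase u c x))).
    by apply: osc => // i; have := uU i; rewrite addn0.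
  by apply/funext => x; rewrite /trig_prod big_nil mulr1.
move=> /andP[/andP[e1 e2] esV] /andP[/andP[v1 v2] esv] unit uU uv.
have unit' : {in es, forall e, unit_valued e}.
  by move=> f fes; apply: unit; rewrite inE fes orbT.
set M := L%:R ^+ size es * beta in IH *.
pose n (a b : 'I_L) : int := (a%:Z - b%:Z).
pose d (j : 'I_L) (a b : 'I_L) : R := 2 * pi * ((n a b)%:~R * (j%:R / L%:R)).
pose T (j a b : 'I_L) x := e.2 (j%:R / L%:R) / 2 *
  (cos (phase (add_edge u (n a b) e.1.1 e.1.2) (c - d j a b) x) * trig_prod es x +
   cos (phase (add_edge u (- n a b) e.1.1 e.1.2) (c + d j a b) x) * trig_prod es x).
have cT j a b : continuous (T j a b).
  apply: continuous_scale; apply: continuous_add; apply: continuous_mul;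
    by [exact: continuous_cos_phase|exact: continuous_trig_prod].
have E x : cos (phase u c x) * trig_prod (e :: es) x =
    L%:R ^- 2 * \sum_(j < L) \sum_(a < L) \sum_(b < L) T j a b x.
  rewrite /trig_prod big_cons -/(trig_prod es x) trigapprox_cosE.
  set S := \sum_(_ < _) _.
  rewrite [LHS](_ : _ = L%:R ^- 2 * (S * (cos (phase u c x) * trig_prod es x))); last by ring.
  congr (_ * _); rewrite mulr_suml; apply: eq_bigr => j _.
  rewrite mulr_suml; apply: eq_bigr => a _; rewrite mulr_suml; apply: eq_bigr => b _.
  rewrite /T !(@phase_add_edge _ _ _ e.1.1 e.1.2)// /d -/(edge_diff e x) (rmorphN _ (n a b)) /=.
  have -> : (n a b)%:~R = a%:R - b%:R :> R by rewrite /n intrB.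
  set y := 2 * pi * ((a%:R - b%:R) * (edge_diff e x - _)).
  rewrite (_ : phase u (c - _) x + _ = phase u c x + y); last by rewrite /phase /y; ring.
  rewrite (_ : phase u (c + _) x + _ = phase u c x - y); last by rewrite /phase /y; ring.
  by rewrite cosD cosB; field.
have cS j a : continuous (fun x => \sum_(b < L) T j a b x) by exact: continuous_sum.
have cS2 j : continuous (fun x => \sum_(a < L) \sum_(b < L) T j a b x) by exact: continuous_sum.
rewrite (eq_Int (fun x _ => E x)) IntZ; last exact: continuous_sum.
rewrite Int_sum// normrM ger0_norm ?invr_ge0 ?exprn_ge0//.
have Lgt0 : 0 < L%:R :> R by rewrite ltr0n.
rewrite mulrC ler_pdivrMr ?exprn_gt0//.
have M0 : 0 <= M by rewrite mulr_ge0 ?exprn_ge0.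
have nL (a b : 'I_L) : (`|n a b| <= L)%N by exact: absz_ord_sub.
have TM j a b : `|Int A B (T j a b)| <= M.
  rewrite IntZ; last by apply: continuous_add; apply: continuous_mul;
    by [exact: continuous_cos_phase|exact: continuous_trig_prod].
  rewrite IntD; try (apply: continuous_mul;
    by [exact: continuous_cos_phase|exact: continuous_trig_prod]).
  rewrite normrM.
  have /andP[g0 g1] := unit _ (mem_head _ _) (j%:R / L%:R).
  have addU m : (`|m| <= L)%N -> forall i, (`|add_edge u m e.1.1 e.1.2 i| + size es * L <= U)%N.
    move=> mL i; have := uU i; rewrite mulSn addnA => H.
    by apply: leq_trans H; rewrite leq_add2r (leq_trans (add_edge_le _ _ _ _ _))// leq_add2l.
  have addv m : add_edge u m e.1.1 e.1.2 v != 0.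
    by rewrite /add_edge ![v == _]eq_sym (negPf v1) (negPf v2) addr0 subr0.
  have H1 := IH _ (c - d j a b) esV esv unit' (addU _ (nL a b)) (addv _).
  have H2 := IH _ (c + d j a b) esV esv unit' (addU (- n a b) _) (addv _).
  have {}H2 := H2 (leq_trans (eq_leq (abszN _)) (nL a b)).
  have := ler_normD (Int A B (fun x => cos (phase (add_edge u (n a b) e.1.1 e.1.2) (c - d j a b) x)
     * trig_prod es x)) (Int A B (fun x => cos (phase (add_edge u (- n a b) e.1.1 e.1.2)
     (c + d j a b) x) * trig_prod es x)).
  set I1 := Int _ _ _ in H1 *; set I2 := Int _ _ _ in H2 * => H3.
  rewrite (ger0_norm (_ : 0 <= e.2 _ / 2)); last lra.
  have : e.2 (j%:R / L%:R) / 2 * `|I1 + I2| <= 2^-1 * (M + M).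
    by apply: ler_pM => //; lra.
  lra.
apply: (@le_trans _ _ (\sum_(j < L) \sum_(a < L) \sum_(b < L) M)).
  apply: le_trans (ler_norm_sum _ _ _) _; apply: ler_sum => j _.
  rewrite Int_sum//; apply: le_trans (ler_norm_sum _ _ _) _; apply: ler_sum => a _.
  rewrite Int_sum//; apply: le_trans (ler_norm_sum _ _ _) _; apply: ler_sum => b _.
  exact: TM.
rewrite !sumr_const !card_ord -!mulrnA -(mulr_natr M) !natrM exprS /M.
by rewrite le_eqVlt; apply/orP; left; apply/eqP; ring.
Qed.

Lemma Int_trig_prod_peel e es : oscillates e.1.1 -> edge_in e -> e.1.1 != e.1.2 ->
  all edge_in es -> all (edge_avoids e.1.1) es -> unit_valued e ->
  {in es, forall f, unit_valued f} -> (L + size es * L <= U)%N ->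
  `|Int A B (trig_prod (e :: es)) - gridavg L e.2 * Int A B (trig_prod es)| <=
    L%:R ^+ (size es).+1 * beta.
Proof.
move=> osc /andP[e1 e2] ee esV esv unit unit' LU.
have Lgt0 : 0 < L%:R :> R by rewrite ltr0n.
pose n (a b : 'I_L) : int := (a%:Z - b%:Z).
pose T (j a b : 'I_L) x := e.2 (j%:R / L%:R) *
  (cos (phase (add_edge (fun=> 0) (n a b) e.1.1 e.1.2)
    (- (2 * pi * ((n a b)%:~R * (j%:R / L%:R)))) x) * trig_prod es x).
have cT j a b : continuous (T j a b).
  apply: continuous_scale; apply: continuous_mul;
    by [exact: continuous_cos_phase|exact: continuous_trig_prod].
have cS j a : continuous (fun x => \sum_(b < L | b != a) T j a b x) by exact: continuous_sum.
have cS2 j : continuous (fun x => \sum_(a < L) \sum_(b < L | b != a) T j a b x).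
  exact: continuous_sum.
have cS3 : continuous (fun x => \sum_(j < L) \sum_(a < L) \sum_(b < L | b != a) T j a b x).
  exact: continuous_sum.
have E x : trig_prod (e :: es) x = gridavg L e.2 * trig_prod es x +
    L%:R ^- 2 * \sum_(j < L) \sum_(a < L) \sum_(b < L | b != a) T j a b x.
  rewrite /trig_prod big_cons -/(trig_prod es x) trigapproxE// mulrDl; congr (_ + _).
  rewrite -mulrA; congr (_ * _); rewrite mulr_suml; apply: eq_bigr => j _.
  rewrite mulr_suml; apply: eq_bigr => a _; rewrite mulr_suml; apply: eq_bigr => b _.
  rewrite /T phase_add_edge// -/(edge_diff e x) mulrA; congr (_ * cos _ * _).
  have -> : (n a b)%:~R = a%:R - b%:R :> R by rewrite /n intrB.
  rewrite /phase big1 => [|i _]; last by rewrite mul0r.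
  by ring.
rewrite (eq_Int (fun x _ => E x)) IntD; last exact: continuous_scale.
- rewrite IntZ; last exact: continuous_trig_prod.
  rewrite addrC addKr IntZ// normrM ger0_norm ?invr_ge0 ?exprn_ge0//.
  rewrite mulrC ler_pdivrMr ?exprn_gt0//.
  have M0 : 0 <= L%:R ^+ size es * beta by rewrite mulr_ge0 ?exprn_ge0.
  have TM j a b : b != a -> `|Int A B (T j a b)| <= L%:R ^+ size es * beta.
    move=> ba; rewrite IntZ; last by apply: continuous_mul;
      [exact: continuous_cos_phase|exact: continuous_trig_prod].
    have /andP[g0 g1] := unit (j%:R / L%:R).
    rewrite normrM (ger0_norm g0) -[leRHS]mul1r; apply: ler_pM => //.
    apply: (Int_cos_trig_prod _ osc) => //.
    - move=> i; apply: leq_trans LU; rewrite leq_add2r.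
      by rewrite (leq_trans (add_edge_le _ _ _ _ _))// absz0 add0n absz_ord_sub.
    - rewrite /add_edge eqxx (negPf ee) add0r subr0 /n subr_eq0.
      by apply: contra ba => /eqP[] /val_inj ->.
  apply: (@le_trans _ _ (\sum_(j < L) \sum_(a < L) \sum_(b < L) L%:R ^+ size es * beta)).
    rewrite Int_sum//; apply: le_trans (ler_norm_sum _ _ _) _; apply: ler_sum => j _.
    rewrite Int_sum//; apply: le_trans (ler_norm_sum _ _ _) _; apply: ler_sum => a _.
    rewrite Int_sum//; apply: le_trans (ler_norm_sum _ _ _) _.
    rewrite [leRHS](bigID (fun b => b != a))/= -[leLHS]addr0; apply: lerD.
      by apply: ler_sum => b; exact: TM.
    by rewrite sumr_ge0.
  rewrite !sumr_const !card_ord -!mulrnA -(mulr_natr (_ * beta)) !natrM exprS.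
  by rewrite le_eqVlt; apply/orP; left; apply/eqP; ring.
- by apply: continuous_scale; exact: continuous_trig_prod.
Qed.

(* The first endpoint of each edge does not occur in the later ones, so its phase
   survives in every frequency: the factors can be replaced by their means one at
   a time. *)
Fixpoint peelable es : Prop :=
  if es is e :: es' then
    [/\ oscillates e.1.1, e.1.1 != e.1.2, all (edge_avoids e.1.1) es' & peelable es']
  else True.

Lemma gridavg_itv (g : R -> R) : (forall t, 0 <= g t <= 1) -> 0 <= gridavg L g <= 1.
Proof.
move=> g01; have Lgt0 : 0 < L%:R :> R by rewrite ltr0n.
rewrite mulr_ge0 ?invr_ge0//=; last first.
  by apply: sumr_ge0 => j _; have /andP[] := g01 (j%:R / L%:R).
rewrite /gridavg mulrC ler_pdivrMr// mul1r -[leRHS](_ : \sum_(j < L) 1 = _); last first.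
  by rewrite sumr_const card_ord.
by apply: ler_sum => j _; have /andP[] := g01 (j%:R / L%:R).
Qed.

Lemma Int_trig_prod es : peelable es -> all edge_in es ->
  {in es, forall e, unit_valued e} -> (size es * L <= U)%N ->
  `|Int A B (trig_prod es) - (B - A) * \prod_(e <- es) gridavg L e.2| <=
    (size es)%:R * L%:R ^+ size es * beta.
Proof.
have Lge1 : 1 <= L%:R :> R by rewrite ler1n.
elim: es => [|e es IH].
  move=> _ _ _ _; rewrite big_nil mulr1 /= !mul0r -(_ : Int A B (fun=> 1) = B - A).
    by rewrite (eq_Int (g := fun=> 1)) ?subrr ?normr0// => x _; rewrite /trig_prod big_nil.
  by rewrite Int_cst// mul1r.
move=> [osc ee esv pes] /= /andP[eV esV] unit LU.
have unit' : {in es, forall e, unit_valued e}.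
  by move=> f fes; apply: unit; rewrite inE fes orbT.
have ue := unit _ (mem_head _ _).
have LU' : (size es * L <= U)%N by apply: leq_trans LU; rewrite mulSn leq_addl.
have H1 := Int_trig_prod_peel osc eV ee esV esv ue unit' LU.
have H2 := IH pes esV unit' LU'.
have /andP[g0 g1] := gridavg_itv ue.
rewrite big_cons (_ : _ - _ = (Int A B (trig_prod (e :: es)) -
  gridavg L e.2 * Int A B (trig_prod es)) + gridavg L e.2 *
  (Int A B (trig_prod es) - (B - A) * \prod_(e <- es) gridavg L e.2)); last by ring.
apply: le_trans (ler_normD _ _) _.
rewrite /= -natr1 [leRHS](_ : _ = L%:R ^+ (size es).+1 * beta +
  (size es)%:R * L%:R ^+ (size es).+1 * beta); last by ring.
apply: lerD => //; rewrite normrM (ger0_norm g0).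
apply: (@le_trans _ _ (1 * ((size es)%:R * L%:R ^+ size es * beta))).
  by apply: ler_pM.
rewrite mul1r ler_wpM2r// ler_wpM2l// exprS -[leLHS]mul1r.
by rewrite ler_wpM2r// exprn_ge0.
Qed.

Definition edge_prod es x := \prod_(e <- es) e.2 (edge_diff e x).

Lemma edge_prod_dist es eta x : 0 <= eta -> {in es, forall e, unit_valued e} ->
  {in es, forall e, forall t, `|trigapprox L e.2 t - e.2 t| <= eta} ->
  [/\ 0 <= edge_prod es x <= 1, 0 <= trig_prod es x <= 1 &
   `|trig_prod es x - edge_prod es x| <= (size es)%:R * eta].
Proof.
move=> eta0; rewrite /edge_prod /trig_prod; elim: es => [|e es IH] unit app.
  by rewrite !big_nil subrr normr0 mul0r ler01 lexx.
have unit' : {in es, forall e, unit_valued e}.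
  by move=> f fes; apply: unit; rewrite inE fes orbT.
have ue := unit _ (mem_head _ _).
have [|/andP[g0 g1] /andP[t0 t1] D] := IH unit'.
  by move=> f fes; apply: app; rewrite inE fes orbT.
have De := app _ (mem_head _ _) (edge_diff e x).
rewrite !big_cons.
have /andP[a0 a1] := ue (edge_diff e x).
have /andP[b0 b1] := trigapprox_itv (edge_diff e x) L0 ue.
move: g0 g1 t0 t1 D De a0 a1 b0 b1.
set G := \prod_(_ <- _) _; set T := \prod_(_ <- _) _; set p := trigapprox _ _ _; set g := e.2 _.
move=> g0 g1 t0 t1 D De a0 a1 b0 b1.
split; first by rewrite mulr_ge0//= mulr_ile1.
  by rewrite mulr_ge0//= mulr_ile1.
rewrite (_ : p * T - g * G = p * (T - G) + (p - g) * G); last by ring.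
apply: le_trans (ler_normD _ _) _; rewrite /= -natr1.
rewrite [leRHS](_ : _ = (size es)%:R * eta + eta); last by ring.
rewrite !normrM; apply: lerD.
  rewrite -[leRHS]mul1r; apply: ler_pM => //; by rewrite ger0_norm.
rewrite -[leRHS]mulr1; apply: ler_pM => //; by rewrite ger0_norm.
Qed.

Lemma Int_edge_prod es eta : peelable es -> all edge_in es -> 0 <= eta ->
  {in es, forall e, unit_valued e} -> {in es, forall e, continuous e.2} ->
  {in es, forall e, forall t, `|trigapprox L e.2 t - e.2 t| <= eta} ->
  (size es * L <= U)%N ->
  `|Int A B (edge_prod es) - (B - A) * \prod_(e <- es) gridavg L e.2| <=
    (size es)%:R * ((B - A) * eta + L%:R ^+ size es * beta).
Proof.
move=> pes esV eta0 unit ces app LU.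
have cep : continuous (edge_prod es).
  rewrite /edge_prod; elim: es ces {pes esV unit app LU} => [|e es IH] ces x.
    by under eq_fun do rewrite big_nil; exact: cvg_cst.
  under eq_fun do rewrite big_cons; move: x; apply: continuous_mul.
    by apply: continuous_compose; [exact: ces (mem_head _ _)|exact: continuous_edge_diff].
  by apply: IH => f fes; apply: ces; rewrite inE fes orbT.
have H1 := Int_trig_prod pes esV unit LU.
have H2 : `|Int A B (trig_prod es) - Int A B (edge_prod es)| <= (size es)%:R * eta * (B - A).
  rewrite -IntB//; last exact: continuous_trig_prod.
  apply: Int_norm_le => // [|x _]; last by have [] := edge_prod_dist x eta0 unit app.
  by move=> x; apply: continuousB; [exact: continuous_trig_prod|exact: cep].
rewrite distrC in H2;
rewrite (_ : Int A B (edge_prod es) - _ = (Int A B (edge_prod es) - Int A B (trig_prod es)) +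
  (Int A B (trig_prod es) - (B - A) * \prod_(e <- es) gridavg L e.2)); last by ring.
apply: le_trans (ler_normD _ _) _; rewrite mulrDr; apply: lerD; last by rewrite mulrA.
by apply: (le_trans H2); rewrite -mulrA (mulrC eta).
Qed.

End Peeling.

(** * Oscillation of the phases e^(x a_n) *)

Lemma piecewise_exponent_le (k r r' : nat) : (r <= r')%N ->
  (piecewise_exponent k r <= piecewise_exponent k r')%N.
Proof.
move=> /subnK <-; elim: (r' - r)%N => // n IH; rewrite addSn /=.
by apply: (leq_trans IH); rewrite mulnDl mul1n addnA; lia.
Qed.

Section ExponentialPhase.
Variables (R : realType) (a : nat -> R) (A B w : R) (k U : nat) (V : seq nat).
Hypotheses (A0 : 0 < A) (AB : A <= B) (Bk : B <= A * k%:R) (w0 : 0 < w) (w2 : w <= 2^-1).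
Hypotheses (Uw : U%:R * w <= 1) (uniqV : uniq V).

Definition exp_theta (n : nat) (x : R) : R := expR (x * a n).

Lemma continuous_exp_theta n : continuous (exp_theta n).
Proof.
apply: continuous_compose; first exact: continuous_expR.
by apply: continuous_mul => x; [exact: cvg_id|exact: cst_continuous].
Qed.

Lemma is_derive_phase u c (x : R) : is_derive x 1 (phase exp_theta V u c)
  (2 * pi * \sum_(i <- V) (u i)%:~R * (a i * expR (x * a i))).
Proof.
rewrite -[X in is_derive _ _ _ X]addr0 /phase.
apply: is_deriveD; apply: is_deriveZ.
elim: V => [|i s IH].
  by under eq_fun do rewrite big_nil; rewrite big_nil; exact: is_derive_cst.
under eq_fun do rewrite big_cons; rewrite big_cons; apply: is_deriveD.
apply: is_deriveZ; rewrite /exp_theta.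
have := is_derive_expR_scale (- a i) x; rewrite opprK mulrN opprK.
by under eq_fun do rewrite mulrN opprK.
Qed.

(** The largest index [m] with a nonzero frequency governs the derivative of the phase. As m >= v,
    control of gaps and growth from [v] on is enough; the relative coefficients are at most U <= 1 /
    w in size because a i <= a m and |u m| >= 1. *)
Lemma oscillates_exp v : v \in V -> {in V, forall n, 0 < a n} ->
  {in V &, forall m n, (v <= m)%N -> (n < m)%N -> w <= a m - a n} ->
  {in V, forall m, (v <= m)%N -> 1 <= a m /\
     expR (- (A * a m)) <= w ^+ (2 * piecewise_exponent k (size V) + 2)} ->
  oscillates exp_theta A B V U
    ((3 ^ size V)%:R * (2 + (B - A) * (1 + (size V)%:R / A)) * w) v.
Proof.
move=> vV apos gap big u c uU uv.
have [m /andP[mV um] mmax] : exists2 m, (m \in V) && (u m != 0) &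
    forall i, i \in V -> (m < i)%N -> u i = 0.
  have ex : exists m, (m \in V) && (u m != 0) by exists v; rewrite vV.
  have bd m : (m \in V) && (u m != 0) -> (m <= \max_(i <- V) i)%N.
    by case/andP=> mV _; exact: (@leq_bigmax_seq _ V xpredT id).
  case: (ex_maxnP ex bd) => m Pm mmax; exists m => // i iV; rewrite ltnNge.
  by apply: contraNeq => ui; apply: mmax; rewrite iV.
have vm : (v <= m)%N by rewrite leqNgt; apply: contra uv => /(mmax _ vV) ->.
have [am1 amE] := big _ mV vm.
have am0 : 0 < a m by exact: apos.
have umR : (u m)%:~R != 0 :> R by rewrite intr_eq0.
pose f i : R * R := ((u i)%:~R * a i / ((u m)%:~R * a m), a m - a i).
pose s0 := [seq f i | i <- V & (i < m)%N].
pose s := sort (fun p q : R * R => q.2 <= p.2) s0.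
have ss : perm_eq s s0 by rewrite perm_sort.
have szs : (size s <= size V)%N.
  by rewrite size_sort size_map size_filter count_size.
have ms p : p \in s -> exists2 i, i \in V & (i < m)%N /\ p = f i.
  rewrite (perm_mem ss) => /mapP[i]; rewrite mem_filter => /andP[im iV] ->.
  by exists i.
have srt : sorted (fun p q : R * R => q.2 <= p.2) s.
  by apply: sort_sorted => p q; exact: le_total.
have sw : {in s, forall p, w <= p.2}.
  by move=> p /ms[i iV [im ->]]; exact: gap.
have sc : {in s, forall p, `|p.1| * w <= 1}.
  move=> p /ms[i iV [im ->]]/=.
  have ai0 : 0 < a i by exact: apos.
  have aim : a i <= a m by have := gap _ _ mV iV vm im; have := w0; lra.
  have u1 : 1 <= `|(u m)%:~R : R|.
    by rewrite -intr_norm ler1z -gtz0_ge1 normr_gt0.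
  have uiU : `|(u i)%:~R : R| <= U%:R.
    by rewrite -intr_norm -[`|u i|%R]abszE -[X in X <= _]/((`|u i|%N)%:R) ler_nat.
  apply: le_trans Uw; rewrite ler_wpM2r ?(ltW w0)// normrM normfV !normrM.
  rewrite (gtr0_norm ai0) (gtr0_norm am0) ler_pdivrMr ?mulr_gt0//; last lra.
  apply: ler_pM => //; first exact: ltW.
  by apply: (le_trans aim); rewrite -[leLHS]mul1r ler_wpM2r// ltW.
pose K : R := 2 * pi * ((u m)%:~R * a m).
have lamK : a m <= `|K|.
  rewrite /K !normrM (gtr0_norm am0) (ger0_norm (pi_ge0 R)) ger0_norm// mulrA.
  rewrite -[leLHS]mul1r ler_wpM2r ?(ltW am0)//.
  have u1 : 1 <= `|(u m)%:~R : R| by rewrite -intr_norm ler1z -gtz0_ge1 normr_gt0.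
  have p2 := pi_ge2 R.
  rewrite -[leLHS]mul1r; apply: ler_pM => //; lra.
have dphi (x : R) : is_derive x 1 (phase exp_theta V u c) (K * expR (x * a m) * expsum s x).
  rewrite [X in is_derive _ _ _ X](_ : _ =
    2 * pi * \sum_(i <- V) (u i)%:~R * (a i * expR (x * a i))); first exact: is_derive_phase.
  rewrite /expsum (perm_big _ ss)/= /s0 big_map big_filter /K -!mulrA; do 2 congr (_ * _).
  rewrite [RHS](bigD1_seq m)//= mulrA mulrA -[RHS]mulr1 !mulrDr mulr1 [in RHS]mulr1; congr (_ + _).
    by rewrite mulrA.
  rewrite mulr_sumr [RHS](bigID (fun i => (i < m)%N))/= [X in _ = _ + X]big_seq_cond.
  rewrite [X in _ = _ + X]big1 => [|i /andP[iV /andP[im]]]; last first.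
    rewrite -leqNgt leq_eqVlt eq_sym (negPf im)/= => /(mmax _ iV) ->.
    by rewrite mul0r.
  rewrite addr0 [RHS](eq_bigl (fun i => (i < m)%N)); last first.
    by move=> i; case: ltngtP; rewrite ?andbF ?andbT.
  apply: eq_bigr => i im.
  rewrite [expR (x * a i)](_ : _ = expR (x * a m) * expR (- (x * (a m - a i)))); last first.
    by rewrite -expRD; congr expR; ring.
  by field; rewrite umR gt_eqF.
have := @Int_cos_expsum R A B w (a m) K (phase exp_theta V u c) s k A0 AB Bk w0 w2 srt sw sc am1 lamK.
move=> /(_ _ dphi) H; apply: le_trans (H _) _.
  have w1 : w <= 1 by have := w2; lra.
  apply: (le_trans amE); rewrite ler_wiXn2l ?(ltW w0)//.
  by rewrite leq_add2r leq_mul2l piecewise_exponent_le// orbT.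
have BA : 0 <= B - A by rewrite subr_ge0.
have szR : (size s)%:R / A <= (size V)%:R / A by rewrite ler_pM2r ?invr_gt0// ler_nat.
have sz0 : 0 <= (size s)%:R / A by rewrite divr_ge0// ltW.
rewrite ler_wpM2r ?(ltW w0)//; apply: ler_pM => //.
- by rewrite addr_ge0// mulr_ge0// addr_ge0.
- by rewrite ler_nat leq_pexp2l.
- by rewrite lerD2l ler_wpM2l//; lra.
Qed.

End ExponentialPhase.

Section TentEdges.
Variable R : realType.

(** The combinatorial part of [peelable], with a predicate on indices in place of oscillation. *)
Fixpoint peel_order (big : pred nat) (es : seq (edge R)) : bool :=
  if es is e :: es' then
    [&& big e.1.1, e.1.1 != e.1.2, all (edge_avoids e.1.1) es' & peel_order big es']
  else true.

Definition tent_edge (S : R) (e : edge R) : Prop :=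
  exists s c : R, [/\ 0 <= s, s <= S & e.2 = (fun t => tent s (t - c))].

Lemma tent_edge_unit S e : tent_edge S e -> unit_valued e.
Proof. by move=> [s [c [s0 _ eE]]] t; rewrite eE tent_ge0 tent_le1. Qed.

Lemma tent_edge_lipschitz S e x y : tent_edge S e -> `|e.2 x - e.2 y| <= S * dn (x - y).
Proof.
move=> [s [c [s0 sS ->]]]; apply: le_trans (tent_lipschitz _ _ s0) _.
rewrite (_ : x - c - (y - c) = x - y); last by ring.
by rewrite ler_wpM2r// dn_ge0.
Qed.

Lemma continuous_tent (s : R) : continuous (tent s).
Proof.
move=> x; apply: (@continuous_max R R (fun=> 0) (fun t => 1 - s * dn t) x).
  exact: cst_continuous.
apply: continuousB; first exact: cst_continuous.
by apply: continuous_scale; exact: continuous_dn.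
Qed.

Lemma tent_edge_continuous S e : tent_edge S e -> continuous e.2.
Proof.
move=> [s [c [_ _ ->]]]; apply: continuous_compose; first exact: continuous_tent.
by apply: continuous_add => x; [exact: cvg_id|exact: cst_continuous].
Qed.

Definition endpoints (es : seq (edge R)) : seq nat := flatten [seq [:: e.1.1; e.1.2] | e <- es].

Lemma size_endpoints es : size (endpoints es) = (2 * size es)%N.
Proof. by elim: es => //= e es IH; rewrite IH; lia. Qed.

Lemma mem_endpoints es e : e \in es -> (e.1.1 \in endpoints es) && (e.1.2 \in endpoints es).
Proof.
move=> ees; apply/andP; split; apply/flattenP; exists [:: e.1.1; e.1.2];
  by rewrite ?inE ?eqxx ?orbT//; apply/mapP; exists e.
Qed.

End TentEdges.

Section Equidistribution.
Variables (R : realType) (a : nat -> R).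
Hypotheses (apos : forall n, (1 <= n)%N -> 0 < a n)
  (aincr : forall m n, (1 <= m)%N -> (m < n)%N -> a m < a n)
  (agrowth : a n / ln (n%:R : R) @[n --> \oo] --> +oo)
  (agap : exists2 C : R, 0 < C & \forall n \near \oo, n%:R `^ (- C) <= a n.+1 - a n).

Lemma growth_log (T : R) : \forall n \near \oo, T * ln n%:R <= a n.
Proof.
move/cvgryPge/(_ T): agrowth => H; near=> n.
have n1 : 0 < ln (n%:R : R).
  by rewrite ln_gt0// ltr1n; near: n; exact: nbhs_infty_gt.
by rewrite -ler_pdivlMr//; near: n.
Unshelve. all: by end_near. Qed.

(* An index [v] counts as large when [m < v ^ k].  The at most [m ^ (1/k)] small
   indices contribute at most [m] to a k-fold sum, but already [a v] is a large
   multiple of [ln m] for large [v]. *)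
Lemma near_large_index (k : nat) (P : nat -> Prop) : (0 < k)%N ->
  (\forall n \near \oo, P n) ->
  \forall m \near \oo, forall v, (m < v ^ k)%N -> P v /\ P v.-1.
Proof.
move=> k0 [n0 _ H]; exists (n0.+1 ^ k)%N => // m /= nm v mv.
have nv : (n0.+1 < v)%N by rewrite -(ltn_exp2r _ _ k0); exact: leq_ltn_trans nm mv.
by split; apply: H => /=; lia.
Qed.

Lemma large_index (k D : nat) (A : R) : (0 < k)%N -> 0 < A ->
  \forall m \near \oo, forall v, (m < v ^ k)%N ->
    1 <= a v /\ expR (- (A * a v)) <= m%:R ^- D.
Proof.
(* As ln v >= ln 2, the first summand of [T] forces a v >= 1; the second gives expR (- (A * a v)) <=
   v^-(k D) <= m^-D. *)
move=> k0 A0; pose T : R := (ln 2)^-1 + (k * D)%:R / A.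
have ln2 : 0 < ln 2 :> R by rewrite ln_gt0// ltr1n.
have [n0 _ H] := near_large_index k0 (growth_log T).
exists (maxn n0 2) => // m /=; rewrite geq_max => /andP[nm m1] v mv.
have [Tv _] := H m nm v mv.
have v1 : (1 < v)%N.
  by case: v mv {Tv} => [|[|//]]; rewrite ?exp1n ?exp0n; lia.
have lv2 : ln 2 <= ln (v%:R : R) by rewrite ler_ln ?posrE ?ltr0n ?ler_nat//; lia.
have lv : 0 < ln (v%:R : R) by lra.
have kD0 : 0 <= (k * D)%:R / A by rewrite divr_ge0// ltW.
split.
  apply: le_trans Tv; rewrite /T mulrDl -[leLHS]addr0; apply: lerD.
    by rewrite mulrC ler_pdivlMr// mul1r.
  by rewrite mulr_ge0// ltW.
have v0 : 0 < v%:R :> R by rewrite ltr0n; lia.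
apply: (@le_trans _ _ (v%:R ^- (k * D))).
  rewrite -[X in _ <= (X ^+ _)^-1](lnK v0) -expRM_natl -expRN ler_expR lerN2.
  apply: (@le_trans _ _ (A * (T * ln v%:R))); last by rewrite ler_pM2l.
  rewrite mulrA ler_pM2r// /T mulrDr mulrCA mulfV ?gt_eqF// mulr1 lerDr.
  by rewrite divr_ge0 ?ltW.
rewrite exprM lef_pV2 ?posrE ?exprn_gt0//; last by rewrite ltr0n; lia.
by rewrite lerXn2r ?nnegrE// -natrX ler_nat ltnW.
Qed.

(** By monotonicity the closest index is v - 1, to which the gap hypothesis applies; v <= m ^ 4
    turns its bound into a power of m. *)
Lemma large_index_gap (k : nat) : (0 < k)%N -> exists C : nat,
  \forall m \near \oo, forall v i, (m < v ^ k)%N -> (v <= m ^ 4)%N -> (1 <= i)%N -> (i < v)%N ->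
    m%:R ^- (4 * C) <= a v - a i.
Proof.
move=> k0; have [C C0 HC] := agap; pose D := (Num.truncn C).+1; exists D.
have CD : C <= D%:R by rewrite /D ltW// truncnS_gt.
have [n0 _ H] := near_large_index k0 HC.
exists (maxn n0 2) => // m /=; rewrite geq_max => /andP[nm m1] v i mv vm i1 iv.
have [_ Hv] := H m nm v mv.
have v1 : (0 < v.-1)%N by lia.
have v0 : (0 < v)%N by lia.
rewrite prednK// in Hv; apply: (@le_trans _ _ (a v - a v.-1)); last first.
  rewrite lerD2l lerN2; have [->//|] := eqVneq i v.-1 => iv'.
  by apply/ltW/aincr => //; lia.
apply: le_trans Hv; rewrite powRN lef_pV2 ?posrE ?exprn_gt0 ?powR_gt0 ?ltr0n//; last lia.
apply: (@le_trans _ _ (v.-1%:R `^ D%:R)); first by rewrite ler_powR// ler1n.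
rewrite powR_mulrn// exprM lerXn2r ?nnegrE ?exprn_ge0// -natrX ler_nat; lia.
Qed.

Lemma peelable_peel_order (A B beta : R) V U (big : pred nat) es :
  {in V, forall v, big v -> oscillates (exp_theta a) A B V U beta v} ->
  all (fun e : edge R => e.1.1 \in V) es -> peel_order big es ->
  peelable (exp_theta a) A B V U beta es.
Proof.
move=> osc; elim: es => //= e es IH /andP[eV esV] /and4P[be ee av pes].
by split => //; [exact: osc|exact: IH].
Qed.

Let exponent_bounds (C K k : nat) : (0 < k)%N -> let E := (4 * C + 16 * K * k + 8 * k + 1)%N in
  [/\ (1 <= E)%N, (4 * C <= E)%N & (8 * K < E)%N].
Proof. by clear; move=> k0 /=; split; nia. Qed.

Let double_le (n k : nat) : (n <= 2 * k)%N -> (2 * n <= 4 * k)%N.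
Proof. by clear; lia. Qed.

Let split8 (K : nat) : (8 * K = 4 * K + 4 * K)%N. Proof. by clear; lia. Qed.

Let eight_four (K k : nat) : (8 * K * (2 * k) = 16 * K * k)%N. Proof. by clear; lia. Qed.

Let four_K (k : nat) : (4 * (2 * k + 3) = 8 * k + 12)%N. Proof. by clear; lia. Qed.

(** The error m^-(8k) is N^-(2k) for N = m ^ 4: summed over all pairs of k-tuples of indices up to
    N, it stays bounded. *)
Lemma Int_tent_edges (k q : nat) (A B : R) : (0 < k)%N -> (0 < q)%N -> 0 < A -> A <= B ->
  \forall m \near \oo, forall es : seq (edge R), (size es <= 2 * k)%N ->
    {in endpoints es, forall v, (0 < v <= m ^ 4)%N} ->
    peel_order (fun v => m < v ^ k)%N es ->
    {in es, forall e, tent_edge (q * m ^ 4)%:R e} ->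
    `|Int A B (edge_prod (exp_theta a) es) -
      (B - A) * \prod_(e <- es) gridavg (q * m ^ (8 * (2 * k + 3))) e.2| <=
    m%:R ^- (8 * k).
Proof.
(* With L = q * m ^ (8 * K), the approximation error of a tent of slope at most q * m ^ 4 is at most
   2 q m^(4 - 4K) = 2 q m^(-8k - 8). *)
move=> k0 q0 A0 AB; set K := (2 * k + 3)%N.
have [C gapC] := large_index_gap k0.
pose b := (Num.truncn (B / A)).+1.
have Bb : B <= A * b%:R by rewrite mulrC -ler_pdivrMr// ltW// truncnS_gt.
(* Shares of the exponent in w = m^-E: 4 * C for the gaps, 16 * K * k for the factor L ^+ (2 * k), 8
   * k for the target, 1 for the constants. That E > 8 * K gives U * w <= 1. *)
pose E := (4 * C + 16 * K * k + 8 * k + 1)%N.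
have [E1 EC EK] : [/\ (1 <= E)%N, (4 * C <= E)%N & (8 * K < E)%N] := exponent_bounds C K k0.
(* At most 2 * k edges have at most 4 * k endpoints. *)
pose C0 : R := (3 ^ (4 * k))%:R * (2 + (B - A) * (1 + (4 * k)%:R / A)).
pose e0 := piecewise_exponent b (4 * k).
have big := large_index (E * (2 * e0 + 2)) k0 A0.
have BA : 0 <= B - A by rewrite subr_ge0.
have C00 : 0 <= C0 by rewrite mulr_ge0// addr_ge0// mulr_ge0// addr_ge0// divr_ge0// ltW.
near=> m.
have m2 : (2 <= m)%N by near: m; exact: nbhs_infty_ge.
have mkq : (2 * k * q <= m)%N by near: m; exact: nbhs_infty_ge.
have mB : 8 * (k * q)%:R * (B - A) <= m%:R by near: m; exact: nbhs_infty_ger.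
have mC0 : 4 * k%:R * q%:R ^+ (2 * k) * C0 <= m%:R by near: m; exact: nbhs_infty_ger.
have gapm : forall v i, (m < v ^ k)%N -> (v <= m ^ 4)%N -> (1 <= i)%N -> (i < v)%N ->
    m%:R ^- (4 * C) <= a v - a i by near: m; exact: gapC.
have bigm : forall v, (m < v ^ k)%N ->
    1 <= a v /\ expR (- (A * a v)) <= m%:R ^- (E * (2 * e0 + 2)) by near: m; exact: big.
move=> es szes Ves pes tes.
pose V := undup (endpoints es).
pose L := (q * m ^ (8 * K))%N.
pose U := (2 * k * L)%N.
pose w : R := m%:R ^- E.
have mge2 : 2 <= m%:R :> R by rewrite ler_nat.
have mgt0 : 0 < m%:R :> R by lra.
have mge1 : 1 <= m%:R :> R by lra.
have w0 : 0 < w by rewrite invr_gt0 exprn_gt0.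
have wX n r : m%:R ^- (n + r) = m%:R ^- n * m%:R ^- r :> R by rewrite exprD invfM.
have mle n r : (n <= r)%N -> m%:R ^- r <= m%:R ^- n :> R.
  by move=> nr; rewrite lef_pV2 ?posrE ?exprn_gt0// ler_weXn2l.
have w2 : w <= 2^-1.
  apply: (@le_trans _ _ (m%:R ^- 1)); first exact: mle.
  by rewrite expr1 lef_pV2 ?posrE.
have Uw : U%:R * w <= 1.
  rewrite ler_pdivrMr ?exprn_gt0// mul1r -natrX ler_nat /U /L mulnA.
  apply: (@leq_trans (m * m ^ (8 * K))); first by rewrite leq_mul2r mkq orbT.
  by rewrite -expnS leq_exp2l.
have szV : (size V <= 4 * k)%N.
  apply: (@leq_trans (size (endpoints es))); first exact: size_undup.
  rewrite size_endpoints; exact: double_le.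
have Vm v : v \in V -> (0 < v <= m ^ 4)%N by rewrite mem_undup; exact: Ves.
have L0 : (0 < L)%N by rewrite muln_gt0 q0 expn_gt0 (ltnW m2).
have Lgt0 : 0 < L%:R :> R by rewrite ltr0n.
have osc : {in V, forall v, (m < v ^ k)%N -> oscillates (exp_theta a) A B V U (C0 * w) v}.
  move=> v vV mv u c uU uv.
  apply: le_trans (_ : (3 ^ size V)%:R * (2 + (B - A) * (1 + (size V)%:R / A)) * w <= _).
    apply: (oscillates_exp A0 AB Bb w0 w2 Uw (undup_uniq _) vV) => //.
    - by move=> n /Vm /andP[n0 _]; exact: apos.
    - move=> n i nV iV vn iN.
      apply: le_trans (_ : m%:R ^- (4 * C) <= _); first exact: mle.
      have /andP[_ nm] := Vm _ nV; have /andP[i1 _] := Vm _ iV.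
      by apply: gapm => //; apply: (leq_trans mv); rewrite leq_exp2r.
    - move=> n nV vn; have [|H1 H2] := bigm n.
        by apply: (leq_trans mv); rewrite leq_exp2r.
      split => //; apply: (le_trans H2); rewrite exprVn -exprM.
      apply: mle; apply: leq_mul (leqnn _) _; rewrite leq_add2r; apply: leq_mul (leqnn _) _.
      exact: piecewise_exponent_le.
  rewrite ler_pM2r//; apply: ler_pM => //.
  - by rewrite addr_ge0// mulr_ge0// addr_ge0// divr_ge0// ltW.
  - by rewrite ler_nat leq_exp2l.
  - by rewrite lerD2l ler_wpM2l// lerD2l ler_pM2r ?invr_gt0// ler_nat.
have inV : all (edge_in V) es.
  by apply/allP => e /mem_endpoints; rewrite /edge_in !mem_undup.
have inV1 : all (fun e : edge R => e.1.1 \in V) es.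
  by apply: sub_all inV => e /andP[].
pose eta : R := (q * m ^ 4)%:R * (m%:R ^- (4 * K) + m%:R ^- (4 * K)).
have eta0 : 0 <= eta by rewrite mulr_ge0// addr_ge0// invr_ge0 exprn_ge0.
have app : {in es, forall e, forall t, `|trigapprox L e.2 t - e.2 t| <= eta}.
  move=> e ees t.
  have sg0 : 0 < m%:R ^- (4 * K) :> R by rewrite invr_gt0 exprn_gt0.
  apply: le_trans (trigapprox_dist t L0 _ sg0 (fun x y => tent_edge_lipschitz x y (tes e ees))) _ => //.
  rewrite /eta ler_wpM2l// lerD2l invfM invrK /L natrM natrX.
  rewrite split8.
  rewrite exprD; set M := m%:R ^+ (4 * K); have M0 : 0 < M by rewrite exprn_gt0.
  rewrite ler_pdivrMl ?mulr_gt0 ?ltr0n// mulrA mulfK ?gt_eqF//.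
  by rewrite -[leLHS]mul1r ler_pM2r// ler1n.
have unit : {in es, forall e, unit_valued e} by move=> e /tes; exact: tent_edge_unit.
have ces : {in es, forall e, continuous e.2} by move=> e /tes; exact: tent_edge_continuous.
have LU : (size es * L <= U)%N by rewrite /U leq_mul2r szes orbT.
have beta0 : 0 <= C0 * w by rewrite mulr_ge0// ltW.
have := @Int_edge_prod R (exp_theta a) A B V L U (C0 * w)
  (@continuous_exp_theta R a) AB (undup_uniq _) L0 beta0 es eta
  (peelable_peel_order osc inV1 pes) inV eta0 unit ces app LU.
move/le_trans; apply.
apply: (@le_trans _ _ ((2 * k)%:R * ((B - A) * eta + L%:R ^+ (2 * k) * (C0 * w)))).
  have t1 : 0 <= (B - A) * eta by exact: mulr_ge0.
  have t2 n : 0 <= L%:R ^+ n * (C0 * w) by apply: mulr_ge0 => //; exact: exprn_ge0.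
  apply: ler_pM; [exact: ler0n|exact: addr_ge0|by rewrite ler_nat|].
  by rewrite lerD2l ler_wpM2r// ler_weXn2l// ler1n.
have h1 : (2 * k)%:R * ((B - A) * eta) <= 2^-1 * m%:R ^- (8 * k).
  rewrite /eta /K four_K.
  rewrite wX [(q * _)%:R]natrM natrX [(2 * k)%:R]natrM.
  have mk : m%:R ^+ 4 * m%:R ^- 12 <= m%:R^-1 :> R.
    rewrite -(expr1 m%:R) ler_pdivrMr ?exprn_gt0// mulrC ler_pdivlMr ?exprn_gt0//.
    by rewrite -exprD ler_weXn2l.
  set y := m%:R ^- (8 * k); have y0 : 0 <= y by rewrite invr_ge0 exprn_ge0.
  rewrite [leLHS](_ : _ = (2^-1 * y) * (8 * (k * q)%:R * (B - A) * (m%:R ^+ 4 * m%:R ^- 12))); last first.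
    by rewrite (natrM _ k); set i12 := (_ ^+ 12)^-1; set M4 := _ ^+ 4; clearbody i12 M4 y; field.
  rewrite -[leRHS]mulr1 ler_wpM2l ?mulr_ge0//.
  apply: (@le_trans _ _ (m%:R * m%:R^-1)); last by rewrite mulfV// gt_eqF.
  by apply: ler_pM; rewrite ?mulr_ge0 ?invr_ge0 ?exprn_ge0.
have h2 : (2 * k)%:R * (L%:R ^+ (2 * k) * (C0 * w)) <= 2^-1 * m%:R ^- (8 * k).
  have -> : w = m%:R ^- (4 * C) * m%:R ^- (16 * K * k) * m%:R ^- (8 * k) * m%:R^-1.
    by rewrite /w /E !wX expr1.
  rewrite /L [(q * _)%:R]natrM natrX exprMn -exprM eight_four [(2 * k)%:R]natrM.
  set M := m%:R ^+ (16 * K * k); have M0 : 0 < M by rewrite exprn_gt0.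
  set y := m%:R ^- (8 * k); have y0 : 0 <= y by rewrite invr_ge0 exprn_ge0.
  set z := m%:R ^- (4 * C).
  have z1 : z <= 1 by rewrite invf_le1 ?exprn_gt0// exprn_ege1.
  have z0 : 0 <= z by rewrite invr_ge0 exprn_ge0.
  rewrite [leLHS](_ : _ = (2^-1 * y) * ((4 * k%:R * q%:R ^+ (2 * k) * C0) * (z * m%:R^-1))); last first.
    set Q := q%:R ^+ _; clearbody Q C0 z y M; field.
    by rewrite !gt_eqF.
  rewrite -[leRHS]mulr1 ler_wpM2l ?mulr_ge0//.
  apply: (@le_trans _ _ (m%:R * (1 * m%:R^-1))); last by rewrite mul1r mulfV// gt_eqF.
  apply: ler_pM; rewrite ?invr_ge0//.
  - by apply: mulr_ge0 => //; rewrite !mulr_ge0 ?exprn_ge0.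
  - by rewrite mulr_ge0 ?invr_ge0.
  - by rewrite ler_pM2r ?invr_gt0.
lra.
Unshelve. all: by end_near. Qed.

End Equidistribution.

(** * Second moment along fourth powers *)

Section Moments.
Variables (R : realType) (theta : nat -> R -> R) (A B : R) (k q N P H : nat).
Variables (large : pred nat) (c : nat -> int) (err : R).
Hypotheses (ctheta : forall n, continuous (theta n)) (AB : A <= B) (k0 : (0 < k)%N) (q0 : (0 < q)%N).
Hypotheses (N0 : (0 < N)%N) (P0 : (0 < P)%N) (H0 : (0 < H)%N) (qN2 : (2 <= q * N)%N) (HN : (4 * H <= N)%N).
(* When the product over a chain does not vanish, its vertices have phases at
   distance at most [H / N] from each other. *)
Hypothesis cH : forall i, (k * (`|c i| + 1) <= H)%N.
Hypothesis equidistributed : forall es : seq (edge R), (size es <= 2 * k)%N ->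
  {in endpoints es, forall v, (0 < v <= N)%N} -> peel_order large es ->
  {in es, forall e, tent_edge (q * N)%:R e} ->
  `|Int A B (edge_prod theta es) - (B - A) * \prod_(e <- es) gridavg (q * N * P) e.2| <= err.

Implicit Types (x y : seq nat) (es : seq (edge R)).

Definition chain_edge x (i : nat) : edge R :=
  (nth 0%N x i, nth 0%N x i.+1, fun t => tent (q * N)%:R (t - (c i)%:~R / (q * N)%:R)).

Definition chain x : seq (edge R) := [seq chain_edge x i | i <- iota 0 k.-1].

(* This slope makes the tent at least [1/2] at distance [H / N] from its centre. *)
Definition star_edge r (v : nat) : edge R :=
  (v, r, fun t => tent (N%:R / (2 * H)%:R) (t - 0)).

Definition star r vs : seq (edge R) := [seq star_edge r v | v <- vs].

Lemma size_chain x : size (chain x) = k.-1. Proof. by rewrite size_map size_iota. Qed.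

Lemma chain_tent x : {in chain x, forall e, tent_edge (q * N)%:R e}.
Proof. by move=> e /mapP[i _ ->]; exists (q * N)%:R, ((c i)%:~R / (q * N)%:R). Qed.

Lemma star_tent r vs : {in star r vs, forall e, tent_edge (q * N)%:R e}.
Proof.
move=> e /mapP[v _ ->]; exists (N%:R / (2 * H)%:R), 0; split => //.
rewrite ler_pdivrMr ?ltr0n ?muln_gt0// -natrM ler_nat.
by rewrite (mulnC q) -mulnA leq_pmulr// !muln_gt0 q0 H0.
Qed.

Lemma in_endpointsP es v : reflect (exists2 e, e \in es & (v == e.1.1) || (v == e.1.2))
  (v \in endpoints es).
Proof.
apply: (iffP flattenP) => [[s /mapP[e ees ->]]|[e ees]].
  by rewrite !inE => ve; exists e.
by move=> ve; exists [:: e.1.1; e.1.2]; [apply/mapP; exists e|rewrite !inE].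
Qed.

Lemma chain_endpoints x : size x = k -> {subset endpoints (chain x) <= x}.
Proof.
move=> sx v /in_endpointsP[e /mapP[i]]; rewrite mem_iota add0n => /andP[_ ik] ->.
by case/orP=> /eqP ->; apply: mem_nth; rewrite sx; lia.
Qed.

Lemma star_endpoints r vs : {subset endpoints (star r vs) <= r :: vs}.
Proof.
move=> v /in_endpointsP[e /mapP[i ivs ->]].
by case/orP=> /eqP ->; rewrite inE ?ivs ?eqxx ?orbT.
Qed.

Lemma edge_avoids_endpoints es v : v \notin endpoints es -> all (edge_avoids v) es.
Proof.
move=> ves; apply/allP => e ees; rewrite /edge_avoids.
by rewrite -negb_or; apply: contra ves => ve; apply/in_endpointsP; exists e => //;
  rewrite ![v == _]eq_sym.
Qed.

Lemma peel_order_cat es es' : peel_order large es -> peel_order large es' ->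
  {in endpoints es, forall v, v \notin endpoints es'} -> peel_order large (es ++ es').
Proof.
move=> + pes'; elim: es => //= e es IH /and4P[-> -> av pes] dis.
rewrite all_cat av IH//= ?edge_avoids_endpoints//.
  by apply: dis; rewrite inE eqxx.
by move=> v ves; apply: dis; rewrite !inE ves !orbT.
Qed.

Lemma chain_peel_order x : size x = k -> uniq x -> all large x -> peel_order large (chain x).
Proof.
move=> sx ux lx; rewrite /chain.
have gen j n : (j + n < k)%N -> peel_order large [seq chain_edge x i | i <- iota j n].
  elim: n j => //= n IH j jk; rewrite IH ?andbT; last lia.
  apply/and3P; split.
  - by apply: (allP lx); rewrite mem_nth// sx; lia.
  - by rewrite nth_uniq ?sx//; lia.
  - apply/allP => e /mapP[i]; rewrite mem_iota => /andP[ji ik] ->.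
    by rewrite /edge_avoids/= !nth_uniq ?sx//; lia.
by apply: gen; lia.
Qed.

(** Only leaves are first endpoints, so the centre [r] may be a small index. *)
Lemma star_peel_order r vs : r \notin vs -> uniq vs -> all large vs ->
  peel_order large (star r vs).
Proof.
elim: vs => //= v vs IH; rewrite inE negb_or => /andP[rv rvs] /andP[vvs uvs] /andP[lv lvs].
rewrite lv eq_sym rv IH// andbT/=; apply/allP => e /mapP[i ivs ->].
by rewrite /edge_avoids/= rv andbT; apply: contraNneq vvs => <-.
Qed.

(** The centres lie on the mesh 1 / (q N), of which the grid is a refinement by the factor [P]; the
    average of each tent is therefore exact. *)
Lemma chain_gridavg x : \prod_(e <- chain x) gridavg (q * N * P) e.2 = (q * N)%:R ^- k.-1 :> R.
Proof.
have qN0 : (q * N)%:R != 0 :> R by rewrite pnatr_eq0; lia.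
have Pn0 : P%:R != 0 :> R by rewrite pnatr_eq0 -lt0n.
rewrite /chain big_map (eq_bigr (fun=> (q * N)%:R^-1)) => [|i _].
  by rewrite big_const_seq count_predT size_iota iter_mulr_1 exprVn.
rewrite /gridavg/=; transitivity ((q * N * P)%:R^-1 * P%:R : R).
  congr (_ * _); rewrite -(@tent_grid_sum R (q * N * P) P (c i * P%:Z)) ?leq_mul2r ?qN2 ?orbT//.
  apply: eq_bigr => j _; congr (tent _ (_ - _)); first by rewrite [(q * N * P)%:R]natrM mulfK.
  by rewrite intrM [(q * N * P)%:R]natrM; set Q := (q * N)%:R in qN0 *; clearbody Q; field; rewrite qN0 Pn0.
by rewrite [(q * N * P)%:R]natrM invfM mulfVK.
Qed.

Lemma star_gridavg r vs :
  \prod_(e <- star r vs) gridavg (q * N * P) e.2 = ((2 * H)%:R / N%:R) ^+ size vs :> R.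
Proof.
have qn0 : q%:R != 0 :> R by rewrite pnatr_eq0 -lt0n.
have Nn0 : N%:R != 0 :> R by rewrite pnatr_eq0 -lt0n.
have Pn0 : P%:R != 0 :> R by rewrite pnatr_eq0 -lt0n.
have Hn0 : H%:R != 0 :> R by rewrite pnatr_eq0 -lt0n.
rewrite /star big_map (eq_bigr (fun=> (2 * H)%:R / N%:R)) => [|i _].
  by rewrite big_const_seq count_predT iter_mulr_1.
rewrite /gridavg/=; transitivity ((q * N * P)%:R^-1 * (2 * H * q * P)%:R : R); last first.
  by rewrite !natrM; field; rewrite qn0 Nn0 Pn0.
congr (_ * _); rewrite -(@tent_grid_sum R (q * N * P) (2 * H * q * P) 0) ?muln_gt0 ?H0 ?q0//.
  apply: eq_bigr => j _; congr (tent _ _); last by rewrite mul0r.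
  by rewrite !natrM; field; rewrite qn0 Hn0 Pn0.
by rewrite !mulnA leq_mul2r (mulnC q) leq_mul2r HN !orbT.
Qed.

Lemma chain_edge_close x i alpha : chain_edge x i \in chain x ->
  edge_prod theta (chain x) alpha != 0 ->
  dn (theta (nth 0%N x i) alpha - theta (nth 0%N x i.+1) alpha) * N%:R * k%:R <= H%:R.
Proof.
move=> ex; rewrite prodf_seq_neq0 => /allP/(_ _ ex)/=; rewrite /edge_diff/=.
set t := theta _ _ - theta _ _; set S := (q * N)%:R; set ci := (c i)%:~R.
have S0 : 0 < S by rewrite ltr0n; lia.
rewrite /tent neq_lt ltNge le_max lexx/= lt_max ltxx/= subr_gt0 => tc.
have : dn t <= dn (t - ci / S) + `|ci| / S.
  have := dnD (t - ci / S) (ci / S); rewrite subrK => /le_trans; apply.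
  rewrite lerD2l; apply: le_trans (dn_le_norm _) _.
  by rewrite normrM normfV (gtr0_norm S0).
have ciE : `|ci| = `|c i|%N%:R by rewrite /ci -intr_norm -abszE.
rewrite ciE => tS.
have {}tS : dn t * S <= (`|c i| + 1)%:R.
  rewrite natrD; have : dn t * S <= (dn (t - ci / S) + `|c i|%N%:R / S) * S by rewrite ler_pM2r.
  by rewrite mulrDl divfK ?gt_eqF// mulrC => h; lra.
apply: (@le_trans _ _ ((`|c i| + 1)%:R * k%:R)).
  rewrite ler_wpM2r//; apply: le_trans tS; rewrite ler_wpM2l ?dn_ge0// /S ler_nat.
  by rewrite leq_pmull.
by rewrite -natrM ler_nat mulnC.
Qed.

Lemma chain_close x alpha u v : size x = k -> edge_prod theta (chain x) alpha != 0 ->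
  u \in x -> v \in x -> dn (theta u alpha - theta v alpha) * N%:R <= H%:R.
Proof.
move=> sx fx ux vx.
have kgt0 : 0 < k%:R :> R by rewrite ltr0n.
have step i j : (i + j < k)%N ->
    dn (theta (nth 0%N x i) alpha - theta (nth 0%N x (i + j)) alpha) * N%:R * k%:R <= (j * H)%:R.
  elim: j => [|j IH] ijk.
    by rewrite addn0 subrr mul0n (_ : dn 0 = 0) ?mul0r// dn_eq_norm normr0.
  have ex : chain_edge x (i + j) \in chain x by apply: map_f; rewrite mem_iota; lia.
  have ij : (i + j < k)%N by lia.
  have := chain_edge_close ex fx; have := IH ij.
  rewrite addnS mulSn natrD.
  set a := theta (nth _ _ i) _; set b := theta (nth _ _ (i + j)) _; set d := theta _ _.
  move=> h1 h2.
  have : dn (a - d) * N%:R * k%:R <= (dn (a - b) + dn (b - d)) * N%:R * k%:R.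
    by do 2 (rewrite ler_wpM2r//); have := dnD (a - b) (b - d); rewrite addrA subrK.
  lra.
wlog uv : u v ux vx / (index u x <= index v x)%N.
  move=> W; case: (leqP (index u x) (index v x)) => [|/ltnW]; first exact: W.
  by rewrite -dnN opprB; exact: W.
have iv : (index v x < k)%N by rewrite -sx index_mem.
have := step (index u x) (index v x - index u x)%N.
rewrite subnKC// => /(_ iv); rewrite !nth_index// => h.
rewrite -(ler_pM2r kgt0); apply: (le_trans h); rewrite -natrM ler_nat mulnC leq_mul2l.
by rewrite (leq_trans (leq_subr _ _) (ltnW iv)) orbT.
Qed.

Lemma edge_prod_ge0 S es alpha : {in es, forall e, tent_edge S e} -> 0 <= edge_prod theta es alpha <= 1.
Proof.
rewrite /edge_prod; elim: es => [|e es IH] tes; first by rewrite big_nil ler01 lexx.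
have /andP[e0 e1] := tent_edge_unit (tes _ (mem_head _ _)) (edge_diff theta e alpha).
have /andP[f0 f1] := IH (fun f fes => tes f (mem_behead (s := e :: es) fes)).
by rewrite big_cons mulr_ge0//= mulr_ile1.
Qed.

Lemma star_ge r vs alpha :
  {in vs, forall v, dn (theta v alpha - theta r alpha) * N%:R <= H%:R} ->
  2^-1 ^+ size vs <= edge_prod theta (star r vs) alpha.
Proof.
rewrite /edge_prod /star big_map; elim: vs => [|v vs IH] close; first by rewrite big_nil expr0.
rewrite big_cons exprS; apply: ler_pM; rewrite ?exprn_ge0//; last first.
  by apply: IH => u uvs; apply: close; rewrite inE uvs orbT.
rewrite /= /edge_diff subr0 /tent le_max; apply/orP; right.
have := close v (mem_head _ _); rewrite /=.
have Hgt0 : 0 < H%:R :> R by rewrite ltr0n.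
rewrite -ler_pdivlMr ?ltr0n// => h.
have : N%:R / (2 * H)%:R * dn (theta v alpha - theta r alpha) <= 2^-1.
  apply: (@le_trans _ _ (N%:R / (2 * H)%:R * (H%:R / N%:R))).
    by rewrite ler_wpM2l// divr_ge0.
  by rewrite natrM le_eqVlt; apply/orP; left; apply/eqP; field; rewrite !pnatr_eq0 -!lt0n N0 H0.
lra.
Qed.

Lemma continuous_edge_prod S es : {in es, forall e, tent_edge S e} ->
  continuous (edge_prod theta es).
Proof.
rewrite /edge_prod; elim: es => [|e es IH] tes x.
  by under eq_fun do rewrite big_nil; exact: cvg_cst.
under eq_fun do rewrite big_cons; move: x; apply: continuous_mul.
  apply: continuous_compose; last exact: continuous_edge_diff.
  exact: (tent_edge_continuous (tes _ (mem_head _ _))).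
by apply: IH => f fes; apply: tes; rewrite inE fes orbT.
Qed.

Definition in_range x := {in x, forall v, (0 < v <= N)%N}.

Lemma Int_chain x : size x = k -> uniq x -> in_range x -> all large x ->
  `|Int A B (edge_prod theta (chain x)) - (B - A) * (q * N)%:R ^- k.-1| <= err.
Proof.
move=> sx ux rx lx; rewrite -(chain_gridavg x); apply: equidistributed.
- by rewrite size_chain; lia.
- by move=> v /(chain_endpoints sx); exact: rx.
- exact: chain_peel_order.
- exact: chain_tent.
Qed.

Lemma edge_prod_cat es es' alpha :
  edge_prod theta (es ++ es') alpha = edge_prod theta es alpha * edge_prod theta es' alpha.
Proof. by rewrite /edge_prod big_cat. Qed.

Lemma Int_chain_disjoint x y : size x = k -> size y = k -> uniq x -> uniq y ->
  in_range x -> in_range y -> all large x -> all large y -> ~~ has (mem x) y ->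
  `|Int A B (fun t => edge_prod theta (chain x) t * edge_prod theta (chain y) t) -
     (B - A) * ((q * N)%:R ^- k.-1 * (q * N)%:R ^- k.-1)| <= err.
Proof.
move=> sx sy ux uy rx ry lx ly dis.
rewrite (eq_Int (g := edge_prod theta (chain x ++ chain y))); last first.
  by move=> t _; rewrite edge_prod_cat.
rewrite -{1}(chain_gridavg x) -(chain_gridavg y) -big_cat/=.
have ends es es' v : v \in endpoints (es ++ es') = (v \in endpoints es) || (v \in endpoints es').
  by rewrite /endpoints map_cat flatten_cat mem_cat.
apply: equidistributed.
- by rewrite size_cat !size_chain; lia.
- by move=> v; rewrite ends => /orP[/(chain_endpoints sx)|/(chain_endpoints sy)]; [exact: rx|exact: ry].
- apply: peel_order_cat; try exact: chain_peel_order.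
  move=> v /(chain_endpoints sx) vx; apply: contra dis => /(chain_endpoints sy) vy.
  by apply/hasP; exists v.
- by move=> e; rewrite mem_cat => /orP[]; exact: chain_tent.
Qed.

(** Where F does not vanish every star factor is at least 1/2, so F is at most 2^n times the star
    product, whose integral follows by peeling the leaves. *)
Lemma Int_le_star (F : R -> R) r vs (n : nat) : continuous F -> (size vs <= n)%N -> (n <= 2 * k)%N ->
  r \notin vs -> uniq vs -> all large vs -> in_range (r :: vs) ->
  (forall alpha, 0 <= F alpha <= 1) ->
  (forall alpha, F alpha != 0 ->
    {in vs, forall v, dn (theta v alpha - theta r alpha) * N%:R <= H%:R}) ->
  Int A B F <= 2 ^+ n * ((B - A) * ((2 * H)%:R / N%:R) ^+ size vs + err).
Proof.
move=> cF vn nk rvs uvs lvs rng F01 Fclose.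
have tes := @star_tent r vs.
have ces := continuous_edge_prod tes.
apply: (@le_trans _ _ (2 ^+ n * Int A B (edge_prod theta (star r vs)))); last first.
  rewrite ler_wpM2l ?exprn_ge0// -(star_gridavg r vs).
  have /ler_normlP[_] : `|Int A B (edge_prod theta (star r vs)) -
      (B - A) * \prod_(e <- star r vs) gridavg (q * N * P) e.2| <= err.
    apply: equidistributed => //.
    - by rewrite size_map; exact: leq_trans nk.
    - by move=> v /star_endpoints; exact: rng.
    - exact: star_peel_order.
  lra.
rewrite -IntZ//; apply: le_Int => //; first exact: continuous_scale.
move=> alpha _; have /andP[F0 F1] := F01 alpha.
have [F00|Fn0] := eqVneq (F alpha) 0.
  by rewrite F00 mulr_ge0 ?exprn_ge0//; have /andP[] := edge_prod_ge0 alpha tes.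
apply: (le_trans F1); rewrite mulrC -ler_pdivrMr ?exprn_gt0// mul1r.
apply: le_trans (star_ge (Fclose _ Fn0)).
by rewrite exprVn lef_pV2 ?posrE ?exprn_gt0// ler_weXn2l// ler1n.
Qed.

(** The union of the two chains may contain a cycle. The star centred at a common index [r] reaches
    the same indices and gives a factor 2 H / N for each of them other than [r]. *)
Lemma Int_chain_overlap x y : size x = k -> size y = k ->
  in_range x -> in_range y -> all large x -> all large y -> has (mem x) y ->
  Int A B (fun t => edge_prod theta (chain x) t * edge_prod theta (chain y) t) <=
    4 ^+ k * ((B - A) * ((2 * H)%:R / N%:R) ^+ (size (undup (x ++ y))).-1 + err).
Proof.
move=> sx sy rx ry lx ly /hasP[r ry' /= rx'].
pose vs := rem r (undup (x ++ y)).
have rxy : r \in undup (x ++ y) by rewrite mem_undup mem_cat rx'.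
have szvs : size vs = (size (undup (x ++ y))).-1 by rewrite size_rem.
have vsP v : v \in vs -> (v \in x) || (v \in y).
  by move=> /mem_rem; rewrite mem_undup mem_cat.
have rng : in_range (r :: vs).
  by move=> v; rewrite inE => /orP[/eqP ->|/vsP/orP[]]; [exact: rx|exact: rx|exact: ry].
rewrite -szvs -[4](_ : 2 ^+ 2 = _ :> R) -?exprM; last by rewrite expr2; lra.
apply: (@Int_le_star _ r) => //.
- by apply: continuous_mul; apply: continuous_edge_prod; exact: chain_tent.
- rewrite szvs; have := size_undup (x ++ y); rewrite size_cat sx sy; lia.
- by rewrite mem_rem_uniq ?undup_uniq// inE eqxx.
- by rewrite rem_uniq ?undup_uniq.
- by apply/allP => v /vsP/orP[]; [exact: (allP lx)|exact: (allP ly)].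
- move=> alpha; have /andP[a0 a1] := edge_prod_ge0 alpha (@chain_tent x).
  have /andP[b0 b1] := edge_prod_ge0 alpha (@chain_tent y).
  by rewrite mulr_ge0//= mulr_ile1.
- move=> alpha; rewrite mulf_eq0 negb_or => /andP[fx fy] v /vsP/orP[] vx.
    exact: chain_close fx vx rx'.
  exact: chain_close fy vx ry'.
Qed.

(** The centre is a small index of x and only the large indices become leaves, so each of these
    still gains a factor of order 1 / N. *)
Lemma Int_chain_small x : size x = k -> uniq x -> in_range x -> ~~ all large x ->
  Int A B (edge_prod theta (chain x)) <=
    2 ^+ k * ((B - A) * ((2 * H)%:R / N%:R) ^+ count large x + err).
Proof.
move=> sx ux rx; rewrite -has_predC => /hasP[r rx' /= rl].
rewrite -size_filter.
apply: (@Int_le_star _ r); rewrite ?filter_uniq//.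
- by apply: continuous_edge_prod; exact: chain_tent.
- by rewrite size_filter -sx count_size.
- by lia.
- by rewrite mem_filter (negPf rl).
- exact: filter_all.
- by move=> v; rewrite inE mem_filter => /orP[/eqP ->|/andP[_]]; exact: rx.
- by move=> alpha; exact: edge_prod_ge0 (@chain_tent x).
- by move=> alpha fx v; rewrite mem_filter => /andP[_ vx]; exact: chain_close fx vx rx'.
Qed.

End Moments.

Lemma continuous_sub (R : realType) (f g : R -> R) : continuous f -> continuous g ->
  continuous (fun x => f x - g x).
Proof. by move=> cf cg x; apply: continuousB; [exact: cf|exact: cg]. Qed.

(** * Sums over tuples weighted by their number of distinct entries *)

Section TupleSums.
Variables (R : realType) (T : finType).

Lemma sum_tupleS (k : nat) (F : seq T -> R) :
  \sum_(t : k.+1.-tuple T) F t = \sum_v \sum_(t : k.-tuple T) F (v :: t).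
Proof.
rewrite pair_bigA (reindex (fun p : T * k.-tuple T => [tuple of p.1 :: p.2])) //=.
exists (fun t : k.+1.-tuple T => (thead t, [tuple of behead t])).
  by move=> [v t] _; rewrite /= theadE; congr pair; exact: val_inj.
by move=> t _; rewrite -tuple_eta.
Qed.

Lemma sum_prod_tuple (k : nat) (w : T -> R) :
  \sum_(t : k.-tuple T) \prod_(v <- t) w v = (\sum_v w v) ^+ k.
Proof.
elim: k => [|k IH].
  rewrite (eq_bigr (fun=> 1)) => [|t _]; last by rewrite tuple0 big_nil.
  by rewrite sumr_const card_tuple expn0 expr0.
rewrite (sum_tupleS _ (fun t => \prod_(v <- t) w v)) exprS -IH big_distrl/=.
by apply: eq_bigr => v _; rewrite big_distrr/=; apply: eq_bigr => t _; rewrite big_cons.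
Qed.

(** Prepending an entry costs a constant: it repeats one of at most [size z] values, or is one of at
    most 2 N new ones, each weighted by a further 1 / N. *)
Lemma sum_inv_size_undup (N k : nat) (s : seq T) : (0 < N)%N -> (#|T| <= 2 * N)%N ->
  \sum_(t : k.-tuple T) N%:R ^- size (undup (t ++ s)) <=
    N%:R ^- size (undup s) * (size s + k + 2)%:R ^+ k :> R.
Proof.
move=> N0 TN; have Nn0 : N%:R != 0 :> R by rewrite pnatr_eq0 -lt0n.
have Ngt0 : 0 < N%:R :> R by rewrite ltr0n.
have step (z : seq T) : \sum_v N%:R ^- size (undup (v :: z)) <=
    N%:R ^- size (undup z) * (size z + 2)%:R :> R.
  rewrite (bigID (mem z))/= natrD mulrDr; apply: lerD.
    rewrite (eq_bigr (fun=> N%:R ^- size (undup z))) => [|v /= vz]; last by rewrite vz.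
    rewrite sumr_const -(mulr_natr (_ ^- _)) ler_wpM2l ?invr_ge0 ?exprn_ge0// ler_nat.
    exact: card_size.
  rewrite (eq_bigr (fun=> N%:R ^- size (undup z) / N%:R)) => [|v /= vz]; last first.
    by rewrite (negPf vz)/= exprS invfM mulrC.
  rewrite sumr_const -(mulr_natr (_ / _)) -mulrA ler_wpM2l ?invr_ge0 ?exprn_ge0//.
  rewrite mulrC ler_pdivrMr// -natrM ler_nat; apply: leq_trans TN; exact: max_card.
elim: k => [|k IH].
  rewrite (eq_bigr (fun=> N%:R ^- size (undup s))) => [|t _]; last by rewrite tuple0.
  by rewrite sumr_const card_tuple expn0 expr0 mulr1n mulr1.
rewrite (sum_tupleS _ (fun t => N%:R ^- size (undup (t ++ s)))) exchange_big/=.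
apply: (@le_trans _ _ (\sum_(t : k.-tuple T) N%:R ^- size (undup (t ++ s)) *
   (size s + k + 2)%:R)).
  apply: ler_sum => t _; apply: le_trans (step (t ++ s)) _.
  by rewrite size_cat size_tuple (addnC k).
rewrite -mulr_suml; apply: (@le_trans _ _ (N%:R ^- size (undup s) *
  (size s + k + 2)%:R ^+ k * (size s + k + 2)%:R)); first by rewrite ler_wpM2r.
rewrite -mulrA -exprSr ler_wpM2l ?invr_ge0 ?exprn_ge0//.
by rewrite lerXn2r ?nnegrE// ler_nat leq_add2r leq_add2l.
Qed.

End TupleSums.

Section Variance.
Variables (R : realType) (theta : nat -> R -> R) (A B : R) (k q N P H : nat).
Variables (large : pred nat) (c : nat -> int) (err : R).
Hypotheses (ctheta : forall n, continuous (theta n)) (AB : A <= B) (k0 : (0 < k)%N) (q0 : (0 < q)%N).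
Hypotheses (N0 : (0 < N)%N) (P0 : (0 < P)%N) (H0 : (0 < H)%N) (qN2 : (2 <= q * N)%N) (HN : (4 * H <= N)%N).
Hypothesis cH : forall i, (k * (`|c i| + 1) <= H)%N.
Hypothesis equidistributed : forall es : seq (edge R), (size es <= 2 * k)%N ->
  {in endpoints es, forall v, (0 < v <= N)%N} -> peel_order large es ->
  {in es, forall e, tent_edge (q * N)%:R e} ->
  `|Int A B (edge_prod theta es) - (B - A) * \prod_(e <- es) gridavg (q * N * P) e.2| <= err.
Hypothesis errN : err * N%:R ^+ (2 * k) <= 1.

Implicit Types (x y : k.-tuple 'I_N.+1).

Definition indices x : seq nat := [seq val v | v <- x].

Definition tuple_weight x : R -> R := edge_prod theta (chain R k q N c (indices x)).

Definition large_tuple x := (x \in distinct_tuples k N) && all large (indices x).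

Definition small_tuple x := (x \in distinct_tuples k N) && ~~ all large (indices x).

Let size_indices x : size (indices x) = k. Proof. by rewrite size_map size_tuple. Qed.

Let uniq_indices x : x \in distinct_tuples k N -> uniq (indices x).
Proof. by rewrite inE => /andP[ux _]; rewrite map_inj_uniq//; exact: val_inj. Qed.

Let range_indices x : x \in distinct_tuples k N -> in_range N (indices x).
Proof.
by rewrite inE => /andP[_ /allP px] v /mapP[u ux ->]; rewrite (px _ ux) /= -ltnS ltn_ord.
Qed.

Let cweight x : continuous (tuple_weight x).
Proof. by apply: continuous_edge_prod => //; exact: chain_tent. Qed.

Let err0 : 0 <= err.
Proof.
have := equidistributed (es := [::]); rewrite big_nil => /(_ isT) H1.
by apply: le_trans (H1 _ _ _).
Qed.

Let Ngt0 : 0 < N%:R :> R. Proof. by rewrite ltr0n. Qed.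

Let card_ordN : (#|'I_N.+1| <= 2 * N)%N. Proof. by rewrite card_ord mul2n -addnn -addn1 leq_add2l. Qed.

Definition large_count (alpha : R) : R := N%:R^-1 * \sum_(x | large_tuple x) tuple_weight x alpha.

Definition small_count (alpha : R) : R := N%:R^-1 * \sum_(x | small_tuple x) tuple_weight x alpha.

Definition large_mean : R :=
  N%:R^-1 * \sum_(x : k.-tuple 'I_N.+1 | large_tuple x) (q * N)%:R ^- k.-1.

Lemma continuous_large_count : continuous large_count.
Proof. by apply: continuous_scale; apply: continuous_sum. Qed.

Lemma continuous_small_count : continuous small_count.
Proof. by apply: continuous_scale; apply: continuous_sum. Qed.

Lemma small_count_ge0 alpha : 0 <= small_count alpha.
Proof.
rewrite mulr_ge0 ?invr_ge0// sumr_ge0// => x _.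
by have /andP[] := edge_prod_ge0 theta alpha (@chain_tent R k q N c (indices x)).
Qed.

(** When the square is expanded, disjoint pairs cancel up to a multiple of [err]. An overlapping
    pair with s distinct indices contributes O(N^(1 - s)) besides, and N^-s has a bounded sum over
    all pairs: the total is O(N), against the N^-2 in front. *)
Lemma Int_large_variance : Int A B (fun alpha => (large_count alpha - large_mean) ^+ 2) <=
  (4 ^+ k * (B - A) * ((2 * H)%:R ^+ (2 * k) * (2 * k + 2)%:R ^+ (2 * k)) +
   (4 ^+ k + 3) * 4 ^+ k) / N%:R.
Proof.
set rho : R := (q * N)%:R ^- k.-1.
have rho0 : 0 <= rho by rewrite invr_ge0 exprn_ge0.
have rho1 : rho <= 1.
  by rewrite invf_le1 ?exprn_gt0 ?exprn_ege1 ?ltr0n ?ler1n//; exact: leq_trans qN2.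
have BA : 0 <= B - A by rewrite subr_ge0.
pose h x alpha := tuple_weight x alpha - rho.
have ch x : continuous (h x).
  by apply: continuous_add => // alpha; exact: cst_continuous.
have E alpha : (large_count alpha - large_mean) ^+ 2 =
    N%:R ^- 2 * \sum_(x | large_tuple x) \sum_(y | large_tuple y) h x alpha * h y alpha.
  rewrite /large_count /large_mean -mulrBr -sumrB exprMn exprVn [(\sum_(_ | _) _) ^+ 2]expr2 big_distrlr/=.
  by congr (_ * _).
rewrite (eq_Int (fun alpha _ => E alpha)).
have chh x y : continuous (fun alpha => h x alpha * h y alpha) by exact: continuous_mul.
have chh2 x : continuous (fun alpha => \sum_(y | large_tuple y) h x alpha * h y alpha).
  exact: continuous_sum.
rewrite IntZ; last exact: continuous_sum.
rewrite Int_sum//.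
have bound x y : large_tuple x -> large_tuple y ->
    Int A B (fun alpha => h x alpha * h y alpha) <=
    4 ^+ k * (B - A) * ((2 * H)%:R ^+ (2 * k) * N%:R) * N%:R ^- size (undup (x ++ y)) +
    (4 ^+ k + 3) * err.
  move=> /andP[xB xl] /andP[yB yl].
  have Ix := Int_chain c AB k0 q0 N0 P0 H0 qN2 HN equidistributed (size_indices x)
    (uniq_indices xB) (range_indices xB) xl.
  have Iy := Int_chain c AB k0 q0 N0 P0 H0 qN2 HN equidistributed (size_indices y)
    (uniq_indices yB) (range_indices yB) yl.
  rewrite -/(tuple_weight x) -/rho in Ix; rewrite -/(tuple_weight y) -/rho in Iy.
  have cxy : continuous (fun alpha => tuple_weight x alpha * tuple_weight y alpha).
    exact: continuous_mul.
  rewrite (eq_Int (g := fun alpha => (tuple_weight x alpha * tuple_weight y alpha -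
    rho * tuple_weight x alpha) - (rho * tuple_weight y alpha - rho ^+ 2))); last first.
    by move=> alpha _; rewrite /h; ring.
  have c1 : continuous (fun alpha => rho * tuple_weight x alpha) by exact: continuous_scale.
  have c2 : continuous (fun alpha => rho * tuple_weight y alpha) by exact: continuous_scale.
  have c3 : continuous (fun alpha : R => rho ^+ 2) by move=> alpha; exact: cst_continuous.
  have c12 := continuous_sub cxy c1; have c23 := continuous_sub c2 c3.
  rewrite IntB//.
  rewrite IntB// IntB// (IntZ _ _ _ (@cweight x)) (IntZ _ _ _ (@cweight y)) Int_cst//.
  have lin (I r : R) : `|I - (B - A) * r| <= err -> (B - A) * r - err <= I <= (B - A) * r + err.
    by rewrite ler_norml => /andP[? ?]; apply/andP; split; lra.
  move: Ix Iy => /lin/andP[Ix _] /lin/andP[Iy _].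
  have Rx : (B - A) * rho ^+ 2 - err <= rho * Int A B (tuple_weight x).
    have : rho * ((B - A) * rho - err) <= rho * Int A B (tuple_weight x) by rewrite ler_wpM2l.
    have : rho * err <= 1 * err by rewrite ler_wpM2r.
    by rewrite expr2; lra.
  have Ry : (B - A) * rho ^+ 2 - err <= rho * Int A B (tuple_weight y).
    have : rho * ((B - A) * rho - err) <= rho * Int A B (tuple_weight y) by rewrite ler_wpM2l.
    have : rho * err <= 1 * err by rewrite ler_wpM2r.
    by rewrite expr2; lra.
  set I2 := Int _ _ _.
  set M := 4 ^+ k * (B - A) * _ * _.
  have M0 : 0 <= M by rewrite !mulr_ge0 ?invr_ge0 ?exprn_ge0.
  have e4 : 0 <= 4 ^+ k * err by rewrite mulr_ge0 ?exprn_ge0.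
  have rr : 0 <= rho ^+ 2 * (B - A) by rewrite mulr_ge0 ?exprn_ge0.
  suff : I2 <= M + (4 ^+ k + 1) * err + (B - A) * rho ^+ 2 by lra.
  case: (boolP (has (mem (indices x)) (indices y))) => ov.
    have O := Int_chain_overlap ctheta AB k0 q0 N0 P0 H0 qN2 HN cH equidistributed
      (size_indices x) (size_indices y) (range_indices xB) (range_indices yB) xl yl ov.
    have {O} : I2 <= M + 4 ^+ k * err; last by have := err0; lra.
    apply: (le_trans O); rewrite mulrDr lerD2r /M -!mulrA ler_wpM2l ?exprn_ge0// ler_wpM2l//.
    rewrite /indices -map_cat undup_map_inj; last exact: val_inj.
    rewrite size_map; set s := size _.
    have s1 : (0 < s)%N.
      rewrite lt0n size_eq0; case/hasP: ov => v; rewrite /indices => /mapP[u uy _] _.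
      apply/eqP => E0; have : u \in undup (x ++ y) by rewrite mem_undup mem_cat uy orbT.
      by rewrite E0.
    have sk : (s <= 2 * k)%N.
      by rewrite (leq_trans (size_undup _))// size_cat !size_tuple mul2n addnn.
    rewrite expr_div_n -[in leRHS](prednK s1) exprS invfM mulVKf ?gt_eqF//.
    rewrite ler_pM2r ?invr_gt0 ?exprn_gt0// ler_weXn2l//.
      by rewrite ler1n muln_gt0 H0.
    exact: leq_trans (leq_pred _) sk.
  have D := Int_chain_disjoint c AB k0 q0 N0 P0 H0 qN2 HN equidistributed
      (size_indices x) (size_indices y) (uniq_indices xB) (uniq_indices yB)
      (range_indices xB) (range_indices yB) xl yl ov.
  move/lin: D => /andP[_]; rewrite -/rho -/I2 -expr2; lra.
have K2 : 0 <= 4 ^+ k * (B - A) * ((2 * H)%:R ^+ (2 * k) * N%:R).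
  by rewrite !mulr_ge0 ?exprn_ge0.
set S := \sum_(_ | _) _.
have -> : N%:R ^- 2 * S = S / N%:R / N%:R by field; rewrite gt_eqF.
rewrite ler_pM2r ?invr_gt0// ler_pdivrMr// /S {S}.
apply: (@le_trans _ _ (\sum_(x : k.-tuple 'I_N.+1) \sum_(y : k.-tuple 'I_N.+1)
   (4 ^+ k * (B - A) * ((2 * H)%:R ^+ (2 * k) * N%:R) * N%:R ^- size (undup (x ++ y)) +
    (4 ^+ k + 3) * err))).
  have t0 x y : 0 <= 4 ^+ k * (B - A) * ((2 * H)%:R ^+ (2 * k) * N%:R) *
      N%:R ^- size (undup (x ++ y)) + (4 ^+ k + 3) * err.
    apply: addr_ge0; first by rewrite mulr_ge0// invr_ge0 exprn_ge0.
    by rewrite mulr_ge0// addr_ge0// exprn_ge0.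
  rewrite [leRHS](bigID large_tuple)/= -[leLHS]addr0; apply: lerD; last first.
    by apply: sumr_ge0 => x _; apply: sumr_ge0.
  apply: ler_sum => x xl; rewrite Int_sum//.
  rewrite [leRHS](bigID large_tuple)/= -[leLHS]addr0; apply: lerD; last exact: sumr_ge0.
  by apply: ler_sum => y yl; exact: bound.
under eq_bigr do rewrite big_split/= -mulr_sumr.
rewrite big_split/= -mulr_sumr [leRHS]mulrDl; apply: lerD.
  rewrite [leRHS](_ : _ = 4 ^+ k * (B - A) * ((2 * H)%:R ^+ (2 * k) * N%:R) *
    (2 * k + 2)%:R ^+ (2 * k)); last by ring.
  rewrite ler_wpM2l// exchange_big/=.
  apply: (@le_trans _ _ (\sum_(y : k.-tuple 'I_N.+1) N%:R ^- size (undup y) * (2 * k + 2)%:R ^+ k)).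
    apply: ler_sum => y _; apply: le_trans (sum_inv_size_undup _ _ _ N0 card_ordN) _.
    by rewrite size_tuple addnn -mul2n.
  rewrite -mulr_suml [X in _ <= _ ^+ X]mul2n -addnn exprD ler_wpM2r ?exprn_ge0//.
  under eq_bigr do rewrite -[X in undup X]cats0.
  apply: le_trans (sum_inv_size_undup _ _ _ N0 card_ordN) _.
  rewrite /= expr0 invr1 mul1r add0n lerXn2r ?nnegrE// ler_nat leq_add2r.
  by rewrite leq_pmull.
rewrite !sumr_const card_tuple card_ord -!mulrnA -(mulr_natr (_ * err)) -expnD addnn -mul2n -!mulrA.
rewrite ler_wpM2l ?addr_ge0 ?exprn_ge0//.
apply: (@le_trans _ _ (err * (2 * N%:R) ^+ (2 * k))).
  rewrite ler_wpM2l// natrX lerXn2r ?nnegrE ?mulr_ge0// -natrM ler_nat.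
  by rewrite -(card_ord N.+1).
rewrite exprMn mulrCA exprM (_ : 2 ^+ 2 = 4 :> R); last by rewrite expr2; lra.
by rewrite ler_wpM2l ?exprn_ge0// (le_trans errN)// ler1n.
Qed.

(** The bound for one tuple factorizes over its entries, with 1 / N for a large index and 1 for a
    small one; the sum over tuples is then a k-th power, of at most the number of small indices plus
    2. *)
Lemma Int_small_count : Int A B small_count <=
  2 ^+ k * ((B - A) * (2 * H)%:R ^+ k * (#|[pred v : 'I_N.+1 | ~~ large v]|%:R + 2) ^+ k + 2 ^+ k) / N%:R.
Proof.
have BA : 0 <= B - A by rewrite subr_ge0.
rewrite IntZ; last exact: continuous_sum.
rewrite Int_sum// mulrC ler_pM2r ?invr_gt0//.
pose w (v : 'I_N.+1) : R := if large v then N%:R^-1 else 1.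
have w0 v : 0 <= w v by rewrite /w; case: ifP => _ //; rewrite invr_ge0.
have bound x : small_tuple x -> Int A B (tuple_weight x) <=
    2 ^+ k * ((B - A) * (2 * H)%:R ^+ k * \prod_(v <- x) w v + err).
  move=> /andP[xB xl].
  apply: le_trans (Int_chain_small ctheta AB k0 q0 N0 P0 H0 qN2 HN cH equidistributed
    (size_indices x) (uniq_indices xB) (range_indices xB) xl) _.
  rewrite ler_wpM2l ?exprn_ge0// lerD2r -mulrA ler_wpM2l// expr_div_n.
  have -> : \prod_(v <- x) w v = N%:R ^- count large (indices x).
    rewrite /indices count_map; elim: (tval x) => [|v s IH]; first by rewrite big_nil expr0 invr1.
    rewrite big_cons IH /w /=; case: ifP => _; last by rewrite mul1r.
    by rewrite add1n exprS invfM.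
  rewrite ler_wpM2r ?invr_ge0 ?exprn_ge0// ler_weXn2l//.
    by rewrite ler1n muln_gt0 H0.
  by rewrite (leq_trans (count_size _ _))// size_indices.
apply: (@le_trans _ _ (\sum_(x : k.-tuple 'I_N.+1)
    2 ^+ k * ((B - A) * (2 * H)%:R ^+ k * \prod_(v <- x) w v + err))).
  rewrite [leRHS](bigID small_tuple)/= -[leLHS]addr0; apply: lerD; first exact: ler_sum.
  apply: sumr_ge0 => x _; rewrite mulr_ge0 ?exprn_ge0// addr_ge0//.
  by rewrite !mulr_ge0 ?exprn_ge0// prodr_ge0.
rewrite -mulr_sumr ler_wpM2l ?exprn_ge0// big_split/= -mulr_sumr sum_prod_tuple.
apply: lerD.
  rewrite ler_wpM2l ?mulr_ge0 ?exprn_ge0// lerXn2r ?nnegrE ?sumr_ge0 ?addr_ge0//.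
  rewrite (bigID (fun v : 'I_N.+1 => ~~ large v))/=; apply: lerD.
    rewrite (eq_bigr (fun=> 1)) => [|v vl]; last by rewrite /w (negPf vl).
    by rewrite sumr_const.
  rewrite (eq_bigr (fun=> N%:R^-1)) => [|v]; last by rewrite negbK /w => ->.
  rewrite sumr_const -(mulr_natr N%:R^-1) mulrC ler_pdivrMr// -natrM ler_nat.
  exact: leq_trans (max_card _) card_ordN.
rewrite sumr_const card_tuple card_ord -(mulr_natr err).
apply: (@le_trans _ _ (err * (2 * N%:R) ^+ k)).
  rewrite ler_wpM2l// natrX lerXn2r ?nnegrE ?mulr_ge0// -natrM ler_nat.
  by rewrite -(card_ord N.+1).
rewrite exprMn mulrCA -[leRHS]mulr1 ler_wpM2l ?exprn_ge0//.
apply: le_trans errN; rewrite ler_wpM2l// ler_weXn2l ?ler1n// leq_pmull//.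
Qed.

End Variance.

(** * Almost sure convergence from summable means *)

Section AlmostEverywhere.
Variable R : realType.

Lemma sum_inv_sqr_le2 (K : nat) : \sum_(0 <= n < K) (n.+1%:R ^- 2 : R) <= 2.
Proof.
case: K => [|K]; first by rewrite big_geq.
apply: (@le_trans _ _ (2 - K.+1%:R^-1)); last by rewrite gerBl invr_ge0.
elim: K => [|K IH].
  by rewrite big_nat1 expr1n invr1; lra.
rewrite big_nat_recr//=.
have K1 : 0 < K.+1%:R :> R by rewrite ltr0n.
have K2 : 0 < K.+2%:R :> R by rewrite ltr0n.
have : (K.+2%:R ^- 2 : R) <= K.+1%:R^-1 - K.+2%:R^-1; last first.
  by move=> h; apply: (le_trans (lerD IH h)); rewrite addrA subrK.
have -> : (K.+1%:R^-1 - K.+2%:R^-1 : R) = (K.+1%:R * K.+2%:R)^-1.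
  have : K.+2%:R = K.+1%:R + 1 :> R by rewrite natr1.
  move: K1 K2; move: (K.+1%:R) (K.+2%:R) => a b a0 b0 bE.
  by rewrite bE in b0 *; field; apply/andP; split; apply: lt0r_neq0.
by rewrite expr2 lef_pV2 ?posrE ?mulr_gt0// ler_pM2r// ler_nat.
Qed.

(** The series of the [Y m], from some index on, has a finite integral; it is thus finite almost
    everywhere on the interval, and its terms tend to 0. *)
Lemma ae_cvg0_of_Int (A B C : R) (Y : nat -> R -> R) : A <= B ->
  (forall m, continuous (Y m)) -> (forall m x, 0 <= Y m x) ->
  (\forall m \near \oo, Int A B (Y m) <= C * m%:R ^- 2) ->
  {ae (@lebesgue_measure R), forall alpha, A <= alpha -> alpha <= B ->
     Y m alpha @[m --> \oo] --> (0 : R)}.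
Proof.
move=> AB cY Y0 [M _ HM].
pose f n (x : R) := (Y (n + M.+1)%N x)%:E.
have mitv : measurable (`[A, B]%classic : set (measurableTypeR R)) by [].
have mf n := measurable_int _ (continuous_integrable A B (cY (n + M.+1)%N)).
have f0 n x : (0 <= f n x)%E by rewrite lee_fin.
have If n : (\int[lebesgue_measure]_(x in `[A, B]) f n x = (Int A B (Y (n + M.+1)%N))%:E)%E.
  rewrite /Int /Rintegral fineK//; apply: integrable_fin_num => //.
  exact: continuous_integrable.
pose F x := (\sum_(n <oo) f n x)%E.
have F0 x : (0 <= F x)%E by apply: nneseries_ge0 => n _ _.
have IF : (\int[lebesgue_measure]_(x in `[A, B]) F x <= (`|C| * 2)%:E)%E.
  rewrite integral_nneseries//.
  apply: lime_le.
    by apply: is_cvg_nneseries => n _ _; rewrite If lee_fin Int_ge0.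
  apply: nearW => K; under eq_bigr do rewrite If.
  rewrite sumEFin lee_fin; apply: (@le_trans _ _ (`|C| * \sum_(0 <= n < K) (n.+1%:R ^- 2 : R))).
    rewrite mulr_sumr; apply: ler_sum => n _.
    apply: le_trans (HM (n + M.+1)%N _) _ => /=; first by rewrite addnS ltnW// ltnS leq_addl.
    apply: (@le_trans _ _ (`|C| * (n + M.+1)%:R ^- 2)).
      by rewrite ler_wpM2r ?invr_ge0 ?exprn_ge0// ler_norm.
    rewrite ler_wpM2l// lef_pV2 ?posrE ?exprn_gt0 ?ltr0n ?addnS//.
    by rewrite lerXn2r ?nnegrE// ler_nat ltnS leq_addr.
  by rewrite ler_wpM2l// sum_inv_sqr_le2.
have iF : (@lebesgue_measure R).-integrable `[A, B] F.
  apply/integrableP; split.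
    by apply: (ge0_emeasurable_sum (P := xpredT)) => [n x _ _|n _]; [exact: f0|exact: mf].
  under eq_integral do rewrite gee0_abs//.
  by apply: le_lt_trans IF _; rewrite ltry.
have := integrable_ae mitv iF; apply: filterS => alpha Halpha Aa aB.
have /Halpha fin : `[A, B]%classic alpha by rewrite /= in_itv/= Aa.
pose u n := Y (n + M.+1)%N alpha.
have cu : cvgn (series u).
  apply: nondecreasing_is_cvgn.
    by apply: nondecreasing_series => n _ _; exact: Y0.
  exists (fine (F alpha)) => _ [n _ <-].
  rewrite -lee_fin fineK// /series/= -sumEFin.
  exact: (nneseries_lim_ge (u_ := fun i => f i alpha)).
by rewrite -(cvg_shiftn M.+1); exact: cvg_series_cvg_0 cu.
Qed.

End AlmostEverywhere.

(** * Correlations of tent test functions *)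

Section TentCorrelation.
Variable R : realType.

Definition hat (y : R) : R := Num.max 0 (1 - `|y|).

(* The centre is a list, padded with [0], so that a countable family serves for
   all dimensions. *)
Definition tent_test (n q : nat) (s : seq int) (z : 'rV[R]_n) : R :=
  \prod_(i < n) hat (q%:R * z ord0 i - (s`_i)%:~R).

Lemma hat_ge0 y : 0 <= hat y. Proof. by rewrite le_max lexx. Qed.

Lemma tent_test_ge0 n q s (z : 'rV[R]_n) : 0 <= tent_test q s z.
Proof. by apply: prodr_ge0 => i _; exact: hat_ge0. Qed.

(** A lattice point differing from the vector [r] of nearest integers is at distance at least 1/2 in
    some coordinate, and there its factor vanishes because q N >= 2. Only [r] contributes. *)
Lemma sum_tent_test (n q N : nat) (s : seq int) (g : 'rV[R]_n) : (0 < N)%N -> (2 <= q * N)%N ->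
  \sum_(m \in [set: 'rV[int]_n]) tent_test q s (N%:R *: (g - map_mx intr m)) =
  \prod_(i < n) tent (q * N)%:R (g ord0 i - (s`_i)%:~R / (q * N)%:R).
Proof.
move=> N0 qN2; set S := (q * N)%:R.
have S2 : 2 <= S by rewrite ler_nat.
have S0 : 0 < S by lra.
pose t i := g ord0 i - (s`_i)%:~R / S.
pose r : 'rV[int]_n := \row_i Num.floor (t i + 2^-1).
have arg (m : 'rV[int]_n) i : q%:R * (N%:R *: (g - map_mx intr m)) ord0 i - (s`_i)%:~R =
    S * (t i - (m ord0 i)%:~R).
  have q0 : q%:R != 0 :> R by rewrite pnatr_eq0; case: (q) qN2.
  have Nn0 : N%:R != 0 :> R by rewrite pnatr_eq0 -lt0n.
  by rewrite !mxE /t /S natrM; field; rewrite q0 Nn0.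
rewrite -(fsbig_widen [set r]) => [|//|m [_ /= mr]].
  rewrite fsbig_set1; apply: eq_bigr => i _.
  by rewrite arg /hat /tent normrM (gtr0_norm S0) /dn mxE.
have [i mi] : exists i, m ord0 i != r ord0 i.
  apply/existsP; apply: contra_notT mr; rewrite negb_exists => /forallP mr.
  by apply/rowP => i; apply/eqP; have := mr i; rewrite negbK.
rewrite /= /tent_test (bigD1 i)//= arg; apply/eqP; rewrite mulf_eq0; apply/orP; left.
rewrite /hat; apply/eqP/max_idPl; rewrite subr_le0 normrM (gtr0_norm S0).
have h1 := dn_le_half (t i).
have h2 : 1 <= `|(m ord0 i)%:~R - (r ord0 i)%:~R : R|.
  by rewrite -intrB -intr_norm ler1z -gtz0_ge1 normr_gt0 subr_eq0.
have h3 : `|(m ord0 i)%:~R - (r ord0 i)%:~R : R| <= `|t i - (r ord0 i)%:~R| + `|t i - (m ord0 i)%:~R|.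
  rewrite (_ : _ - _ = (t i - (r ord0 i)%:~R) - (t i - (m ord0 i)%:~R)); last by ring.
  exact: ler_normB.
have h4 : `|t i - (r ord0 i)%:~R| = dn (t i) by rewrite /dn mxE.
have : 2 * 2^-1 <= S * `|t i - (m ord0 i)%:~R| by apply: ler_pM => //; lra.
by rewrite mulfV.
Qed.

Lemma correlation_tent (k q N : nat) (s : seq int) (theta : nat -> R -> R) (alpha : R)
    (large : pred nat) : (0 < k)%N -> (0 < N)%N -> (2 <= q * N)%N ->
  correlation (@tent_test k.-1 q s) (fun n => theta n alpha) N =
  large_count theta k q N large (nth 0 s) alpha + small_count theta k q N large (nth 0 s) alpha.
Proof.
move=> k0 N0 qN2; rewrite /correlation /large_count /small_count -mulrDr; congr (_ * _).
rewrite (bigID (fun x : k.-tuple 'I_N.+1 => all large (indices x)))/=.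
have E (x : k.-tuple 'I_N.+1) : \sum_(m \in [set: 'rV[int]_k.-1])
      tent_test q s (N%:R *: (gaps x (fun n => theta n alpha) - map_mx intr m)) =
    tuple_weight theta q (nth 0 s) x alpha.
  rewrite sum_tent_test// /tuple_weight /edge_prod /chain big_map -[k.-1 in RHS]subn0.
  rewrite -/(index_iota 0 k.-1) big_mkord; apply: eq_bigr => i _.
  have ik : (i.+1 < k)%N by have := ltn_ord i; clear -k0; lia.
  rewrite /chain_edge/= /edge_diff/= mxE; congr (tent _ (_ - _ - _)).
    by rewrite (nth_map ord0)// size_tuple ltnW.
  by rewrite (nth_map ord0)// size_tuple.
by congr (_ + _); apply: eq_bigr => x _; rewrite E.
Qed.

End TentCorrelation.

(** * Numbers of small and of large indices *)

Lemma ffact_bounds (n k : nat) : ((n - k) ^ k <= n ^_ k <= n ^ k)%N.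
Proof.
elim: k n => [|k IH] n; first by rewrite ffactn0 !expn0.
rewrite ffactnS !expnS; have /andP[l u] := IH n.-1.
apply/andP; split; apply: leq_mul; rewrite ?leq_subr//.
  by apply: leq_trans l; rewrite subnS -subn1 subnAC subn1.
by apply: (leq_trans u); case: k {IH l u} => // k; rewrite leq_exp2r// leq_pred.
Qed.

Section SmallIndices.
Variables (k m N : nat).
Hypotheses (k0 : (0 < k)%N) (m0 : (0 < m)%N).

(** The small indices are among 0, ..., r, where r is the integer part of m^(1/k), so there are at
    most r + 1; the constant 4 comes from r + 3 <= 4 r. *)
Lemma card_small_index : ((#|[pred v : 'I_N.+1 | ~~ (m < v ^ k)]| + 2) ^ k <= 4 ^ k * m)%N /\
   (#|[pred v : 'I_N.+1 | ~~ (m < v ^ k)] | <= m.+1)%N.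
Proof.
have ex : exists v, (v ^ k <= m)%N by exists 1%N; rewrite exp1n.
have vk v : (v <= v ^ k)%N by case: v => // v; rewrite -{1}(expn1 v.+1) leq_pexp2l.
have bd v : (v ^ k <= m)%N -> (v <= m)%N by apply: leq_trans.
have [r rk rmax] := ex_maxnP ex bd.
have r1 : (0 < r)%N by apply: rmax; rewrite exp1n.
have card : (#|[pred v : 'I_N.+1 | ~~ (m < v ^ k)%N]| <= r.+1)%N.
  rewrite -[r.+1]card_ord.
  apply: leq_trans (_ : #|[pred v : 'I_N.+1 | v < r.+1]%N| <= _)%N.
    by apply/subset_leq_card/fintype.subsetP => v; rewrite !inE -leqNgt => /rmax.
  pose f (v : 'I_N.+1) : 'I_r.+1 := inord v.
  rewrite -(card_in_image (f := f)); first exact: max_card.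
  move=> u v; rewrite !inE => ur vr /(congr1 val); rewrite /f /= !inordK// => uv.
  exact: val_inj.
have rm : (r <= m)%N by exact: bd.
split; last by apply: leq_trans card _.
apply: leq_trans (leq_mul (leqnn (4 ^ k)) rk); rewrite -expnMn leq_exp2r//.
by clear -card r1; lia.
Qed.
End SmallIndices.

Section LargeMean.
Variable R : realType.

Lemma bernoulli_ineq (x : R) (k : nat) : 0 <= x -> x <= 1 -> 1 - k%:R * x <= (1 - x) ^+ k.
Proof.
move=> x0 x1; elim: k => [|k IH]; first by rewrite mul0r subr0 expr0.
rewrite exprS -natr1; apply: (@le_trans _ _ ((1 - x) * (1 - k%:R * x))); last first.
  by rewrite ler_wpM2l// subr_ge0.
have : 0 <= k%:R * x * x by rewrite !mulr_ge0.
by set kx := k%:R * x; rewrite mulrDl mul1r -/kx => h; lra.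
Qed.

Lemma card_large_tuple (k m N : nat) : (0 < k)%N ->
  #|[pred x : k.-tuple 'I_N.+1 | large_tuple (fun v => m < v ^ k)%N x]| =
  (#|[pred v : 'I_N.+1 | (m < v ^ k)%N]| ^_ k)%N.
Proof.
move=> k0; rewrite -card_uniq_tuples; apply: eq_card => x.
rewrite !inE /large_tuple /distinct_tuples !inE /indices all_map.
rewrite andbC; have [lx|//] := boolP (all _ x).
rewrite !andTb -[RHS]andbT; congr (_ && _).
apply/allP => v vx; have := allP lx _ vx; rewrite /= lt0n; apply: contraTneq => ->.
by rewrite exp0n.
Qed.

(** If c indices are large, c ^_ k tuples are counted. As N - m <= c <= N with N = m ^ 4, the
    quotient of c ^_ k by N^k tends to 1, by Bernoulli's inequality. *)
Lemma large_mean_cvg (k q : nat) : (0 < k)%N -> (0 < q)%N ->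
  large_mean R k q (m ^ 4)%N (fun v => m < v ^ k)%N @[m --> \oo] --> (q%:R ^- k.-1 : R).
Proof.
move=> k0 q0; have qgt0 : 0 < q%:R :> R by rewrite ltr0n.
apply/cvgrPdist_le => /= e e0; near=> m.
have m0 : (0 < m)%N by near: m; exact: nbhs_infty_gt.
have mbig : (k * (k.+1 + 1))%:R / e <= m%:R by near: m; exact: nbhs_infty_ger.
have mgt0 : 0 < m%:R :> R by rewrite ltr0n.
set N := (m ^ 4)%N; have N0 : (0 < N)%N by rewrite expn_gt0 m0.
have Ngt0 : 0 < N%:R :> R by rewrite ltr0n.
rewrite /large_mean sumr_const card_large_tuple//.
set c := #|_|.
have cN : (c <= N)%N.
  have : (c < #|'I_N.+1|)%N.
    apply: proper_card; apply/fintype.properP; split; first exact: subset_predT.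
    by exists ord0; rewrite // inE /= exp0n.
  by rewrite card_ord ltnS.
have cNm : (N - m <= c)%N.
  have [_ sm] := card_small_index N k0 m0.
  have := cardC [pred v : 'I_N.+1 | (m < v ^ k)%N]; rewrite -/c card_ord => cE.
  rewrite leq_subLR -ltnS -cE addnC -addSn leq_add2r.
  apply: leq_trans sm; by apply/eq_leq/eq_card => v; rewrite !inE.
have /andP[fl fu] := ffact_bounds c k.
have E : N%:R^-1 * ((q * N)%:R ^- k.-1 *+ (c ^_ k)) = q%:R ^- k.-1 * ((c ^_ k)%:R / N%:R ^+ k) :> R.
  have -> : N%:R ^+ k = N%:R * N%:R ^+ k.-1 :> R by rewrite -exprS prednK.
  rewrite -(mulr_natr (_ ^- _)) natrM exprMn; field.
  by rewrite !expf_neq0 ?gt_eqF.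
rewrite E -[X in X - _]mulr1 -mulrBr normrM.
have q1 : `|q%:R ^- k.-1 : R| <= 1.
  by rewrite ger0_norm ?invr_ge0 ?exprn_ge0// invf_le1 ?exprn_gt0// exprn_ege1// ler1n.
apply: (@le_trans _ _ (1 * `|1 - (c ^_ k)%:R / N%:R ^+ k|)); first by rewrite ler_wpM2r.
rewrite mul1r ger0_norm; last first.
  rewrite subr_ge0 ler_pdivrMr ?exprn_gt0// mul1r -natrX ler_nat.
  by apply: (leq_trans fu); rewrite leq_exp2r.
rewrite lerBlDr addrC -lerBlDr.
pose x : R := (m + k)%:R / N%:R.
have x0 : 0 <= x by rewrite divr_ge0.
have xm : x <= (k.+1)%:R / m%:R.
  rewrite /x ler_pdivrMr// mulrAC ler_pdivlMr// -!natrM ler_nat /N.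
  rewrite (expnS m 3) mulnCA mulnC leq_mul2l; apply/orP; right.
  have m3 : (m <= m ^ 3)%N by rewrite -{1}(expn1 m) leq_pexp2l.
  apply: (@leq_trans (k.+1 * m)); last by rewrite leq_mul2l m3 orbT.
  by rewrite mulSn leq_add2l leq_pmulr.
have kxe : k%:R * x <= e.
  apply: (@le_trans _ _ (k%:R * (k.+1%:R / m%:R))); first by rewrite ler_wpM2l.
  rewrite mulrA ler_pdivrMr// -ler_pdivrMl// mulrC; apply: le_trans mbig.
  by rewrite ler_pM2r ?invr_gt0// -natrM ler_nat leq_mul2l addn1 leqnSn orbT.
have [x1|x1] := leP x 1; last first.
  have k1 : 1 <= k%:R :> R by rewrite ler1n.
  have : 0 <= (c ^_ k)%:R / N%:R ^+ k :> R by rewrite divr_ge0// exprn_ge0.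
  have : 1 * 1 <= k%:R * x by apply: ler_pM => //; exact: ltW.
  lra.
have := bernoulli_ineq k x0 x1.
have : (1 - x) ^+ k <= (c ^_ k)%:R / N%:R ^+ k.
  have mkN : (m + k <= N)%N by rewrite -(ler_nat R) -[leRHS]mul1r -ler_pdivrMr.
  rewrite (_ : 1 - x = (N - (m + k))%:R / N%:R); last first.
    by rewrite natrB// /x; field; rewrite gt_eqF.
  rewrite expr_div_n ler_pM2r ?invr_gt0 ?exprn_gt0// -natrX ler_nat.
  apply: leq_trans fl; rewrite leq_exp2r// subnDA leq_sub2r//.
lra.
Unshelve. all: by end_near. Qed.

End LargeMean.

(** * Tent correlations for almost every alpha *)

Lemma cvg_centered_sum (R : realType) (X Y mean u : nat -> R) (l : R) :
  X m ^+ 2 @[m --> \oo] --> (0 : R) -> Y m @[m --> \oo] --> (0 : R) ->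
  mean m @[m --> \oo] --> l -> (\forall m \near \oo, X m + Y m + mean m = u m) ->
  u m @[m --> \oo] --> l.
Proof.
move=> HX HY Hm E; apply: cvg_trans (near_eq_cvg E) _.
have HX' : X m @[m --> \oo] --> (0 : R).
  apply/cvgr0Pnorm_le => e e0; move/cvgr0Pnorm_le: HX => /(_ _ (exprn_gt0 2 e0)).
  by apply: filterS => m; rewrite normrX ler_pXn2r ?nnegrE//; exact: ltW.
have E0 : 0 + 0 + l = l by rewrite !add0r.
by have := cvgD (cvgD HX' HY) Hm; rewrite E0; exact.
Qed.

Section TentAlmostEverywhere.
Variables (R : realType) (a : nat -> R).
Hypotheses (apos : forall n, (1 <= n)%N -> 0 < a n)
  (aincr : forall m n, (1 <= m)%N -> (m < n)%N -> a m < a n)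
  (agrowth : a n / ln (n%:R : R) @[n --> \oo] --> +oo)
  (agap : exists2 C : R, 0 < C & \forall n \near \oo, n%:R `^ (- C) <= a n.+1 - a n).

(** The estimates yield m^-4 for the variance and m^-3 for the small indices; the common rate m^-2
    is enough for summability. *)
Lemma moment_bounds (k q : nat) (s : seq int) (A B : R) : (0 < k)%N -> (0 < q)%N ->
  0 < A -> A <= B -> exists C : R, \forall m \near \oo,
    Int A B (fun alpha => (large_count (exp_theta a) k q (m ^ 4) (fun v => m < v ^ k)%N
        (nth 0 s) alpha - large_mean R k q (m ^ 4) (fun v => m < v ^ k)%N) ^+ 2) <=
      C * m%:R ^- 2 /\
    Int A B (small_count (exp_theta a) k q (m ^ 4) (fun v => m < v ^ k)%N (nth 0 s)) <=
      C * m%:R ^- 2.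
Proof.
move=> k0 q0 A0 AB.
(* The sum of the |s_i| bounds each of them, and the padding zeros as well. *)
pose H := (k * (sumn [seq `|z|%N | z <- s] + 1))%N.
have BA : 0 <= B - A by rewrite subr_ge0.
pose C1 : R := 4 ^+ k * (B - A) * ((2 * H)%:R ^+ (2 * k) * (2 * k + 2)%:R ^+ (2 * k)) +
   (4 ^+ k + 3) * 4 ^+ k.
pose C2 : R := 2 ^+ k * ((B - A) * (2 * H)%:R ^+ k * 4 ^+ k + 2 ^+ k).
have C10 : 0 <= C1 by rewrite addr_ge0 ?mulr_ge0 ?exprn_ge0// ?addr_ge0 ?exprn_ge0// mulr_ge0 ?exprn_ge0.
have C20 : 0 <= C2 by rewrite mulr_ge0 ?exprn_ge0// addr_ge0 ?mulr_ge0 ?exprn_ge0.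
exists (C1 + C2).
have eq := Int_tent_edges apos aincr agrowth agap k0 q0 A0 AB.
near=> m; set N := (m ^ 4)%N.
have eqm : forall es : seq (edge R), (size es <= 2 * k)%N ->
    {in endpoints es, forall v, (0 < v <= m ^ 4)%N} ->
    peel_order (fun v => m < v ^ k)%N es ->
    {in es, forall e, tent_edge (q * m ^ 4)%:R e} ->
    `|Int A B (edge_prod (exp_theta a) es) -
      (B - A) * \prod_(e <- es) gridavg (q * m ^ (8 * (2 * k + 3))) e.2| <=
    m%:R ^- (8 * k) by near: m; exact: eq.
have m2 : (2 <= m)%N by near: m; exact: nbhs_infty_ge.
have mH : (4 * H <= m)%N by near: m; exact: nbhs_infty_ge.
have m0 : (0 < m)%N by exact: ltnW.
have mgt0 : 0 < m%:R :> R by rewrite ltr0n.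
have mN : (m <= N)%N by rewrite -{1}(expn1 m) leq_pexp2l.
have N0 : (0 < N)%N by exact: leq_trans mN.
(* Chosen so that q * m ^ 4 * P is the grid size of the equidistribution estimate. *)
pose P := (m ^ (16 * k + 20))%N.
have P0 : (0 < P)%N by rewrite expn_gt0 m0.
have LE : (q * m ^ (8 * (2 * k + 3)) = q * N * P)%N.
  by rewrite -mulnA /N /P -expnD; congr (_ * m ^ _)%N; clear; lia.
have H0 : (0 < H)%N by rewrite muln_gt0 k0 addn1.
have qN2 : (2 <= q * N)%N by rewrite (leq_trans m2)// (leq_trans mN)// leq_pmull.
have HN : (4 * H <= N)%N by exact: leq_trans mN.
have cH i : (k * (`|nth 0%R s i| + 1) <= H)%N.
  rewrite leq_mul2l leq_add2r; apply/orP; right.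
  clear; elim: s i => [|z s IH] [|i] //=; first exact: leq_addr.
  by apply: leq_trans (IH i) _; exact: leq_addl.
rewrite LE in eqm.
have errN : m%:R ^- (8 * k) * N%:R ^+ (2 * k) <= 1 :> R.
  rewrite natrX -exprM mulnA mulVf// expf_neq0// gt_eqF//.
have c0 := @continuous_exp_theta R a.
have NE : N%:R^-1 <= m%:R ^- 2 :> R.
  by rewrite natrX lef_pV2 ?posrE ?exprn_gt0// ler_weXn2l// ler1n.
split.
  apply: le_trans (Int_large_variance c0 AB k0 q0 N0 P0 H0 qN2 HN cH eqm errN) _.
  rewrite -/C1; apply: ler_pM; rewrite ?invr_ge0//.
  by rewrite lerDl.
apply: le_trans (Int_small_count c0 AB k0 q0 N0 P0 H0 qN2 HN cH eqm errN) _.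
have [sm _] := card_small_index N k0 m0.
apply: (@le_trans _ _ (C2 * m%:R / N%:R)).
  rewrite ler_pM2r ?invr_gt0 ?ltr0n// /C2 -[leRHS]mulrA ler_wpM2l ?exprn_ge0//.
  rewrite [leRHS]mulrDl; apply: lerD; last first.
    by rewrite -[leLHS]mulr1 ler_wpM2l ?exprn_ge0// ler1n.
  rewrite -[leRHS]mulrA ler_wpM2l ?mulr_ge0 ?exprn_ge0//.
  by rewrite -natrX -natrM -natrD -natrX ler_nat.
apply: (@le_trans _ _ (C2 * m%:R ^- 2)).
  rewrite -mulrA ler_wpM2l// natrX ler_pdivrMr ?exprn_gt0//.
  rewrite mulrC ler_pdivlMr ?exprn_gt0// -exprS ler_weXn2l// ler1n//.
by rewrite ler_wpM2r ?invr_ge0 ?exprn_ge0// lerDr.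
Unshelve. all: by end_near. Qed.

(** The limit q^-(k-1) is the integral of the tent test function. *)
Lemma tent_correlation_ae (k q : nat) (s : seq int) (A B : R) : (0 < k)%N -> (0 < q)%N ->
  0 < A -> A <= B ->
  {ae (@lebesgue_measure R), forall alpha, A <= alpha -> alpha <= B ->
     correlation (@tent_test R k.-1 q s) (fun n => expR (alpha * a n)) (m ^ 4)
       @[m --> \oo] --> (q%:R ^- k.-1 : R)}.
Proof.
move=> k0 q0 A0 AB.
have [C HC] := moment_bounds s k0 q0 A0 AB.
pose large m := (fun v => m < v ^ k)%N.
pose X m alpha := large_count (exp_theta a) k q (m ^ 4) (large m) (nth 0 s) alpha -
   large_mean R k q (m ^ 4) (large m).
pose Y m alpha := small_count (exp_theta a) k q (m ^ 4) (large m) (nth 0 s) alpha.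
have cX m : continuous (X m).
  apply: continuous_sub; first exact: continuous_large_count (@continuous_exp_theta R a).
  by move=> x; exact: cst_continuous.
have aeX := @ae_cvg0_of_Int R A B C (fun m alpha => X m alpha ^+ 2) AB.
have aeY := @ae_cvg0_of_Int R A B C Y AB.
have {aeX} : {ae (@lebesgue_measure R), forall alpha, A <= alpha -> alpha <= B ->
     X m alpha ^+ 2 @[m --> \oo] --> (0 : R)}.
  apply: aeX.
  - by move=> m; under eq_fun do rewrite expr2; exact: continuous_mul.
  - by move=> m x; exact: sqr_ge0.
  - by apply: filterS HC => m [].
have {aeY} : {ae (@lebesgue_measure R), forall alpha, A <= alpha -> alpha <= B ->
     Y m alpha @[m --> \oo] --> (0 : R)}.
  apply: aeY.
  - by move=> m; exact: continuous_small_count (@continuous_exp_theta R a).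
  - by move=> m x; exact: small_count_ge0.
  - by apply: filterS HC => m [].
move=> aeY aeX; have F := ae_filter_ringOfSetsType (@lebesgue_measure R).
apply: (@filterS _ _ F _ _ _ (filterI aeX aeY)) => alpha [HX HY] Aa aB.
have {}HX := HX Aa aB; have {}HY := HY Aa aB.
apply: (cvg_centered_sum HX HY (@large_mean_cvg R k q k0 q0)).
exists 2%N => // m /= m2.
have mN : (m <= m ^ 4)%N by rewrite -{1}(expn1 m) leq_pexp2l// ltnW.
have N0 : (0 < m ^ 4)%N by apply: leq_trans mN; exact: ltnW.
have qN2 : (2 <= q * m ^ 4)%N by rewrite (leq_trans m2)// (leq_trans mN)// leq_pmull.
by rewrite (correlation_tent s (exp_theta a) alpha (large m) k0 N0 qN2) /X /Y; ring.
Qed.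

End TentAlmostEverywhere.

(** * From tents to continuous test functions *)

Section CompactSupport.
Variables (R : realType) (n : nat).
Implicit Types (f : 'rV[R]_n -> R) (x y z : 'rV[R]_n).

Lemma compactly_supported_bounded f : compactly_supported f ->
  exists H : nat, forall z, f z != 0 -> forall i, `|z ord0 i| <= H%:R.
Proof.
move=> /compact_bounded[M [Mreal HM]].
exists (Num.truncn (M + 1)).+1 => z fz i.
have zM : `|z| <= M + 1.
  apply: HM; first by rewrite ltrDl.
  exact: subset_closure.
apply: le_trans (ltW (truncnS_gt _)); apply: le_trans zM.
rewrite [leRHS]/Num.norm/= mx_normrE; apply/bigmax_geP; right => /=.
by exists (ord0, i).
Qed.

Lemma compactly_supported_unif f (e : R) : continuous f -> compactly_supported f -> 0 < e ->
  \forall q \near \oo, forall x y, (forall i, `|x ord0 i - y ord0 i| <= q%:R^-1) ->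
    `|f x - f y| <= e.
Proof.
move=> cf /compact_near_coveringP cpt e0.
pose P (q : nat) x := forall y, (forall i, `|x ord0 i - y ord0 i| <= q%:R^-1) -> `|f x - f y| <= e.
have near_P x : closure [set x | f x != 0] x -> \forall x' \near x & q \near \oo, P q x'.
  move=> _; have e2 : 0 < e / 2 by rewrite divr_gt0.
  have /cvgrPdist_le/(_ _ e2) := cf x.
  move=> /nbhs_ballP[d /= d0 Hd].
  have d2 : 0 < d / 2 by rewrite divr_gt0.
  exists (ball x (d / 2), [set q | 2 / d < q%:R]) => /=.
    split; first exact: nbhsx_ballx.
    exact: nbhs_infty_gtr.
  move=> [x' q] [/= xx' dq] y x'y.
  have q0 : 0 < q%:R :> R by apply: lt_trans dq; rewrite divr_gt0.
  have qd : q%:R^-1 < d / 2.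
    by rewrite -[d / 2]invrK invf_div ltf_pV2 ?posrE// divr_gt0.
  have hx' : `|f x - f x'| <= e / 2.
    by apply: Hd; apply: le_ball xx'; lra.
  have hy : `|f x - f y| <= e / 2.
    apply: Hd; split => // i j; rewrite (ord1 i).
    have [_ /(_ ord0 j)] := xx'; rewrite /ball/= => h1.
    have := x'y j => h2; rewrite (_ : x ord0 j - y ord0 j =
      (x ord0 j - x' ord0 j) + (x' ord0 j - y ord0 j)); last by ring.
    by apply: le_lt_trans (ler_normD _ _) _; lra.
  rewrite (_ : f x' - f y = (f x - f y) - (f x - f x')); last by ring.
  by apply: le_trans (ler_normB _ _) _; lra.
apply: filterS (cpt _ _ P _ near_P) => q Hq x y xy.
have [fx|fx] := eqVneq (f x) 0; last first.
  by apply: Hq xy; apply: subset_closure.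
have [fy|fy] := eqVneq (f y) 0; first by rewrite fx fy subrr normr0 ltW.
rewrite distrC; apply: Hq; first exact: subset_closure.
by move=> i; rewrite distrC.
Qed.

End CompactSupport.

(** * Lattice sums as sums over finite boxes *)

Section FiniteLatticeSums.
Variables (R : realType) (n : nat).

Lemma finite_lattice_box (K : nat) : finite_set [set m : 'rV[int]_n | forall i, (`|m ord0 i| <= K)%N].
Proof.
pose g (c : {ffun 'I_n -> 'I_(2 * K).+1}) : 'rV[int]_n := \row_i ((c i)%:Z - K%:Z).
apply: (@sub_finite_set _ _ (g @` [set: {ffun 'I_n -> 'I_(2 * K).+1}])); last first.
  exact: finite_image.
move=> m /= mK; exists [ffun i => inord (absz (m ord0 i + K%:Z))] => //.
apply/rowP => i; rewrite mxE ffunE.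
have := mK i; rewrite (_ : m 0 i = m ord0 i); last by congr (m _ i); exact: val_inj.
by move: (m ord0 i) => z h; rewrite inordK; clear -h; lia.
Qed.

Lemma fsbig_box (K : nat) (E : 'rV[int]_n -> R) :
  (forall m, E m != 0 -> forall i, (`|m ord0 i| <= K)%N) ->
  \sum_(m \in [set: 'rV[int]_n]) E m =
  \sum_(m <- fset_set [set m : 'rV[int]_n | forall i, (`|m ord0 i| <= K)%N]) E m.
Proof.
move=> EK; rewrite -fsbig_finite; last exact: finite_lattice_box.
apply/esym/fsbig_widen => // m [_ /= mK].
by apply/eqP; apply: contra_notT mK; exact: EK.
Qed.

Lemma fsbig_box_le (K : nat) (F G : 'rV[int]_n -> R) :
  (forall m, F m != 0 -> forall i, (`|m ord0 i| <= K)%N) ->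
  (forall m, G m != 0 -> forall i, (`|m ord0 i| <= K)%N) ->
  (forall m, F m <= G m) ->
  \sum_(m \in [set: 'rV[int]_n]) F m <= \sum_(m \in [set: 'rV[int]_n]) G m.
Proof.
by move=> FK GK FG; rewrite !(@fsbig_box K)//; apply: ler_sum => m _.
Qed.

Lemma fsbig_box_sum (K : nat) (I : finType) (w : I -> R) (F : I -> 'rV[int]_n -> R) :
  (forall c m, F c m != 0 -> forall i, (`|m ord0 i| <= K)%N) ->
  \sum_(m \in [set: 'rV[int]_n]) (\sum_c w c * F c m) =
  \sum_c w c * \sum_(m \in [set: 'rV[int]_n]) F c m.
Proof.
move=> FK; rewrite (@fsbig_box K); last first.
  move=> m; apply: contra_neqP => /existsNP[i mi].
  rewrite big1// => c _; apply/eqP; rewrite mulf_eq0; apply/orP; right.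
  by apply: contra_notT mi => Fcm; exact: FK Fcm i.
rewrite exchange_big/=; apply: eq_bigr => c _.
by rewrite -mulr_sumr (@fsbig_box K)//; exact: FK.
Qed.

End FiniteLatticeSums.

Section HatPartition.
Variable R : realType.
Implicit Type y : R.

(* [hat] is a difference of two translates of [clamp], so the sum of its integer
   translates telescopes. *)
Let clamp (y : R) : R := Num.min (Num.max y 0) 1.

Let clamp_le0 y : y <= 0 -> clamp y = 0.
Proof. by move=> y0; rewrite /clamp max_r// min_l. Qed.

Let clamp_ge1 y : 1 <= y -> clamp y = 1.
Proof. by move=> y1; rewrite /clamp max_l ?min_r//; lra. Qed.

Let clamp_id y : 0 <= y -> y <= 1 -> clamp y = y.
Proof. by move=> y0 y1; rewrite /clamp max_l// min_l. Qed.

Let clamp_itv y : 0 <= clamp y <= 1.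
Proof.
have [y0|y0] := leP y 0; first by rewrite clamp_le0// lexx ler01.
have [y1|y1] := leP y 1; first by rewrite clamp_id// ltW.
by rewrite clamp_ge1 ?ler01 ?lexx// ltW.
Qed.

Let hatE y : hat y = clamp (y + 1) - clamp y.
Proof.
rewrite /hat; have [y1|y1] := leP y (- 1).
  by rewrite !clamp_le0 ?subrr ?ler0_norm ?max_l//; lra.
have [y0|y0] := leP y 0.
  by rewrite clamp_id ?clamp_le0 ?ler0_norm ?max_r//; lra.
rewrite (clamp_ge1 (_ : 1 <= y + 1)) ?gtr0_norm//; last lra.
have [y2|y2] := leP y 1.
  by rewrite clamp_id ?max_r//; lra.
by rewrite clamp_ge1 ?max_l//; lra.
Qed.

Lemma sum_hat (M : nat) y : \sum_(j < M) hat (y - j%:R) = clamp (y + 1) - clamp (y + 1 - M%:R).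
Proof.
elim: M => [|M IH]; first by rewrite big_ord0 subr0 subrr.
rewrite big_ord_recr/= IH hatE -[M.+1%:R]natr1.
rewrite (_ : y - M%:R + 1 = y + 1 - M%:R); last by ring.
by rewrite (_ : y + 1 - (M%:R + 1) = y - M%:R); last ring; rewrite addrA subrK.
Qed.

Lemma sum_hat_le1 (M : nat) y : \sum_(j < M) hat (y - j%:R) <= 1.
Proof.
rewrite sum_hat.
have /andP[_ h1] := clamp_itv (y + 1); have /andP[h2 _] := clamp_itv (y + 1 - M%:R).
by lra.
Qed.

Lemma sum_hat_eq1 (M : nat) y : 0 <= y -> y <= M%:R -> \sum_(j < M.+1) hat (y - j%:R) = 1.
Proof.
move=> y0 yM; have h : M.+1%:R = M%:R + 1 :> R by rewrite natr1.
by rewrite sum_hat clamp_ge1 ?clamp_le0 ?subr0//; lra.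
Qed.

Lemma hat_neq0 y : hat y != 0 -> `|y| < 1.
Proof. by rewrite /hat neq_lt ltNge le_max lexx/= lt_max ltxx/= subr_gt0. Qed.

End HatPartition.

Section Grid.
Variables (R : realType) (n q H : nat).
Hypothesis q0 : (0 < q)%N.

(* The grid extends to [2 * H + 1] although the support is within [H], to leave room
   for a dilation by a factor [rho] close to [1]. *)
Definition grid_radius : nat := (q * (2 * H + 1))%N.

Definition grid_index := {ffun 'I_n -> 'I_(2 * grid_radius).+1}.

Implicit Type c : grid_index.

Definition grid_seq c : seq int := [seq (c i)%:Z - grid_radius%:Z | i <- enum 'I_n].

Definition grid_point c : 'rV[R]_n := \row_i (((c i)%:R - grid_radius%:R) / q%:R).

Let qgt0 : 0 < q%:R :> R. Proof. by rewrite ltr0n. Qed.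

Lemma grid_testE c (z : 'rV[R]_n) :
  tent_test q (grid_seq c) z = \prod_i hat (q%:R * z ord0 i + grid_radius%:R - (c i)%:R).
Proof.
apply: eq_bigr => i _; congr hat.
rewrite (nth_map i) ?size_enum_ord// nth_ord_enum intrB -!pmulrn; ring.
Qed.

Lemma sum_grid_test (z : 'rV[R]_n) : \sum_c tent_test q (grid_seq c) z =
  \prod_i \sum_(j < (2 * grid_radius).+1) hat (q%:R * z ord0 i + grid_radius%:R - j%:R).
Proof.
by rewrite bigA_distr_bigA; apply: eq_bigr => c _; rewrite grid_testE.
Qed.

Lemma sum_grid_test_le1 (z : 'rV[R]_n) : \sum_c tent_test q (grid_seq c) z <= 1.
Proof.
rewrite sum_grid_test; apply: (@le_trans _ _ (\prod_(i < n) 1)); last by rewrite big1.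
apply: ler_prod => i _; rewrite sum_hat_le1 andbT.
by apply: sumr_ge0 => j _; exact: hat_ge0.
Qed.

Lemma sum_grid_test_eq1 (z : 'rV[R]_n) : (forall i, `|z ord0 i| <= (2 * H + 1)%:R) ->
  \sum_c tent_test q (grid_seq c) z = 1.
Proof.
move=> zH; rewrite sum_grid_test big1// => i _.
have h : `|q%:R * z ord0 i| <= grid_radius%:R.
  by rewrite normrM gtr0_norm// natrM ler_wpM2l.
move: h; rewrite ler_norml => /andP[h1 h2].
by apply: sum_hat_eq1; [lra|rewrite (natrM _ 2); lra].
Qed.

Lemma grid_test_close c (z : 'rV[R]_n) : tent_test q (grid_seq c) z != 0 ->
  forall i, `|z ord0 i - grid_point c ord0 i| <= q%:R^-1 /\ `|z ord0 i| <= (2 * H + 2)%:R.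
Proof.
rewrite grid_testE => /prodf_neq0 nz i.
have /hat_neq0 h := nz i isT.
have close : `|z ord0 i - grid_point c ord0 i| <= q%:R^-1.
  rewrite -(ler_pM2l qgt0) mulfV ?gt_eqF// -{1}(gtr0_norm qgt0) -normrM.
  rewrite (_ : q%:R * _ = q%:R * z ord0 i + grid_radius%:R - (c i)%:R) ?ltW//.
  by rewrite mxE; field; rewrite gt_eqF.
split=> //.
have q1 : q%:R^-1 <= 1 :> R by rewrite invf_le1// ler1n.
have p1 : `|grid_point c ord0 i| <= (2 * H + 1)%:R.
  rewrite mxE normrM normfV (gtr0_norm qgt0) ler_pdivrMr// mulrC -natrM -/grid_radius.
  have : (c i)%:R <= (2 * grid_radius)%:R :> R by rewrite ler_nat -ltnS ltn_ord.
  have : 0 <= (c i)%:R :> R by [].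
  by rewrite natrM ler_norml => ? ?; apply/andP; split; lra.
have := ler_normD (z ord0 i - grid_point c ord0 i) (grid_point c ord0 i).
rewrite subrK (natrD _ _ 2) natrD in p1 *; lra.
Qed.

Section Sandwich.
Variables (f : 'rV[R]_n -> R) (e rho : R).
Hypothesis f0 : forall z, 0 <= f z.
Hypothesis fH : forall z, f z != 0 -> forall i, `|z ord0 i| <= H%:R.
Hypothesis f_unif : forall x y : 'rV[R]_n,
  (forall i, `|x ord0 i - y ord0 i| <= q%:R^-1 + q%:R^-1) -> `|f x - f y| <= e.
Hypotheses (e0 : 0 <= e) (rho_close : `|rho - 1| * (2 * H + 2)%:R <= q%:R^-1).

Let term (z : 'rV[R]_n) c :
  (f (grid_point c) - e) * tent_test q (grid_seq c) z <= f (rho *: z) * tent_test q (grid_seq c) z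
    <= (f (grid_point c) + e) * tent_test q (grid_seq c) z.
Proof.
have [->|T0] := eqVneq (tent_test q (grid_seq c) z) 0; first by rewrite !mulr0 lexx.
have Tge0 := tent_test_ge0 q (grid_seq c) z.
have : `|f (rho *: z) - f (grid_point c)| <= e.
  (* The dilation moves each coordinate by at most 1 / q and z is within 1 / q of the grid point,
     hence the modulus 2 / q. *)
  apply: f_unif => i; have [h1 h2] := grid_test_close T0 i.
  rewrite mxE (_ : _ - _ = (rho - 1) * z ord0 i + (z ord0 i - grid_point c ord0 i)); last by ring.
  apply: le_trans (ler_normD _ _) _; apply: lerD => //.
  by rewrite normrM; apply: le_trans rho_close; rewrite ler_wpM2l.
rewrite ler_norml => /andP[? ?].
by apply/andP; split; rewrite ler_wpM2r//; lra.
Qed.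

(** As f >= 0, a total of at most 1 for the tents suffices. *)
Lemma grid_lower z : \sum_c (f (grid_point c) - e) * tent_test q (grid_seq c) z <= f (rho *: z).
Proof.
apply: (@le_trans _ _ (\sum_c f (rho *: z) * tent_test q (grid_seq c) z)).
  by apply: ler_sum => c _; have /andP[] := term z c.
by rewrite -mulr_sumr -[leRHS]mulr1 ler_wpM2l// sum_grid_test_le1.
Qed.

(** The tents have to sum to 1 wherever f (rho *: z) is nonzero; there |z_i| <= H / |rho| <= 2 H,
    since |rho| >= 1/2. *)
Lemma grid_upper z : f (rho *: z) <= \sum_c (f (grid_point c) + e) * tent_test q (grid_seq c) z.
Proof.
have [->|fz] := eqVneq (f (rho *: z)) 0.
  by apply: sumr_ge0 => c _; rewrite mulr_ge0 ?addr_ge0 ?tent_test_ge0.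
have zH i : `|z ord0 i| <= (2 * H + 1)%:R.
  have := fH fz i; rewrite mxE normrM => h.
  have q1 : q%:R^-1 <= 1 :> R by rewrite invf_le1// ler1n.
  have H2 : 2 <= (2 * H + 2)%:R :> R by rewrite ler_nat leq_addl.
  have r2 : `|rho - 1| <= 2^-1.
    have : `|rho - 1| * 2 <= q%:R^-1 by apply: le_trans rho_close; rewrite ler_wpM2l.
    lra.
  have : 2^-1 <= `|rho|.
    by move: r2; rewrite ler_norml => /andP[? ?]; rewrite ler_normr; apply/orP; left; lra.
  move=> r1; have : 2^-1 * `|z ord0 i| <= `|rho| * `|z ord0 i| by rewrite ler_wpM2r.
  rewrite natrD natrM; lra.
rewrite -[leLHS]mulr1 -(sum_grid_test_eq1 zH) mulr_sumr.
by apply: ler_sum => c _; have /andP[] := term z c.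
Qed.

End Sandwich.
End Grid.

(** Also the exact integral of the interpolation of [f] by tents, as each tent has integral q^-n. *)
Definition riemann_sum (R : realType) (n : nat) (f : 'rV[R]_n -> R) (H q : nat) : R :=
  q%:R ^- n * \sum_(c : grid_index n q H) f (grid_point R c).

(** * Comparison of N with nearby fourth powers *)

Section Interpolation.
Variables (R : realType) (k : nat) (theta : nat -> R).
Hypothesis k0 : (0 < k)%N.
Implicit Types (x : seq nat) (g f : 'rV[R]_k.-1 -> R).

Definition gap_vector x : 'rV[R]_k.-1 :=
  \row_(i < k.-1) (theta (nth 0%N x i) - theta (nth 0%N x i.+1)).

Definition lattice_sum g (N : nat) x : R :=
  \sum_(m \in [set: 'rV[int]_k.-1]) g (N%:R *: (gap_vector x - map_mx intr m)).

Lemma correlationE g N : correlation g theta N =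
  N%:R^-1 * \sum_(x in distinct_tuples k N) lattice_sum g N (indices x).
Proof.
congr (_ * _); apply: eq_bigr => x _; rewrite /lattice_sum.
suff -> : gaps x theta = gap_vector (indices x) by [].
apply/rowP => i; rewrite !mxE.
have ik : (i.+1 < k)%N by have := ltn_ord i; clear -k0; lia.
by rewrite /indices !(nth_map ord0) ?size_tuple// ltnW.
Qed.

Lemma sum_distinct_le (F : seq nat -> R) N N' : (forall x, 0 <= F x) -> (N <= N')%N ->
  \sum_(x in distinct_tuples k N) F (indices x) <= \sum_(x in distinct_tuples k N') F (indices x).
Proof.
move=> F0 NN'; have NN1 : (N.+1 <= N'.+1)%N by [].
pose w (x : k.-tuple 'I_N.+1) : k.-tuple 'I_N'.+1 := [tuple of map (widen_ord NN1) x].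
have winj : injective w.
  move=> x y /(congr1 val)/= /inj_map E; apply/val_inj/E.
  by move=> u v /(congr1 val)/= uv; exact: val_inj.
have wE (y : k.-tuple 'I_N.+1) : indices (w y) = indices y by rewrite /indices -map_comp; exact: eq_map.
rewrite (eq_bigr (fun y : k.-tuple 'I_N.+1 => F (indices (w y)))) => [|y _]; last by rewrite wE.
rewrite -(big_imset (fun y : k.-tuple 'I_N'.+1 => F (indices y)))/=; last by move=> y z _ _; exact: winj.
rewrite [leRHS](bigID (fun y => y \in w @: distinct_tuples k N))/= -[leLHS]addr0.
apply: lerD; last exact: sumr_ge0.
rewrite le_eqVlt; apply/orP; left; apply/eqP/eq_bigl => y.
rewrite andbC; case: (boolP (y \in w @: _)) => //= /imsetP[x xD ->].
apply/esym; move: xD; rewrite !inE /= => /andP[ux /allP px].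
rewrite map_inj_uniq ?ux/=; last by move=> u v /(congr1 val)/= uv; exact: val_inj.
by apply/allP => _ /mapP[v vx ->]/=; exact: px.
Qed.

Lemma lattice_box (b : nat) (g : 'rV[R]_k.-1 -> R) x :
  (forall z, g z != 0 -> forall i, `|z ord0 i| <= b%:R) ->
  exists K : nat, forall N, (0 < N)%N -> forall m : 'rV[int]_k.-1,
    g (N%:R *: (gap_vector x - map_mx intr m)) != 0 -> forall i, (`|m ord0 i| <= K)%N.
Proof.
move=> gb; pose K0 := (\sum_(i < k.-1) (Num.truncn `|gap_vector x ord0 i|).+1)%N.
exists (K0 + b)%N => N N0 m /gb gz i.
rewrite -(ler_nat R) natrD -[X in X <= _]/((absz (m ord0 i))%:R) natr_absz intr_norm.
have N1 : 1 <= N%:R :> R by rewrite ler1n.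
have h1 : `|gap_vector x ord0 i - (m ord0 i)%:~R| <= b%:R.
  apply: le_trans (gz i); rewrite !mxE normrM ger0_norm// -[leLHS]mul1r.
  by rewrite ler_wpM2r// ?normr_ge0.
have h2 : `|gap_vector x ord0 i| <= K0%:R.
  apply: le_trans (ltW (truncnS_gt _)) _; rewrite ler_nat /K0 (bigD1 i)//=.
  exact: leq_addr.
have := ler_normB (gap_vector x ord0 i) (gap_vector x ord0 i - (m ord0 i)%:~R).
rewrite (_ : _ - (_ - _) = (m ord0 i)%:~R); last by ring.
lra.
Qed.

Section Bounds.
Variables (f : 'rV[R]_k.-1 -> R) (e : R) (q H N N' : nat).
Hypotheses (q0 : (0 < q)%N) (N0 : (0 < N)%N) (N'0 : (0 < N')%N).
Hypothesis f0 : forall z, 0 <= f z.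
Hypothesis fH : forall z, f z != 0 -> forall i, `|z ord0 i| <= H%:R.
Hypothesis f_unif : forall x y : 'rV[R]_k.-1,
  (forall i, `|x ord0 i - y ord0 i| <= q%:R^-1 + q%:R^-1) -> `|f x - f y| <= e.
Hypotheses (e0 : 0 <= e) (NN' : `|N%:R / N'%:R - 1 : R| * (2 * H + 2)%:R <= q%:R^-1).

Let T (c : grid_index k.-1 q H) : 'rV[R]_k.-1 -> R := tent_test q (grid_seq c).

Let Tsupp c z : T c z != 0 -> forall i, `|z ord0 i| <= (2 * H + 2)%:R.
Proof. by move=> /(grid_test_close q0) h i; have [] := h i. Qed.

Let lattice_sum_ge0 (h : 'rV[R]_k.-1 -> R) M x : (forall z, 0 <= h z) -> 0 <= lattice_sum h M x.
Proof. by move=> h0; apply: fsumr_ge0 => m _. Qed.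

(** The scales N and N' differ by the dilation N / N', which is the [rho] of the sandwich. *)
Let rescale (z : 'rV[R]_k.-1) : N%:R *: z = (N%:R / N'%:R) *: (N'%:R *: z).
Proof. by rewrite scalerA divfK// pnatr_eq0 -lt0n. Qed.

Let box x : exists K : nat, (forall m : 'rV[int]_k.-1,
    f (N%:R *: (gap_vector x - map_mx intr m)) != 0 -> forall i, (`|m ord0 i| <= K)%N) /\
  forall c (m : 'rV[int]_k.-1),
    T c (N'%:R *: (gap_vector x - map_mx intr m)) != 0 -> forall i, (`|m ord0 i| <= K)%N.
Proof.
have [K1 HK1] := lattice_box x fH.
(* The tents are nonnegative, so the support of their sum contains all of theirs and one box serves
   every c. *)
pose G (z : 'rV[R]_k.-1) : R := \sum_c T c z.
have GT c z : T c z != 0 -> G z != 0.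
  apply: contra_neq => Gz; move/eqP: Gz; rewrite psumr_eq0 => [|d _]; last exact: tent_test_ge0.
  by move=> /allP/(_ c); rewrite mem_index_enum => /(_ isT)/eqP.
have Gsupp z : G z != 0 -> forall i, `|z ord0 i| <= (2 * H + 2)%:R.
  move=> Gz; have [c Tc] : exists c, T c z != 0.
    apply/existsP; apply: contraNT Gz; rewrite negb_exists => /forallP Tz.
    by rewrite /G big1// => c _; apply/eqP; have := Tz c; rewrite negbK.
  exact: Tsupp Tc.
have [K2 HK2] := lattice_box x Gsupp.
exists (K1 + K2)%N; split=> [m fm i|c m /GT Tm i].
  by apply: leq_trans (HK1 N N0 m fm i) _; exact: leq_addr.
by apply: leq_trans (HK2 N' N'0 m Tm i) _; exact: leq_addl.
Qed.

Let sum_box x (K : nat) (w : grid_index k.-1 q H -> R) :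
  (forall c (m : 'rV[int]_k.-1), T c (N'%:R *: (gap_vector x - map_mx intr m)) != 0 ->
     forall i, (`|m ord0 i| <= K)%N) ->
  forall m : 'rV[int]_k.-1, \sum_c w c * T c (N'%:R *: (gap_vector x - map_mx intr m)) != 0 ->
     forall i, (`|m ord0 i| <= K)%N.
Proof.
move=> TK m; apply: contra_neqP => /existsNP[i mi]; rewrite big1// => c _.
apply/eqP; rewrite mulf_eq0; apply/orP; right.
by apply: contra_notT mi => Tcm; exact: TK Tcm i.
Qed.

Lemma lattice_sum_upper x :
  lattice_sum f N x <= \sum_c (f (grid_point R c) + e) * lattice_sum (T c) N' x.
Proof.
have [K [fK TK]] := box x.
rewrite -(fsbig_box_sum (K := K) (fun c => f (grid_point R c) + e)
  (F := fun c m => T c (N'%:R *: (gap_vector x - map_mx intr m))))//.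
apply: (fsbig_box_le (K := K)) => //; first exact: sum_box.
move=> m; rewrite rescale.
exact: (grid_upper q0 f0 fH f_unif e0 NN').
Qed.

Lemma lattice_sum_lower x :
  \sum_c (f (grid_point R c) - e) * lattice_sum (T c) N' x <= lattice_sum f N x.
Proof.
have [K [fK TK]] := box x.
rewrite -(fsbig_box_sum (K := K) (fun c => f (grid_point R c) - e)
  (F := fun c m => T c (N'%:R *: (gap_vector x - map_mx intr m))))//.
apply: (fsbig_box_le (K := K)) => //; first exact: sum_box.
move=> m; rewrite rescale.
exact: (grid_lower q0 f0 f_unif NN').
Qed.

Let scaled (h : 'rV[R]_k.-1 -> R) M : (0 < M)%N ->
  \sum_(x in distinct_tuples k M) lattice_sum h M (indices x) = M%:R * correlation h theta M.
Proof. by move=> M0; rewrite correlationE mulVKf// pnatr_eq0 -lt0n. Qed.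

(** Passing from N to a larger N' only adds nonnegative terms; the tent correlations are then all at
    N', which will be a fourth power. *)
Lemma correlation_upper : (N <= N')%N -> N%:R * correlation f theta N <=
  N'%:R * \sum_c (f (grid_point R c) + e) * correlation (T c) theta N'.
Proof.
move=> NN; rewrite -scaled//.
apply: le_trans (sum_distinct_le (fun x => lattice_sum_ge0 N x f0) NN) _.
apply: (@le_trans _ _ (\sum_(x in distinct_tuples k N')
    \sum_c (f (grid_point R c) + e) * lattice_sum (T c) N' (indices x))).
  by apply: ler_sum => x _; exact: lattice_sum_upper.
rewrite exchange_big/= mulr_sumr le_eqVlt; apply/orP; left; apply/eqP/eq_bigr => c _.
by rewrite -mulr_sumr scaled// mulrCA.
Qed.

Lemma correlation_lower : (N' <= N)%N ->
  N'%:R * \sum_c (f (grid_point R c) - e) * correlation (T c) theta N' <=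
  N%:R * correlation f theta N.
Proof.
move=> NN; rewrite -[leRHS]scaled//.
apply: le_trans (sum_distinct_le (fun x => lattice_sum_ge0 N x f0) NN).
apply: (@le_trans _ _ (\sum_(x in distinct_tuples k N')
    \sum_c (f (grid_point R c) - e) * lattice_sum (T c) N' (indices x))); last first.
  by apply: ler_sum => x _; exact: lattice_sum_lower.
rewrite exchange_big/= mulr_sumr le_eqVlt; apply/orP; left; apply/eqP/eq_bigr => c _.
by rewrite -mulr_sumr scaled// mulrCA.
Qed.

End Bounds.

End Interpolation.

Lemma fourth_root (N : nat) : (0 < N)%N -> exists m, (m ^ 4 <= N < m.+1 ^ 4)%N.
Proof.
move=> N0; have ex : exists m, (m ^ 4 <= N)%N by exists 0%N.
have bd m : (m ^ 4 <= N)%N -> (m <= N)%N.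
  by apply: leq_trans; case: m => // m; rewrite -{1}(expn1 m.+1) leq_pexp2l.
have [m mN mmax] := ex_maxnP ex bd; exists m; rewrite mN/= ltnNge.
by apply/negP => /mmax; rewrite ltnn.
Qed.

Lemma cvg_sumZ (R : realType) (I : Type) (s : seq I) (w l : I -> R) (u : I -> nat -> R) :
  (forall i, u i m @[m --> \oo] --> l i) ->
  \sum_(i <- s) w i * u i m @[m --> \oo] --> \sum_(i <- s) w i * l i.
Proof.
move=> ul; elim: s => [|i s IH].
  by under eq_fun do rewrite big_nil; rewrite big_nil; exact: cvg_cst.
under eq_fun do rewrite big_cons; rewrite big_cons.
by apply: cvgD; [apply: cvgM; [exact: cvg_cst|exact: ul]|exact: IH].
Qed.

Section LimitAlongAllIntegers.
Variables (R : realType) (k : nat) (theta : nat -> R).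
Hypothesis k0 : (0 < k)%N.
Hypothesis tents : forall q (s : seq int), (0 < q)%N ->
  correlation (@tent_test R k.-1 q s) theta (m ^ 4) @[m --> \oo] --> (q%:R ^- k.-1 : R).

Lemma correlation_ge0 (g : 'rV[R]_k.-1 -> R) N : (forall z, 0 <= g z) -> 0 <= correlation g theta N.
Proof.
move=> g0; rewrite mulr_ge0 ?invr_ge0//; apply: sumr_ge0 => x _.
by apply: fsumr_ge0 => m _.
Qed.

Lemma grid_volume (H q : nat) : (0 < q)%N ->
  q%:R ^- k.-1 * (#|grid_index k.-1 q H|)%:R <= (4 * H + 3)%:R ^+ k.-1 :> R.
Proof.
move=> q0; have qgt0 : 0 < q%:R :> R by rewrite ltr0n.
rewrite card_ffun !card_ord natrX mulrC ler_pdivrMr ?exprn_gt0// -exprMn.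
rewrite lerXn2r ?nnegrE ?mulr_ge0// -natrM ler_nat /grid_radius; clear -q0; nia.
Qed.

(* [(m + 1) ^ 4 <= m ^ 4 * (1 + 15 / m)] for [m >= 1]. *)
Lemma cvg_scaled15 (u : nat -> R) (l c : R) : u m @[m --> \oo] --> l ->
  (1 + c / m%:R) * u m @[m --> \oo] --> l.
Proof.
move=> ul; rewrite -[X in _ --> X]mul1r; apply: cvgM => //.
rewrite -[X in _ --> X]addr0; apply: cvgD; first exact: cvg_cst.
rewrite -(mulr0 c); apply: cvgM; first exact: cvg_cst.
apply/cvgr0Pnorm_le => e e0; near=> m.
rewrite ger0_norm ?invr_ge0// -[e]invrK lef_pV2 ?posrE ?invr_gt0//.
  by near: m; exact: nbhs_infty_ger.
by rewrite ltr0n; near: m; exact: nbhs_infty_gt.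
Unshelve. all: by end_near. Qed.

Lemma correlation_cvg_nonneg (f : 'rV[R]_k.-1 -> R) (H : nat) (J : R) :
  continuous f -> compactly_supported f -> (forall z, 0 <= f z) ->
  (forall z, f z != 0 -> forall i, `|z ord0 i| <= H%:R) ->
  riemann_sum f H q @[q --> \oo] --> J ->
  correlation f theta N @[N --> \oo] --> J.
Proof.
move=> cf suppf f0 fH HJ; apply/cvgrPdist_le => /= eps eps0.
(* [V] bounds the total mass of the tents uniformly in q, so [e] can be fixed before q. *)
pose V : R := (4 * H + 3)%:R ^+ k.-1.
have V1 : 1 <= V by rewrite exprn_ege1// ler1n addn3.
have V0 : 0 < V by lra.
pose e := eps / (4 * V).
have e0 : 0 < e by rewrite divr_gt0// mulr_gt0.
have [r0 _ Hr] := compactly_supported_unif cf suppf e0.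
have eps4 : 0 < eps / 4 by rewrite divr_gt0.
have /cvgrPdist_le/(_ _ eps4)[r1 _ Hr1] := HJ.
(* With q = 2 r, the modulus 2 / q of the sandwich is 1 / r. *)
pose r := (r0 + r1 + 1)%N; pose q := (2 * r)%N.
have r0r : (r0 <= r)%N by rewrite /r; clear; lia.
have r1q : (r1 <= q)%N by rewrite /q /r; clear; lia.
have q0 : (0 < q)%N by rewrite /q /r; clear; lia.
have rgt0 : 0 < r%:R :> R by rewrite ltr0n /r; clear; lia.
have qgt0 : 0 < q%:R :> R by rewrite ltr0n.
have f_unif (x y : 'rV[R]_k.-1) : (forall i, `|x ord0 i - y ord0 i| <= q%:R^-1 + q%:R^-1) ->
    `|f x - f y| <= e.
  move=> xy; apply: (Hr r r0r) => i; apply: le_trans (xy i) _.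
  by rewrite le_eqVlt; apply/orP; left; apply/eqP; rewrite /q natrM; field; rewrite gt_eqF.
have riem : `|J - riemann_sum f H q| <= eps / 4 by exact: Hr1.
pose T (c : grid_index k.-1 q H) : 'rV[R]_k.-1 -> R := tent_test q (grid_seq c).
pose U m := \sum_c (f (grid_point R c) + e) * correlation (T c) theta (m ^ 4).
pose L m := \sum_c (f (grid_point R c) - e) * correlation (T c) theta (m ^ 4).
pose vol : R := q%:R ^- k.-1 * (#|grid_index k.-1 q H|)%:R.
have volV : e * vol <= eps / 4.
  apply: (@le_trans _ _ (e * V)); first by rewrite ler_wpM2l ?grid_volume// ltW.
  by rewrite le_eqVlt; apply/orP; left; apply/eqP; rewrite /e; field; rewrite gt_eqF.
have limU : U m @[m --> \oo] --> (riemann_sum f H q + e * vol).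
  have -> : riemann_sum f H q + e * vol = \sum_(c : grid_index k.-1 q H) (f (grid_point R c) + e) * q%:R ^- k.-1.
    rewrite -mulr_suml big_split/= sumr_const /riemann_sum /vol -(mulr_natr e); ring.
  by apply: cvg_sumZ => c; exact: tents.
have limL : L m @[m --> \oo] --> (riemann_sum f H q - e * vol).
  have -> : riemann_sum f H q - e * vol = \sum_(c : grid_index k.-1 q H) (f (grid_point R c) - e) * q%:R ^- k.-1.
    rewrite -mulr_suml sumrB sumr_const /riemann_sum /vol -(mulr_natr e); ring.
  by apply: cvg_sumZ => c; exact: tents.
have eps2 : 0 < eps / 2 by rewrite divr_gt0.
have limU1 : U m.+1 @[m --> \oo] --> (riemann_sum f H q + e * vol) by rewrite cvg_shiftS.
have /cvgrPdist_le/(_ _ eps2)[M1 _ HM1] := cvg_scaled15 15 limU1.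
have /cvgrPdist_le/(_ _ eps2)[M2 _ HM2] := cvg_scaled15 (- 15) limL.
have /cvgrPdist_le/(_ _ eps2)[M3 _ HM3] := limL.
(* The last summand makes a dilation within 15 / m of 1 close enough for the sandwich. *)
pose M := (M1 + M2 + M3 + 15 * (2 * H + 2) * q)%N.
exists (M ^ 4 + 1)%N => // N /=; rewrite addn1 => MN.
have N0 : (0 < N)%N by exact: leq_ltn_trans MN.
have [m /andP[mN Nm]] := fourth_root N0.
have Mm : (M <= m)%N.
  by rewrite -ltnS -(ltn_exp2r _ _ (isT : (0 < 4)%N)); apply: ltn_trans Nm.
have m1 : (0 < m)%N.
  apply: leq_trans Mm; rewrite /M; clear -q0; nia.
have mgt0 : 0 < m%:R :> R by rewrite ltr0n.
have mge1 : 1 <= m%:R :> R by rewrite ler1n.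
pose a : R := (m ^ 4)%:R; pose b : R := (m.+1 ^ 4)%:R.
have agt0 : 0 < a by rewrite ltr0n expn_gt0 m1.
have bgt0 : 0 < b by rewrite ltr0n expn_gt0.
have Ngt0 : 0 < N%:R :> R by rewrite ltr0n.
have aN : a <= N%:R by rewrite ler_nat.
have Nb : N%:R <= b by rewrite ler_nat ltnW.
have ba : b <= a * (1 + 15 / m%:R).
  rewrite /a /b !natrX -[m.+1%:R]natr1 -subr_ge0.
  have -> : m%:R ^+ 4 * (1 + 15 / m%:R) - (m%:R + 1) ^+ 4 =
      6 * (m%:R ^+ 3 - m%:R ^+ 2) + 4 * (m%:R ^+ 3 - m%:R) + (m%:R ^+ 3 - 1) :> R.
    by field; rewrite gt_eqF.
  have m32 : m%:R ^+ 2 <= m%:R ^+ 3 :> R by rewrite ler_weXn2l.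
  have m31 : m%:R <= m%:R ^+ 3 :> R by rewrite -{1}(expr1 m%:R) ler_weXn2l.
  have m30 : 1 <= m%:R ^+ 3 :> R by rewrite exprn_ege1.
  lra.
have close : 15 / m%:R * (2 * H + 2)%:R <= q%:R^-1 :> R.
  rewrite mulrAC ler_pdivrMr// [leRHS]mulrC ler_pdivlMr// -!natrM ler_nat.
  by apply: leq_trans Mm; rewrite /M; clear; lia.
have c15 : 0 <= 15 / m%:R :> R by rewrite divr_ge0// ltW.
have aC : a * (1 + 15 / m%:R) = a + a * (15 / m%:R) by ring.
have H2 : 0 <= (2 * H + 2)%:R :> R by [].
have closeb : `|N%:R / b - 1| * (2 * H + 2)%:R <= q%:R^-1.
  apply: le_trans close; rewrite ler_wpM2r// ler0_norm; last first.
    by rewrite subr_le0 ler_pdivrMr// mul1r.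
  rewrite opprB lerBlDr -lerBlDl ler_pdivlMr//.
  have : b * (15 / m%:R) >= a * (15 / m%:R) by rewrite ler_wpM2r//; lra.
  lra.
have closea : `|N%:R / a - 1| * (2 * H + 2)%:R <= q%:R^-1.
  apply: le_trans close; rewrite ler_wpM2r// ger0_norm; last first.
    by rewrite subr_ge0 ler_pdivlMr// mul1r.
  by rewrite lerBlDr ler_pdivrMr//; lra.
have m40 : (0 < m ^ 4)%N by rewrite expn_gt0 m1.
have m140 : (0 < m.+1 ^ 4)%N by rewrite expn_gt0.
have up := correlation_upper theta k0 q0 N0 m140 f0 fH f_unif (ltW e0) closeb (ltnW Nm).
have lo := correlation_lower theta k0 q0 N0 m40 f0 fH f_unif closea mN.
rewrite -/b -/(U m.+1) in up; rewrite -/a -/(L m) in lo.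
have M1m : (M1 <= m)%N by apply: leq_trans Mm; rewrite /M; clear; lia.
have M2m : (M2 <= m)%N by apply: leq_trans Mm; rewrite /M; clear; lia.
have M3m : (M3 <= m)%N by apply: leq_trans Mm; rewrite /M; clear; lia.
have /= := HM1 m M1m; have /= := HM2 m M2m; have /= := HM3 m M3m.
set C := correlation f theta N in up lo *.
rewrite !ler_norml => /andP[_ h3] /andP[_ h2] /andP[h1 _].
have U0 : 0 <= U m.+1.
  apply: sumr_ge0 => c _; rewrite mulr_ge0 ?addr_ge0 ?(ltW e0)//.
  by apply: correlation_ge0 => z; exact: tent_test_ge0.
have upC : C <= (1 + 15 / m%:R) * U m.+1.
  rewrite -(ler_pM2l Ngt0); apply: (le_trans up); rewrite mulrA ler_wpM2r//.
  apply: (le_trans ba); rewrite ler_wpM2r//; lra.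
(* The coefficients f - e may be negative, so [L m] has unknown sign: if it is nonnegative, a / N >=
   1 - 15 / m is used, otherwise a / N <= 1. *)
have loC : Num.min (L m) ((1 + - 15 / m%:R) * L m) <= C.
  rewrite ge_min -(ler_pM2l Ngt0) -[X in _ || X](ler_pM2l Ngt0).
  have [L0|L0] := leP 0 (L m); apply/orP; [right|left]; apply: le_trans lo; last first.
    by rewrite ler_wnM2r// ltW.
  rewrite mulrA ler_wpM2r// mulrDr mulr1.
  have t1 : a * (15 / m%:R) <= N%:R * (15 / m%:R) by rewrite ler_wpM2r.
  have -> : N%:R * (- 15 / m%:R) = - (N%:R * (15 / m%:R)) :> R by ring.
  lra.
have loL : riemann_sum f H q - e * vol - eps / 2 <= C.
  by apply: le_trans loC; rewrite le_min; apply/andP; split; lra.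
move: riem; rewrite ler_norml => /andP[r1' r2'].
apply/andP; split; lra.
Qed.

End LimitAlongAllIntegers.

(** * Riemann sums *)

Section RiemannSums.
Variables (R : realType) (n : nat) (f : 'rV[R]_n -> R) (H : nat).
Hypotheses (cf : continuous f) (suppf : compactly_supported f).
Hypothesis fH : forall z, f z != 0 -> forall i, `|z ord0 i| <= H%:R.

Let T := n.-tuple (measurableTypeR R).
Let mu := lebesgue_tuple R n.

Lemma measurable_tuple_box (A : 'I_n -> set (measurableTypeR R)) : (forall i, measurable (A i)) ->
  measurable [set t : T | forall i, A i (tnth t i)].
Proof.
move=> mA; rewrite (_ : mkset _ = \bigcap_(i in [set: 'I_n]) ((@tnth n _)^~ i @^-1` A i)).
  apply: fin_bigcap_measurable => // i _.
  by rewrite -[X in measurable X]setTI; apply: measurable_tnth.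
by apply/seteqP; split => t /= At i; [move=> _|]; apply: At.
Qed.

Lemma integrable_tuple_box (A : 'I_n -> set (measurableTypeR R)) : (forall i, measurable (A i)) ->
  (forall i, lebesgue_measure (A i) \is a fin_num) ->
  mu.-integrable [set: T] (fun t => (\1_[set t : T | forall i, A i (tnth t i)] t)%:E).
Proof.
move=> mA fA; have mB := measurable_tuple_box mA.
apply/integrableP; split; first by apply/measurable_EFinP; exact: measurable_indic.
rewrite (eq_integral (fun t => (\1_[set t : T | forall i, A i (tnth t i)] t)%:E)); last first.
  by move=> t _; rewrite gee0_abs// lee_fin.
rewrite integral_indic// setIT [X in (X < _)%E](lebesgue_tuple_box mA).
by rewrite ltey_eq; apply/orP; left; apply: prode_fin_num.
Qed.

Section Mesh.
Variable q : nat.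
Hypothesis q0 : (0 < q)%N.

Let qgt0 : 0 < q%:R :> R. Proof. by rewrite ltr0n. Qed.

Definition cell_side (c : grid_index n q H) i : set (measurableTypeR R) :=
  [set` `[grid_point R c ord0 i, grid_point R c ord0 i + q%:R^-1[%R].

Definition cell c : set T := [set t | forall i, cell_side c i (tnth t i)].

Definition mesh_floor (t : T) : 'rV[R]_n := \row_i ((Num.floor (q%:R * tnth t i))%:~R / q%:R).

Let cell_sideE (p y : R) : (p / q%:R <= y < p / q%:R + q%:R^-1) = (p <= q%:R * y < p + 1).
Proof.
by rewrite ler_pdivrMr// -{2}[q%:R^-1]mul1r -mulrDl ltr_pdivlMr// [y * _]mulrC.
Qed.

Let cellP c t : cell c t <-> mesh_floor t = grid_point R c.
Proof.
have intE i : (c i)%:R - (grid_radius q H)%:R = ((c i)%:Z - (grid_radius q H)%:Z)%:~R :> R.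
  by rewrite intrB -!pmulrn.
split=> [ct|E i].
  apply/rowP => i; rewrite !mxE; congr (_ / _).
  have := ct i; rewrite /cell_side/= in_itv/= mxE cell_sideE intE => ?.
  by congr (_%:~R); apply: floor_def; rewrite [_%:~R in X in _ && X]intrD.
rewrite /cell_side/= in_itv/= -E mxE cell_sideE.
by have := floor_itv (q%:R * tnth t i); rewrite [in X in X -> _]intrD.
Qed.

Lemma integral_cell c : (\int[mu]_t (\1_(cell c) t)%:E)%E = (q%:R ^- n)%:E.
Proof.
rewrite integral_indic//; last by apply: measurable_tuple_box => i; exact: measurable_itv.
rewrite setIT [LHS](@lebesgue_tuple_box R n (cell_side c)); last by move=> i; exact: measurable_itv.
rewrite (eq_bigr (fun=> (q%:R^-1)%:E)) => [|i _].
  by rewrite prodEFin prodr_const card_ord exprVn.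
rewrite lebesgue_measure_itv/= lte_fin ltrDl invr_gt0 qgt0 -EFinD; congr (_%:E); ring.
Qed.

Lemma integrable_cell c : mu.-integrable [set: T] (fun t => (\1_(cell c) t)%:E).
Proof.
apply: integrable_tuple_box => i; first exact: measurable_itv.
by rewrite lebesgue_measure_itv/= lte_fin ltrDl invr_gt0 qgt0 -EFinD.
Qed.

Let grid_point_inj : injective (@grid_point R n q H).
Proof.
move=> c d /rowP cd; apply/ffunP => i; apply: val_inj; apply/eqP; rewrite -(eqr_nat R).
have := cd i; rewrite !mxE => /(mulIf (invr_neq0 (lt0r_neq0 qgt0))) /addIr ->.
exact: eqxx.
Qed.

Lemma mesh_sumE t : f (mesh_floor t) = \sum_(c : grid_index n q H) f (grid_point R c) * \1_(cell c) t.
Proof.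
have [[c ct]|nc] := pselect (exists c, cell c t).
  rewrite (bigD1 c)//= big1 => [|d dc].
    by rewrite indicE mem_set// mulr1 addr0; congr f; exact/cellP.
  rewrite indicE memNset ?mulr0// => dt; move/eqP: dc; apply.
  by apply: grid_point_inj; move/cellP : ct => <-; move/cellP : dt => <-.
rewrite big1 => [|c _]; last first.
  by rewrite indicE memNset ?mulr0// => ct; apply: nc; exists c.
apply/eqP; apply: contra_notT nc => /fH fz.
pose z i := Num.floor (q%:R * tnth t i).
have zr i : (absz (z i) <= q * H)%N.
  have := fz i; rewrite mxE normrM normfV (gtr0_norm qgt0) ler_pdivrMr//.
  by rewrite -intr_norm -natrM -natr_absz ler_nat mulnC.
have zi i : (absz (z i + (grid_radius q H)%:Z)%R < (2 * grid_radius q H).+1)%N.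
  by have := zr i; rewrite /grid_radius; clear -q0; nia.
exists [ffun i => Ordinal (zi i)]; apply/cellP; apply/rowP => i.
rewrite !mxE ffunE/=; congr (_ / _).
have -> : (absz (z i + (grid_radius q H)%:Z)%R)%:R = (z i + (grid_radius q H)%:Z)%:~R :> R.
  rewrite pmulrn gez0_abs//.
  by have := zr i; rewrite /grid_radius; clear -q0; nia.
by rewrite intrD -pmulrn addrK.
Qed.

Lemma integral_mesh : (\int[mu]_t (f (mesh_floor t))%:E)%E = (riemann_sum f H q)%:E.
Proof.
under eq_integral do rewrite mesh_sumE -sumEFin.
rewrite integral_sum//; last first.
  by move=> c; under eq_fun do rewrite EFinM; exact/integrableZl/integrable_cell.
rewrite /riemann_sum mulr_sumr -sumEFin; apply: eq_bigr => c _.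
under eq_integral do rewrite EFinM.
by rewrite integralZl//; [rewrite integral_cell -EFinM mulrC|exact: integrable_cell].
Qed.

Lemma measurable_mesh : measurable_fun [set: T] (fun t => f (mesh_floor t)).
Proof.
under eq_fun do rewrite mesh_sumE.
apply: measurable_sum => c; apply: measurable_funM => //.
by apply: measurable_indic; apply: measurable_tuple_box => i; exact: measurable_itv.
Qed.

End Mesh.

Let g (t : T) : R := f (\row_(i < n) tnth t i).

Let mesh_cvg t : f (mesh_floor q t) @[q --> \oo] --> g t.
Proof.
apply/cvgrPdist_le => /= e e0.
have := compactly_supported_unif cf suppf e0 => unif; near=> q.
have q0 : 0 < q%:R :> R by rewrite ltr0n; near: q; exact: nbhs_infty_gt.
apply: (near unif q) => // i; rewrite !mxE ger0_norm; last first.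
  by rewrite subr_ge0 ler_pdivrMr// mulrC floor_le.
have := floorD1_gt (q%:R * tnth t i); rewrite intrD => /ltW h.
by rewrite lerBlDr -{1}[q%:R^-1]mul1r -mulrDl ler_pdivlMr// mulrC addrC.
Unshelve. all: by end_near. Qed.

Let bounded_f : exists M, forall z, `|f z| <= M.
Proof.
have [M [_ HM]] := compact_bounded (continuous_compact (continuous_subspaceT cf) suppf).
exists (Num.max 0 (M + 1)) => z; rewrite le_max; apply/orP.
have [->|fz] := eqVneq (f z) 0; first by left; rewrite normr0.
right; apply: HM; first by rewrite ltrDl.
by exists z => //; exact: subset_closure.
Qed.

(** A Riemann sum is the integral of a step function, [f] after rounding down to the mesh. Uniform
    continuity gives pointwise convergence, and a multiple of the indicator of a box dominates. *)
Lemma riemann_sum_cvg : riemann_sum f H q @[q --> \oo] --> integral_rV f.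
Proof.
have [M HM] := bounded_f.
have M0 : 0 <= M by apply: le_trans (HM 0).
(* Rounding moves a coordinate by at most 1, hence the radius H + 1. *)
pose A (i : 'I_n) : set (measurableTypeR R) := [set` `[- (H + 1)%:R, (H + 1)%:R]%R].
pose B : set T := [set t | forall i, A i (tnth t i)].
have iB : mu.-integrable [set: T] (fun t => (\1_B t)%:E).
  apply: integrable_tuple_box => i; first exact: measurable_itv.
  by rewrite lebesgue_measure_itv/=; case: ifP => // _; rewrite -EFinD.
(* Measurability for the coordinate sigma-algebra is inherited from the step functions. *)
have mg : measurable_fun [set: T] g.
  apply: (@measurable_fun_cvg _ _ _ _ (fun q t => f (mesh_floor q.+1 t))).
    by move=> q; exact: measurable_mesh.
  move=> t _; rewrite (cvg_shiftS (fun q => f (mesh_floor q t))); exact: mesh_cvg.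
have mf q := (measurable_EFinP _ _).2 (measurable_mesh (ltn0Sn q)).
have lim : \forall t \ae mu, setT t -> (f (mesh_floor q.+1 t))%:E @[q --> \oo] --> (g t)%:E.
  apply: aeW => t _; apply: cvg_EFin; first exact: nearW.
  by rewrite (cvg_shiftS (fun q => f (mesh_floor q t))); exact: mesh_cvg.
have dom : \forall t \ae mu, forall q, setT t ->
    (`|(f (mesh_floor q.+1 t))%:E| <= M%:E * (\1_B t)%:E)%E.
  apply: aeW => t q _; rewrite -EFinM lee_fin.
  have [->|fz] := eqVneq (f (mesh_floor q.+1 t)) 0; first by rewrite normr0 mulr_ge0.
  suff -> : \1_B t = 1 :> R by rewrite mulr1.
  rewrite indicE mem_set// => i; rewrite /A/= in_itv/=.
  have := fH fz i; rewrite mxE ler_norml => /andP[h1 h2].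
  have q0 : 0 < q.+1%:R :> R by rewrite ltr0n.
  have := floorD1_gt (q.+1%:R * tnth t i); have := floor_le (q.+1%:R * tnth t i).
  move: h1 h2; rewrite intrD; set y := _%:~R; rewrite ler_pdivlMr// ler_pdivrMr// => h1 h2 h3 h4.
  have q1 : 1 <= q.+1%:R :> R by rewrite ler1n.
  rewrite -(ler_pM2l q0) -[X in _ && X](ler_pM2l q0) natrD; apply/andP; split; lra.
have [ig _] := dominated_convergence measurableT mf ((measurable_EFinP _ _).2 mg) lim
  (integrableZl measurableT M iB) dom.
under eq_fun do rewrite integral_mesh//.
have -> : (\int[mu]_t (g t)%:E)%E = (integral_rV f)%:E.
  by rewrite /integral_rV /Rintegral fineK//; apply: integrable_fin_num.
by move=> /fine_cvgP[_]; rewrite (cvg_shiftS (riemann_sum f H)).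
Qed.

End RiemannSums.

(** * Signed test functions and the exceptional null set *)

Lemma compactly_supportedS (R : realType) (n : nat) (f g : 'rV[R]_n -> R) :
  compactly_supported f -> (forall z, g z != 0 -> f z != 0) -> compactly_supported g.
Proof.
move=> suppf gf; apply: subclosed_compact suppf _; first exact: closed_closure.
exact: closure_subset.
Qed.

Lemma correlationD (R : realType) (k : nat) (f g : 'rV[R]_k.-1 -> R) (theta : nat -> R) (N : nat) :
  (0 < k)%N -> (0 < N)%N -> compactly_supported f -> compactly_supported g ->
  correlation (fun z => f z + g z) theta N = correlation f theta N + correlation g theta N.
Proof.
move=> k0 N0 /compactly_supported_bounded[Hf fH] /compactly_supported_bounded[Hg gH].
rewrite !correlationE// -mulrDr -big_split/=; congr (_ * _); apply: eq_bigr => x _.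
have [Kf HKf] := lattice_box theta (indices x) fH; have [Kg HKg] := lattice_box theta (indices x) gH.
have fK m : f (N%:R *: (gap_vector k theta (indices x) - map_mx intr m)) != 0 ->
    forall i, (`|m ord0 i| <= maxn Kf Kg)%N.
  by move=> /(HKf _ N0) h i; apply: leq_trans (h i) (leq_maxl _ _).
have gK m : g (N%:R *: (gap_vector k theta (indices x) - map_mx intr m)) != 0 ->
    forall i, (`|m ord0 i| <= maxn Kf Kg)%N.
  by move=> /(HKg _ N0) h i; apply: leq_trans (h i) (leq_maxr _ _).
rewrite /lattice_sum !(@fsbig_box _ _ (maxn Kf Kg))//; first by rewrite big_split.
move=> m; apply: contra_neqP => mK.
have [->|/fK//] := eqVneq (f (N%:R *: (gap_vector k theta (indices x) - map_mx intr m))) 0.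
by have [->|/gK//] := eqVneq (g (N%:R *: (gap_vector k theta (indices x) - map_mx intr m))) 0; rewrite addr0.
Qed.

(** Writing f = (f + |f|) - |f| reduces the claim to nonnegative continuous functions; the two
    limits recombine because Riemann sums are linear in the test function. *)
Lemma correlation_cvg (R : realType) (k : nat) (theta : nat -> R) (f : 'rV[R]_k.-1 -> R) :
  (0 < k)%N ->
  (forall q (s : seq int), (0 < q)%N ->
    correlation (@tent_test R k.-1 q s) theta (m ^ 4) @[m --> \oo] --> (q%:R ^- k.-1 : R)) ->
  continuous f -> compactly_supported f ->
  correlation f theta N @[N --> \oo] --> integral_rV f.
Proof.
move=> k0 tents cf suppf.
have cn : continuous (fun z => `|f z|) by move=> z; apply: (@continuous_comp _ _ _ f Num.norm); [exact: cf|exact: norm_continuous].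
have cp : continuous (fun z => f z + `|f z|) by move=> z; exact: (cvgD (cf z) (cn z)).
have suppn : compactly_supported (fun z => `|f z|).
  by apply: compactly_supportedS suppf _ => z; rewrite normr_eq0.
have suppp : compactly_supported (fun z => f z + `|f z|).
  by apply: compactly_supportedS suppf _ => z; apply: contra_neq => ->; rewrite normr0 addr0.
have [H fH] := compactly_supported_bounded suppf.
have nH z : `|f z| != 0 -> forall i, `|z ord0 i| <= H%:R by rewrite normr_eq0; exact: fH.
have pH z : f z + `|f z| != 0 -> forall i, `|z ord0 i| <= H%:R.
  by move=> h; apply: fH; apply: contra_neq h => ->; rewrite normr0 addr0.
have limn := riemann_sum_cvg cn suppn nH; have limp := riemann_sum_cvg cp suppp pH.
have lim : riemann_sum f H q @[q --> \oo] -->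
    integral_rV (fun z => f z + `|f z|) - integral_rV (fun z => `|f z|).
  have E q : riemann_sum f H q = riemann_sum (fun z => f z + `|f z|) H q -
      riemann_sum (fun z => `|f z|) H q by rewrite /riemann_sum -mulrBr big_split/= addrK.
  by under eq_fun do rewrite E; exact: cvgB.
rewrite (cvg_unique _ (riemann_sum_cvg cf suppf fH) lim)//.
have cp' := correlation_cvg_nonneg k0 tents cp suppp _ pH limp.
have cn' := correlation_cvg_nonneg k0 tents cn suppn (fun z => normr_ge0 _) nH limn.
rewrite -cvg_shiftS.
have E N : correlation f theta N.+1 =
    correlation (fun z => f z + `|f z|) theta N.+1 - correlation (fun z => `|f z|) theta N.+1.
  by rewrite (correlationD (f := f))// addrK.
under eq_fun do rewrite E; apply: cvgB.
  rewrite (cvg_shiftS (correlation (fun z => f z + `|f z|) theta)); apply: cp' => z.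
  by have := ler_norm (- f z); rewrite normrN; lra.
by rewrite (cvg_shiftS (correlation (fun z => `|f z|) theta)).
Qed.

Lemma integer_box_cover (R : realType) (x : R) : 0 < x -> exists j : nat, j.+1%:R^-1 <= x <= j.+1%:R.
Proof.
move=> x0; exists (Num.truncn x + Num.truncn x^-1)%N.
have h1 := truncnS_gt x; have h2 := truncnS_gt x^-1.
apply/andP; split.
  rewrite -[leRHS]invrK lef_pV2 ?posrE ?invr_gt0//; apply: le_trans (ltW h2) _.
  by rewrite ler_nat ltnS leq_addl.
by apply: le_trans (ltW h1) _; rewrite ler_nat ltnS leq_addr.
Qed.

Theorem theorem1p2 (R : realType) (a : nat -> R)
  (apos : forall n, (1 <= n)%N -> 0 < a n)
  (aincr : forall m n, (1 <= m)%N -> (m < n)%N -> a m < a n)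
  (agrowth : a n / ln (n%:R : R) @[n --> \oo] --> +oo)
  (agap : exists2 C : R, 0 < C &
    \forall n \near \oo, n%:R `^ (- C) <= a n.+1 - a n) :
  {ae (@lebesgue_measure R), forall alpha : R, 0 < alpha ->
    forall k : nat, (2 <= k)%N ->
      poissonian k (fun n => fractional_part (expR (alpha * a n)))}.
Proof.
(* All parameters are natural numbers, the list s through its code i, so the exceptional sets form a
   countable union. The intervals from 1 / (j + 1) to j + 1 exhaust alpha > 0. *)
pose P (j k q i : nat) (alpha : R) := (0 < k)%N -> (0 < q)%N -> forall s : seq int, choice.unpickle i = Some s ->
  j.+1%:R^-1 <= alpha -> alpha <= j.+1%:R ->
  correlation (@tent_test R k.-1 q s) (fun n => expR (alpha * a n)) (m ^ 4)
    @[m --> \oo] --> (q%:R ^- k.-1 : R).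
have aeP j k q i : {ae (@lebesgue_measure R), forall alpha, P j k q i alpha}.
  have [k0|k0] := posnP k; first by apply: aeW => alpha; rewrite /P k0.
  have [q0|q0] := posnP q; first by apply: aeW => alpha; rewrite /P q0.
  case Es : (choice.unpickle i : option (seq int)) => [s|]; last by apply: aeW => alpha _ _ s'; rewrite Es.
  have j0 : 0 < j.+1%:R :> R by [].
  have jj : j.+1%:R^-1 <= j.+1%:R :> R.
    by apply: (@le_trans _ _ 1); rewrite ?invf_le1// ler1n.
  have F := ae_filter_ringOfSetsType (@lebesgue_measure R).
  have j1 : 0 < j.+1%:R^-1 :> R by rewrite invr_gt0.
  apply: filterS (tent_correlation_ae apos aincr agrowth agap s k0 q0 j1 jj).
  by move=> alpha h _ _ s'; rewrite Es => -[<-].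
have all_P : {ae (@lebesgue_measure R), forall alpha, forall j k q i, P j k q i alpha}.
  do 4![apply: ae_foralln => ?]; exact: aeP.
have F := ae_filter_ringOfSetsType (@lebesgue_measure R).
apply: filterS all_P => alpha HP alpha0 k k2 f sf suppf.
have [j /andP[j1 j2]] := integer_box_cover alpha0.
under eq_fun do rewrite correlation_fractional_part.
have k0 : (0 < k)%N by exact: ltnW.
apply: correlation_cvg => //; last by have [] := sf 0%N.
by move=> q s q0; apply: (HP j k q (choice.pickle s) k0 q0 s) => //; rewrite choice.pickleK.
Qed.
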